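(* Let $0<q<1$. There exists a faithful admissible commutator representation $(\pi,F)$ of the $3D$-calculus on $SU_q(2)$.
   Context: **The algebra.** $0<q<1$; $\mathcal{A}=\mathcal{O}(SU_q(2))$ is the Hopf $\ast$-algebra generated by $a,b,c,d$ with $ab=qba$, $ac=qca$, $bd=qdb$, $cd=qdc$, $bc=cb$, $ad-qbc=da-q^{-1}bc=1$; $\Delta(a)=a\otimes a+b\otimes c$, $\Delta(b)=a\otimes b+b\otimes d$, $\Delta(c)=c\otimes a+d\otimes c$, $\Delta(d)=c\otimes b+d\otimes d$; $\varepsilon(a)=\varepsilon(d)=1$, $\varepsilon(b)=\varepsilon(c)=0$; $S(a)=d$, $S(d)=a$, $S(b)=-q^{-1}b$, $S(c)=-qc$; $a^*=d$, $b^*=-qc$, $c^*=-q^{-1}b$, $d^*=a$. Sweedler notation: $\Delta(x)=x_{(1)}\otimes x_{(2)}$. **Differential calculi.** A first order differential calculus (FODC) over a unital $\ast$-algebra $\mathcal{A}$ is an $\mathcal{A}$-bimodule $\Gamma$ with a linear map $\mathrm{d}:\mathcal{A}\to\Gamma$ such that $\mathrm{d}(xy)=x\,\mathrm{d}y+\mathrm{d}x\,y$ and $\Gamma=\mathrm{Lin}\{x\,\mathrm{d}y\,z\}$. It is a $\ast$-FODC if it is equipped with an (antilinear) involution with $(x\,\mathrm{d}y\,z)^*=z^*\mathrm{d}(y^* )x^*$. A homomorphism of FODC $\Gamma_1\to\Gamma_2$ is a linear map $\rho$ with $\rho(x\,\mathrm{d}_1y\,z)=x\,\mathrm{d}_2y\,z$;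 for $\ast$-FODC one also requires $\rho(\omega^* )=\rho(\omega)^*$. An FODC over a Hopf algebra is left-covariant if there is a linear map $\varphi:\Gamma\to\mathcal{A}\otimes\Gamma$ with $\varphi(x\,\mathrm{d}y)=\Delta(x)(\mathrm{id}\otimes\mathrm{d})\Delta(y)$. Put $\omega_\Gamma(x)=S(x_{(1)})\mathrm{d}x_{(2)}$ and $\mathcal{R}_\Gamma=\{x\in\ker\varepsilon:\omega_\Gamma(x)=0\}$; this is a right ideal which determines $\Gamma$ up to isomorphism, and every right ideal contained in $\ker\varepsilon$ occurs. The $3D$-calculus is the left-covariant $\ast$-FODC over $\mathcal{O}(SU_q(2))$ whose right ideal is generated by $b^2,\ c^2,\ bc,\ (a-1)b,\ (a-1)c,\ q^2a+d-(q^2+1)$. **Commutator representations.** Let $\pi$ be a $\ast$-representation of $\mathcal{A}$ by bounded operators on a Hilbert space and $F$ a symmetric operator on that space with dense domain $\mathcal{D}(F)$; let $\mathcal{D}_F\subseteq\mathcal{D}(F)$ be a dense linear subspace with $\pi(\mathcal{A})\mathcal{D}_F\subseteq\mathcal{D}(F)$. $\Gamma_{\pi,F}$ is the span of the operators $\pi(x)(F\pi(y)-\pi(y)F)\pi(z)\lceil\mathcal{D}_F$ (restriction to $\mathcal{D}_F$), with bimodule structure given by multiplication by $\pi(x)$ from left and right, differential $\mathrm{d}_{\pi,F}(x)=(\mathrm{i}F\pi(x)-\pi(x)\mathrm{i}F)\lceil\mathcal{D}_F$ and involution $\big(\sum_j\pi(x_j)(F\pi(y_j)-\pi(y_j)F)\pi(z_j)\lceil\mathcal{D}_F\big)^*=\sum_j\pi(z_j^*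 )(\pi(y_j^* )F-F\pi(y_j^* ))\pi(x_j^* )\lceil\mathcal{D}_F$; it is a $\ast$-FODC. $(\pi,F)$ is a commutator representation of a $\ast$-FODC $\Gamma$ if there is a $\ast$-FODC homomorphism $\rho:\Gamma\to\Gamma_{\pi,F}$; it is faithful if $\rho$ is injective. **Admissibility.** A commutator representation $(\pi,F)$ is admissible if there are linear subspaces $\mathcal{E}\subseteq\ker\pi(c)$ and $\mathcal{D}_0\subseteq\ker\pi(a)$ with $\pi(a)\mathcal{E}\subseteq\mathcal{E}$, $\pi(d)\mathcal{E}\subseteq\mathcal{E}$, $\pi(b)\mathcal{D}_0\subseteq\mathcal{D}_0$, $\pi(c)\mathcal{D}_0\subseteq\mathcal{D}_0$ such that $\mathcal{D}_F:=\mathcal{E}+\mathrm{Lin}\{\pi(d^n)\mathcal{D}_0:n\in\mathbb{N}_0\}$ is contained in $\mathcal{D}(F)$ and is a core for $F$; this $\mathcal{D}_F$ is the domain used in the commutator representation. *)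

(* Defs.v *)
From HB Require Import structures.
From mathcomp Require Import all_boot all_order all_algebra.
From mathcomp Require Import sesquilinear complex.
From mathcomp Require Import boolp classical_sets functions reals topology.
From mathcomp Require Import normedtype.

Set Implicit Arguments.
Unset Strict Implicit.
Unset Printing Implicit Defensive.

Import Order.TTheory GRing.Theory Num.Theory.
Import numFieldNormedType.Exports.

Local Open Scope classical_set_scope.
Local Open Scope ring_scope.
Local Open Scope complex_scope.
Local Open Scope quotient_scope.

Definition bilin (K : fieldType) (U V W : lmodType K) (f : U -> V -> W) :=
  (forall v, linear (f^~ v)) /\ (forall u, linear (f u)).

Lemma is_linear_sum (K : fieldType) (U V : lmodType K) (f : U -> V) :
  linear f -> forall (I : Type) (r : seq I) (F : I -> U),
  f (\sum_(i <- r) F i) = \sum_(i <- r) f (F i).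
Proof.
move=> lf I r F; have f0 : f 0 = 0.
  have := lf 1 0 0; rewrite !scale1r addr0 => /eqP.
  by rewrite -subr_eq subrr eq_sym => /eqP.
apply: (big_morph f _ f0) => x y; by rewrite -[x]scale1r lf !scale1r.
Qed.

Section Tensor.
Variables (K : fieldType) (V W : lmodType K).

(* A list of pairs (v_i, w_i) stands for the formal sum of the v_i (x) w_i; this
   is the least congruence making (x) bilinear. *)
Inductive tensor_eq : seq (V * W) -> seq (V * W) -> Prop :=
| TeqRefl s : tensor_eq s s
| TeqSym s t : tensor_eq s t -> tensor_eq t s
| TeqTrans s t u : tensor_eq s t -> tensor_eq t u -> tensor_eq s u
| TeqCat s s' t t' :
    tensor_eq s s' -> tensor_eq t t' -> tensor_eq (s ++ t) (s' ++ t')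
| TeqCatC s t : tensor_eq (s ++ t) (t ++ s)
| TeqAddl v v' w : tensor_eq [:: (v + v', w)] [:: (v, w); (v', w)]
| TeqAddr v w w' : tensor_eq [:: (v, w + w')] [:: (v, w); (v, w')]
| TeqScale k v w : tensor_eq [:: (k *: v, w)] [:: (v, k *: w)]
| TeqZero w : tensor_eq [:: (0, w)] [::].

Definition tensor_eqb s t := `[< tensor_eq s t >].

Lemma tensor_eqb_refl : reflexive tensor_eqb.
Proof. by move=> s; apply/asboolP/TeqRefl. Qed.
Lemma tensor_eqb_sym : symmetric tensor_eqb.
Proof. by move=> s t; apply/asboolP/asboolP => /TeqSym. Qed.
Lemma tensor_eqb_trans : transitive tensor_eqb.
Proof.
by move=> t s u /asboolP st /asboolP tu; apply/asboolP/(TeqTrans st tu).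
Qed.

Canonical tensor_equiv :=
  EquivRel tensor_eqb tensor_eqb_refl tensor_eqb_sym tensor_eqb_trans.

Definition tensor : Type := {eq_quot tensor_equiv}.
HB.instance Definition _ := Choice.on tensor.
HB.instance Definition _ := EqQuotient.on tensor.

Definition tclass (s : seq (V * W)) : tensor := \pi_tensor s.
Definition tens (v : V) (w : W) : tensor := tclass [:: (v, w)].

Lemma tclassE s t : tensor_eq s t <-> tclass s = tclass t.
Proof.
split=> [st|]; first by apply/eqquotP/asboolP.
by move=> /eqquotP/asboolP.
Qed.

Lemma tensor_eq_repr s : tensor_eq (repr (tclass s)) s.
Proof. by apply/tclassE; rewrite /tclass reprK. Qed.

Lemma tclassP (t : tensor) : exists s, t = tclass s.
Proof. by exists (repr t); rewrite /tclass reprK. Qed.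

Definition tscale1 k (s : seq (V * W)) := [seq (k *: p.1, p.2) | p <- s].

Lemma tensor_eq_scale k s t :
  tensor_eq s t -> tensor_eq (tscale1 k s) (tscale1 k t).
Proof.
elim=> {s t} [s|s t _|s t u _ + _|s s' t t' _ + _|s t|v v' w|v w w'|l v w|w].
- exact: TeqRefl.
- exact: TeqSym.
- exact: TeqTrans.
- rewrite /tscale1 !map_cat; exact: TeqCat.
- rewrite /tscale1 !map_cat; exact: TeqCatC.
- rewrite /tscale1 /= scalerDr; exact: TeqAddl.
- exact: TeqAddr.
- rewrite /tscale1 /= scalerA mulrC -scalerA; exact: TeqScale.
- rewrite /tscale1 /= scaler0; exact: TeqZero.
Qed.

Definition tzero : tensor := tclass [::].
Definition tadd (x y : tensor) : tensor := tclass (repr x ++ repr y).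
Definition tscale k (x : tensor) : tensor := tclass (tscale1 k (repr x)).
Definition topp (x : tensor) : tensor := tscale (-1) x.

Lemma taddE s t : tadd (tclass s) (tclass t) = tclass (s ++ t).
Proof. by apply/tclassE/TeqCat; apply: tensor_eq_repr. Qed.

Lemma tscaleE k s : tscale k (tclass s) = tclass (tscale1 k s).
Proof. by apply/tclassE/tensor_eq_scale/tensor_eq_repr. Qed.

Lemma taddA : associative tadd.
Proof.
move=> x y z; have [s ->] := tclassP x; have [t ->] := tclassP y.
have [u ->] := tclassP z.
by rewrite !taddE catA.
Qed.
Lemma taddC : commutative tadd.
Proof.
move=> x y; have [s ->] := tclassP x; have [t ->] := tclassP y.
by rewrite !taddE; apply/tclassE/TeqCatC.
Qed.
Lemma tadd0 : left_id tzero tadd.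
Proof. by move=> x; have [s ->] := tclassP x; rewrite taddE. Qed.

Lemma tensor_eq_cancel s : tensor_eq (tscale1 (-1) s ++ s) [::].
Proof.
elim: s => [|[v w] s IH]; first exact: TeqRefl.
have -> : tscale1 (-1) ((v, w) :: s) ++ (v, w) :: s
  = [:: (- v, w)] ++ tscale1 (-1) s ++ ([:: (v, w)] ++ s).
  by rewrite /= scaleN1r.
apply: (@TeqTrans _ ([:: (- v, w)] ++ ([:: (v, w)] ++ (tscale1 (-1) s ++ s)))).
  apply: TeqCat; first exact: TeqRefl.
  rewrite !catA; apply: TeqCat; [exact: TeqCatC | exact: TeqRefl].
rewrite catA -[[::]]/([::] ++ [::]); apply: TeqCat IH.
apply: TeqTrans (TeqZero w); rewrite -(addNr v); apply: TeqSym; exact: TeqAddl.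
Qed.

Lemma taddN : left_inverse tzero topp tadd.
Proof.
move=> x; have [s ->] := tclassP x; rewrite /topp tscaleE taddE.
by apply/tclassE/tensor_eq_cancel.
Qed.

HB.instance Definition _ := GRing.isZmodule.Build tensor taddA taddC tadd0 taddN.

Lemma tscaleA a b x : tscale a (tscale b x) = tscale (a * b) x.
Proof.
have [s ->] := tclassP x; rewrite !tscaleE /tscale1 -map_comp; congr tclass.
by apply: eq_map => p /=; rewrite scalerA.
Qed.
Lemma tscale1r : left_id 1 tscale.
Proof.
move=> x; have [s ->] := tclassP x; rewrite !tscaleE /tscale1; congr tclass.
by rewrite -[RHS]map_id; apply: eq_map => -[v w] /=; rewrite scale1r.
Qed.
Lemma tscaleDr : right_distributive tscale +%R.
Proof.
move=> k x y; have [s ->] := tclassP x; have [t ->] := tclassP y.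
by rewrite /GRing.add /= taddE !tscaleE taddE /tscale1 map_cat.
Qed.
Lemma tensor_eq_scaleD a b s :
  tensor_eq (tscale1 (a + b) s) (tscale1 a s ++ tscale1 b s).
Proof.
elim: s => [|[v w] s IH]; first exact: TeqRefl.
rewrite /= scalerDl.
apply: (@TeqTrans _ ([:: (a *: v, w); (b *: v, w)] ++
          (tscale1 a s ++ tscale1 b s))).
  exact: (@TeqCat [:: _] _ _ _ (TeqAddl _ _ _) IH).
apply: (@TeqCat [:: _] [:: _] (_ :: _) (_ ++ _ :: _)); first exact: TeqRefl.
rewrite -[_ :: tscale1 b s]cat1s catA.
exact: (TeqCat (TeqCatC [:: _] _) (TeqRefl _)).
Qed.
Lemma tscaleDl v : {morph tscale^~ v : a b / a + b}.
Proof.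
move=> a b; have [s ->] := tclassP v.
rewrite /GRing.add /= !tscaleE taddE; apply/tclassE/tensor_eq_scaleD.
Qed.

HB.instance Definition _ := GRing.Zmodule_isLmodule.Build K tensor
  tscaleA tscale1r tscaleDr tscaleDl.

Lemma tclass_sum s : tclass s = \sum_(p <- s) tens p.1 p.2.
Proof.
elim: s => [|[v w] s IH]; first by rewrite big_nil.
by rewrite big_cons -IH /GRing.add /= taddE.
Qed.

Lemma tens_bilin : bilin tens.
Proof.
split=> [w a v v'|v a w w']; rewrite /GRing.add /GRing.scale /= tscaleE taddE.
  by apply/tclassE/TeqAddl.
apply/tclassE; apply: TeqTrans (TeqAddr _ _ _) _.
apply: (@TeqCat [:: _] [:: _] [:: _] [:: _]); last exact: TeqRefl.
by apply: TeqSym; apply: TeqScale.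
Qed.

Definition tlift (U : lmodType K) (f : V -> W -> U) (t : tensor) : U :=
  \sum_(p <- repr t) f p.1 p.2.

Section TLift.
Variables (U : lmodType K) (f : V -> W -> U).
Hypothesis bf : bilin f.

Lemma bilin0l w : f 0 w = 0.
Proof.
by have := is_linear_sum (bf.1 w) (Nil nat) (fun=> 0); rewrite !big_nil.
Qed.
Lemma bilin0r v : f v 0 = 0.
Proof.
by have := is_linear_sum (bf.2 v) (Nil nat) (fun=> 0); rewrite !big_nil.
Qed.
Lemma bilinZl k v w : f (k *: v) w = k *: f v w.
Proof. by have := bf.1 w k v 0; rewrite bilin0l !addr0. Qed.
Lemma bilinZr k v w : f v (k *: w) = k *: f v w.
Proof. by have := bf.2 v k w 0; rewrite bilin0r !addr0. Qed.
Lemma bilinDl v v' w : f (v + v') w = f v w + f v' w.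
Proof. by have := bf.1 w 1 v v'; rewrite !scale1r. Qed.
Lemma bilinDr v w w' : f v (w + w') = f v w + f v w'.
Proof. by have := bf.2 v 1 w w'; rewrite !scale1r. Qed.

Lemma tensor_eq_lift s t : tensor_eq s t ->
  \sum_(p <- s) f p.1 p.2 = \sum_(p <- t) f p.1 p.2.
Proof.
elim=> {s t} [s|s t _ ->|s t u _ -> _|s s' t t' _ + _ +|s t|v v' w|v w w'|k v w|w] //.
- by rewrite !big_cat /= => -> ->.
- by rewrite !big_cat /= addrC.
- by rewrite !big_cons big_nil !addr0 /= bilinDl.
- by rewrite !big_cons big_nil !addr0 /= bilinDr.
- by rewrite !big_cons big_nil !addr0 /= bilinZl bilinZr.
- by rewrite !big_cons big_nil !addr0 /= bilin0l.
Qed.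

Lemma tlift_class s : tlift f (tclass s) = \sum_(p <- s) f p.1 p.2.
Proof. exact/tensor_eq_lift/tensor_eq_repr. Qed.

Lemma tlift_tens v w : tlift f (tens v w) = f v w.
Proof. by rewrite tlift_class big_cons big_nil addr0. Qed.

Lemma tlift_linear : linear (tlift f).
Proof.
move=> k x y; have [s ->] := tclassP x; have [t ->] := tclassP y.
rewrite {1}/GRing.add {1}/GRing.scale /= tscaleE taddE !tlift_class big_cat /=.
congr (_ + _); rewrite /tscale1 big_map scaler_sumr; apply: eq_bigr => p _ /=.
exact: bilinZl.
Qed.
End TLift.

End Tensor.

Section TensorAction.
Variables (K : fieldType) (A B V W V' W' : lmodType K).
Variables (f : A -> V -> V') (g : B -> W -> W').

(* (a (x) b) (v (x) w) = f a v (x) g b w, extended bilinearly. *)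
Definition tensor_act (t : tensor A B) (u : tensor V W) : tensor V' W' :=
  tlift (fun a b => tlift (fun v w => tens (f a v) (g b w)) u) t.

Hypotheses (bf : bilin f) (bg : bilin g).

Let b2 a b : bilin (fun v w => tens (f a v) (g b w)).
Proof.
have [tl tr] := tens_bilin V' W'.
split=> [w k v v'|v k w w']; first by rewrite bf.2 tl.
by rewrite bg.2 tr.
Qed.

Let b1 u : bilin (fun a b => tlift (fun v w => tens (f a v) (g b w)) u).
Proof.
have [tl tr] := tens_bilin V' W'.
have [s ->] := tclassP u.
split=> [b k a a'|a k b b']; rewrite !tlift_class // scaler_sumr -big_split /=;
  apply: eq_bigr => p _; first by rewrite bf.1 tl.
by rewrite bg.1 tr.
Qed.

Lemma tensor_actE a b v w :
  tensor_act (tens a b) (tens v w) = tens (f a v) (g b w).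
Proof. by rewrite /tensor_act !tlift_tens. Qed.

Lemma tensor_act_bilin : bilin tensor_act.
Proof.
split=> [u|t]; first exact: tlift_linear.
have [s ->] := tclassP t; rewrite /tensor_act.
move=> k u v; rewrite !tlift_class // scaler_sumr -big_split /=.
by apply: eq_bigr => p _; rewrite tlift_linear.
Qed.
End TensorAction.

Lemma tensor_ind (K : fieldType) (V W : lmodType K) (P : tensor V W -> Prop) :
  P 0 -> (forall x y, P x -> P y -> P (x + y)) ->
  (forall v w, P (tens v w)) -> forall t, P t.
Proof.
move=> P0 PD Pt t; have [s ->] := tclassP t; rewrite tclass_sum.
by elim: s => [|p s IH]; rewrite ?big_nil // big_cons; apply: PD.
Qed.

Lemma linear_spec (K : fieldType) (V W : lmodType K) (f : V -> W) : linear f ->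
  [/\ f 0 = 0, {morph f : x y / x + y}, {morph f : x / - x}
    & forall k, {morph f : x / k *: x}].
Proof.
move=> lf; have f0 : f 0 = 0.
  by have := is_linear_sum lf (Nil nat) (fun=> 0); rewrite !big_nil.
have fZ k : {morph f : x / k *: x}.
  by move=> x; have := lf k x 0; rewrite f0 !addr0.
split=> // [x y|x]; first by have := lf 1 x y; rewrite !scale1r.
by rewrite -!scaleN1r fZ.
Qed.

Lemma mulr_bilin (K : fieldType) (A : algType K) : bilin ( *%R : A -> A -> A).
Proof.
by split=> [y k x x'|x k y y']; rewrite ?mulrDl ?mulrDr -?scalerAl -?scalerAr.
Qed.

Section TensorAlgebra.
Variables (K : fieldType) (A : algType K).
Local Notation tmul := (tensor_act ( *%R : A -> A -> A) ( *%R : A -> A -> A)).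

Let bm := mulr_bilin A.

Lemma tmulE (x y x' y' : A) :
  tmul (tens x y) (tens x' y') = tens (x * x') (y * y').
Proof. exact: tensor_actE. Qed.

Lemma tmul_bilin : bilin tmul.
Proof. exact: tensor_act_bilin bm bm. Qed.
Let tm := tmul_bilin.
Let tb := tens_bilin A A.

Let tmulDD (x1 y1 x2 y2 x3 y3 x4 y4 : A) :
  tmul (tens x1 y1 + tens x2 y2) (tens x3 y3 + tens x4 y4) =
  (tens (x1 * x3) (y1 * y3) + tens (x2 * x4) (y2 * y4)) +
  (tens (x1 * x4) (y1 * y4) + tens (x2 * x3) (y2 * y3)).
Proof.
rewrite (bilinDl tm) !(bilinDr tm) !tmulE.
by rewrite [X in _ + X = _]addrC addrACA.
Qed.

Let tZl k (x y : A) : tens (k *: x) y = k *: tens x y.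
Proof. exact: (bilinZl tb). Qed.
Let tZr k (x y : A) : tens x (k *: y) = k *: tens x y.
Proof. exact: (bilinZr tb). Qed.
Let tDl (x x' y : A) : tens (x + x') y = tens x y + tens x' y.
Proof. exact: (bilinDl tb). Qed.
Let tDr (x y y' : A) : tens x (y + y') = tens x y + tens x y'.
Proof. exact: (bilinDr tb). Qed.

Lemma tmulA : associative tmul.
Proof.
have H := (bilin0l tm, bilin0r tm, bilinDl tm, bilinDr tm).
apply: tensor_ind => [y z|x x' Hx Hx' y z|x x']; rewrite ?H ?Hx ?Hx' //.
apply: tensor_ind => [z|y y' Hy Hy' z|y y']; rewrite ?H ?Hy ?Hy' //.
apply: tensor_ind => [|z z' Hz Hz'|z z']; rewrite ?H ?Hz ?Hz' //.
by rewrite !tmulE !mulrA.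
Qed.
Lemma tmul1l : left_id (tens 1 1) tmul.
Proof.
apply: tensor_ind => [|x y Hx Hy|x y]; rewrite ?(bilin0r tm) //.
  by rewrite (bilinDr tm) Hx Hy.
by rewrite tmulE !mul1r.
Qed.
Lemma tmul1r : right_id (tens 1 1) tmul.
Proof.
apply: tensor_ind => [|x y Hx Hy|x y]; rewrite ?(bilin0l tm) //.
  by rewrite (bilinDl tm) Hx Hy.
by rewrite tmulE !mulr1.
Qed.


Section Relations.
Variables (q : K) (a b c d : A).
Hypotheses (q0 : q != 0) (ab : a * b = q *: (b * a)) (ac : a * c = q *: (c * a)).
Hypotheses (bd : b * d = q *: (d * b)) (cd : c * d = q *: (d * c)).
Hypotheses (cb : c * b = b * c) (ad : a * d = 1 + q *: (b * c)).
Hypothesis da : d * a = 1 + q^-1 *: (b * c).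

Let Da := tens a a + tens b c.
Let Db := tens a b + tens b d.
Let Dc := tens c a + tens d c.
Let Dd := tens c b + tens d d.

Lemma tmul_rel :
  [/\ tmul Da Db = q *: tmul Db Da, tmul Da Dc = q *: tmul Dc Da,
      tmul Db Dd = q *: tmul Dd Db & tmul Dc Dd = q *: tmul Dd Dc] /\
  [/\ tmul Db Dc = tmul Dc Db, tmul Da Dd - q *: tmul Db Dc = tens 1 1
    & tmul Dd Da - q^-1 *: tmul Db Dc = tens 1 1].
Proof.
have red := (ab, ac, bd, cd, cb, ad, da).
have lin := (tZl, tZr, tDl, tDr, scalerDr, scalerA).
do 2 split; rewrite !tmulDD !red !lin ?(mulfV q0, mulVf q0, scale1r).
- by congr (_ + _); rewrite [RHS]addrCA addrA.
- by congr (_ + _); rewrite [RHS]addrCA addrA.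
- by congr (_ + _); rewrite [RHS]addrCA addrA.
- by congr (_ + _); rewrite [RHS]addrCA addrA.
- by congr (_ + _); rewrite addrACA [X in X + _ = _]addrC addrACA.
- apply/eqP; rewrite subr_eq; apply/eqP; rewrite [RHS]addrCA; congr (_ + _).
  by rewrite -!addrA; do 2 congr (_ + _); rewrite addrCA.
- apply/eqP; rewrite subr_eq; apply/eqP; rewrite [RHS]addrCA; congr (_ + _).
  by rewrite -!addrA [LHS]addrCA; congr (_ + _); rewrite addrCA.
Qed.
End Relations.
End TensorAlgebra.

Section SUq2.
Variables (R : realType) (q : R).
Local Notation C := R[i].
Local Notation qc := (q%:C).

Inductive su_gen := Ga | Gb | Gc | Gd.

Inductive su_term :=
| TGen of su_gen
| TZero | TOne
| TAdd of su_term & su_term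
| TOpp of su_term
| TMul of su_term & su_term
| TScale of C & su_term.

HB.instance Definition _ := gen_eqMixin su_term.
HB.instance Definition _ := gen_choiceMixin su_term.

Local Notation "x +' y" := (TAdd x y) (at level 50, left associativity).
Local Notation "x *' y" := (TMul x y) (at level 40, left associativity).
Local Notation "k *:' x" := (TScale k x) (at level 40).
Local Notation ta := (TGen Ga).
Local Notation tb := (TGen Gb).
Local Notation tc := (TGen Gc).
Local Notation td := (TGen Gd).

Inductive su_rel : su_term -> su_term -> Prop :=
| SuAB : su_rel (ta *' tb) (qc *:' (tb *' ta))
| SuAC : su_rel (ta *' tc) (qc *:' (tc *' ta))
| SuBD : su_rel (tb *' td) (qc *:' (td *' tb))
| SuCD : su_rel (tc *' td) (qc *:' (td *' tc))
| SuBC : su_rel (tb *' tc) (tc *' tb)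
| SuAD : su_rel (ta *' td +' TOpp (qc *:' (tb *' tc))) TOne
| SuDA : su_rel (td *' ta +' TOpp (qc^-1 *:' (tb *' tc))) TOne.

(* The congruence generated by the axioms of unital complex algebras and by
   the defining relations. *)
Inductive su_eq : su_term -> su_term -> Prop :=
| SuRel s t : su_rel s t -> su_eq s t
| SuRefl s : su_eq s s
| SuSym s t : su_eq s t -> su_eq t s
| SuTrans s t u : su_eq s t -> su_eq t u -> su_eq s u
| SuCongD s s' t t' : su_eq s s' -> su_eq t t' -> su_eq (s +' t) (s' +' t')
| SuCongN s s' : su_eq s s' -> su_eq (TOpp s) (TOpp s')
| SuCongM s s' t t' : su_eq s s' -> su_eq t t' -> su_eq (s *' t) (s' *' t')
| SuCongZ k s s' : su_eq s s' -> su_eq (k *:' s) (k *:' s')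
| SuAddA s t u : su_eq (s +' (t +' u)) (s +' t +' u)
| SuAddC s t : su_eq (s +' t) (t +' s)
| SuAdd0 s : su_eq (TZero +' s) s
| SuAddN s : su_eq (TOpp s +' s) TZero
| SuMulA s t u : su_eq (s *' (t *' u)) (s *' t *' u)
| SuMul1l s : su_eq (TOne *' s) s
| SuMul1r s : su_eq (s *' TOne) s
| SuMulDl s t u : su_eq ((s +' t) *' u) (s *' u +' t *' u)
| SuMulDr s t u : su_eq (s *' (t +' u)) (s *' t +' s *' u)
| SuScaleA k l s : su_eq (k *:' (l *:' s)) ((k * l) *:' s)
| SuScale1 s : su_eq (1 *:' s) s
| SuScaleDr k s t : su_eq (k *:' (s +' t)) (k *:' s +' k *:' t)
| SuScaleDl k l s : su_eq ((k + l) *:' s) (k *:' s +' l *:' s)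
| SuScaleAl k s t : su_eq (k *:' (s *' t)) ((k *:' s) *' t)
| SuScaleAr k s t : su_eq (k *:' (s *' t)) (s *' (k *:' t)).

Definition su_eqb s t := `[< su_eq s t >].
Lemma su_eqb_refl : reflexive su_eqb.
Proof. by move=> s; apply/asboolP/SuRefl. Qed.
Lemma su_eqb_sym : symmetric su_eqb.
Proof. by move=> s t; apply/asboolP/asboolP => /SuSym. Qed.
Lemma su_eqb_trans : transitive su_eqb.
Proof.
by move=> t s u /asboolP st /asboolP tu; apply/asboolP/(SuTrans st tu).
Qed.

Canonical su_equiv := EquivRel su_eqb su_eqb_refl su_eqb_sym su_eqb_trans.

Definition SUq2 : Type := {eq_quot su_equiv}.
HB.instance Definition _ := Choice.on SUq2.
HB.instance Definition _ := EqQuotient.on SUq2.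

Definition su_class (t : su_term) : SUq2 := \pi_SUq2 t.

Lemma su_classE s t : su_eq s t <-> su_class s = su_class t.
Proof.
split=> [st|]; first by apply/eqquotP/asboolP.
by move=> /eqquotP/asboolP.
Qed.
Lemma su_eq_repr t : su_eq (repr (su_class t)) t.
Proof. by apply/su_classE; rewrite /su_class reprK. Qed.
Lemma su_classP (x : SUq2) : exists t, x = su_class t.
Proof. by exists (repr x); rewrite /su_class reprK. Qed.

Definition su_add (x y : SUq2) := su_class (repr x +' repr y).
Definition su_opp (x : SUq2) := su_class (TOpp (repr x)).
Definition su_mul (x y : SUq2) := su_class (repr x *' repr y).
Definition su_scale k (x : SUq2) := su_class (k *:' repr x).

Lemma su_addE s t : su_add (su_class s) (su_class t) = su_class (s +' t).
Proof. by apply/su_classE/SuCongD; apply: su_eq_repr. Qed.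
Lemma su_oppE s : su_opp (su_class s) = su_class (TOpp s).
Proof. by apply/su_classE/SuCongN; apply: su_eq_repr. Qed.
Lemma su_mulE s t : su_mul (su_class s) (su_class t) = su_class (s *' t).
Proof. by apply/su_classE/SuCongM; apply: su_eq_repr. Qed.
Lemma su_scaleE k s : su_scale k (su_class s) = su_class (k *:' s).
Proof. by apply/su_classE/SuCongZ; apply: su_eq_repr. Qed.

Let su_addA : associative su_add.
Proof.
move=> x y z; have [s ->] := su_classP x; have [t ->] := su_classP y.
by have [u ->] := su_classP z; rewrite !su_addE; apply/su_classE/SuAddA.
Qed.
Let su_addC : commutative su_add.
Proof.
move=> x y; have [s ->] := su_classP x; have [t ->] := su_classP y.
by rewrite !su_addE; apply/su_classE/SuAddC.
Qed.
Let su_add0 : left_id (su_class TZero) su_add.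
Proof.
move=> x; have [s ->] := su_classP x.
by rewrite su_addE; apply/su_classE/SuAdd0.
Qed.
Let su_addN : left_inverse (su_class TZero) su_opp su_add.
Proof.
move=> x; have [s ->] := su_classP x.
by rewrite su_oppE su_addE; apply/su_classE/SuAddN.
Qed.
HB.instance Definition _ :=
  GRing.isZmodule.Build SUq2 su_addA su_addC su_add0 su_addN.

Let su_scaleA a b x : su_scale a (su_scale b x) = su_scale (a * b) x.
Proof.
have [s ->] := su_classP x; rewrite !su_scaleE.
by apply/su_classE/SuScaleA.
Qed.
Let su_scale1 : left_id 1 su_scale.
Proof.
by move=> x; have [s ->] := su_classP x; rewrite su_scaleE; apply/su_classE/SuScale1.
Qed.
Let su_scaleDr : right_distributive su_scale +%R.
Proof.
move=> k x y; have [s ->] := su_classP x; have [t ->] := su_classP y.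
rewrite /GRing.add /= su_addE !su_scaleE su_addE.
by apply/su_classE/SuScaleDr.
Qed.
Let su_scaleDl x : {morph su_scale^~ x : a b / a + b}.
Proof.
move=> a b; have [s ->] := su_classP x.
rewrite [in RHS]/GRing.add /= !su_scaleE su_addE.
by apply/su_classE/SuScaleDl.
Qed.
HB.instance Definition _ := GRing.Zmodule_isLmodule.Build C SUq2
  su_scaleA su_scale1 su_scaleDr su_scaleDl.

Lemma su_mulA : associative su_mul.
Proof.
move=> x y z; have [s ->] := su_classP x; have [t ->] := su_classP y.
by have [u ->] := su_classP z; rewrite !su_mulE; apply/su_classE/SuMulA.
Qed.
Lemma su_mul1l : left_id (su_class TOne) su_mul.
Proof.
by move=> x; have [s ->] := su_classP x; rewrite su_mulE; apply/su_classE/SuMul1l.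
Qed.
Lemma su_mul1r : right_id (su_class TOne) su_mul.
Proof.
by move=> x; have [s ->] := su_classP x; rewrite su_mulE; apply/su_classE/SuMul1r.
Qed.
Lemma su_mulDl : left_distributive su_mul +%R.
Proof.
move=> x y z; have [s ->] := su_classP x; have [t ->] := su_classP y.
have [u ->] := su_classP z; rewrite /GRing.add /= su_addE !su_mulE su_addE.
by apply/su_classE/SuMulDl.
Qed.
Lemma su_mulDr : right_distributive su_mul +%R.
Proof.
move=> x y z; have [s ->] := su_classP x; have [t ->] := su_classP y.
have [u ->] := su_classP z; rewrite /GRing.add /= su_addE !su_mulE su_addE.
by apply/su_classE/SuMulDr.
Qed.

Section Eval.
Variables (U : lmodType C) (one : U) (mul : U -> U -> U).
Variables (theta : {rmorphism C -> C}) (f : su_gen -> U).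

(* With theta the conjugation or mul the opposite multiplication, this also
   covers antilinear maps and antihomomorphisms. *)
Fixpoint su_eval (t : su_term) : U :=
  match t with
  | TGen g => f g
  | TZero => 0
  | TOne => one
  | s +' t => su_eval s + su_eval t
  | TOpp s => - su_eval s
  | s *' t => mul (su_eval s) (su_eval t)
  | k *:' s => theta k *: su_eval s
  end.

Definition su_lift (x : SUq2) : U := su_eval (repr x).

Hypotheses (mulA : associative mul) (mul1l : left_id one mul).
Hypotheses (mul1r : right_id one mul) (bmul : bilin mul).
Hypothesis frel : forall s t, su_rel s t -> su_eval s = su_eval t.

Lemma su_eq_eval s t : su_eq s t -> su_eval s = su_eval t.
Proof.
elim=> {s t} /=; try by [move=> *; congruence | exact: frel].
- by move=> *; rewrite addrA.
- by move=> *; rewrite addrC.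
- by move=> *; rewrite add0r.
- by move=> *; rewrite addNr.
- by move=> *; rewrite (bilinDl bmul).
- by move=> *; rewrite (bilinDr bmul).
- by move=> *; rewrite rmorphM scalerA.
- by move=> *; rewrite rmorph1 scale1r.
- by move=> *; rewrite scalerDr.
- by move=> *; rewrite rmorphD scalerDl.
- by move=> *; rewrite (bilinZl bmul).
- by move=> *; rewrite (bilinZr bmul).
Qed.

Lemma su_lift_class t : su_lift (su_class t) = su_eval t.
Proof. exact/su_eq_eval/su_eq_repr. Qed.
End Eval.
End SUq2.

Section SUq2Algebra.
Variables (R : realType) (q : R).
Local Notation C := R[i].
Local Notation qc := (q%:C).
Local Notation A := (SUq2 q).

Definition su_a : A := su_class q (TGen R Ga).
Definition su_b : A := su_class q (TGen R Gb).
Definition su_c : A := su_class q (TGen R Gc).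
Definition su_d : A := su_class q (TGen R Gd).

Definition counit_gen (g : su_gen) : C^o :=
  match g with Ga | Gd => 1 | Gb | Gc => 0 end.

Definition su_counit (x : A) : C := su_lift 1 *%R idfun counit_gen x.

Let counit_rel s t : su_rel q s t ->
  su_eval 1 *%R idfun counit_gen s = su_eval 1 *%R idfun counit_gen t.
Proof.
by case=> /=; rewrite ?(mulr0, mul0r, scaler0, mulr1, oppr0, addr0).
Qed.

Lemma su_counit_class t :
  su_counit (su_class q t) = su_eval 1 *%R idfun counit_gen t.
Proof.
apply: (su_lift_class _ _ _ _ counit_rel).
- exact: mulrA.
- exact: mul1r.
- exact: mulr1.
- exact: mulr_bilin.
Qed.

Lemma su_one_neq0 : su_class q (TOne R) != 0.
Proof.
apply/eqP => /(congr1 su_counit); rewrite /GRing.zero /= !su_counit_class /=.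
by apply/eqP; rewrite oner_neq0.
Qed.

HB.instance Definition _ := GRing.Zmodule_isNzRing.Build A
  (@su_mulA R q) (@su_mul1l R q) (@su_mul1r R q) (@su_mulDl R q) (@su_mulDr R q)
  su_one_neq0.

Let su_scaleAl (k : C) (x y : A) : k *: (x * y) = (k *: x) * y.
Proof.
have [s ->] := su_classP x; have [t ->] := su_classP y.
rewrite /GRing.scale /GRing.mul /= !(su_mulE, su_scaleE).
by apply/su_classE/SuScaleAl.
Qed.
HB.instance Definition _ := GRing.Lmodule_isLalgebra.Build C A su_scaleAl.

Let su_scaleAr (k : C) (x y : A) : k *: (x * y) = x * (k *: y).
Proof.
have [s ->] := su_classP x; have [t ->] := su_classP y.
rewrite /GRing.scale /GRing.mul /= !(su_mulE, su_scaleE).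
by apply/su_classE/SuScaleAr.
Qed.
HB.instance Definition _ := GRing.Lalgebra_isAlgebra.Build C A su_scaleAr.

Lemma su_class0 : su_class q (TZero R) = 0. Proof. by []. Qed.
Lemma su_class1 : su_class q (TOne R) = 1. Proof. by []. Qed.
Lemma su_classD s t : su_class q (TAdd s t) = su_class q s + su_class q t.
Proof. by rewrite /GRing.add /= su_addE. Qed.
Lemma su_classN s : su_class q (TOpp s) = - su_class q s.
Proof. by rewrite /GRing.opp /= su_oppE. Qed.
Lemma su_classM s t : su_class q (TMul s t) = su_class q s * su_class q t.
Proof. by rewrite /GRing.mul /= su_mulE. Qed.
Lemma su_classZ k s : su_class q (TScale k s) = k *: su_class q s.
Proof. by rewrite /GRing.scale /= su_scaleE. Qed.

Lemma su_ind (P : A -> Prop) :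
  P su_a -> P su_b -> P su_c -> P su_d -> P 1 ->
  (forall x y, P x -> P y -> P (x + y)) ->
  (forall x y, P x -> P y -> P (x * y)) ->
  (forall k x, P x -> P (k *: x)) -> forall x, P x.
Proof.
move=> Pa Pb Pc Pd P1 PD PM PZ x; have [t ->] := su_classP x.
elim: t => [[]||||||] //.
- by rewrite su_class0 -(scale0r 1); apply: PZ.
- by move=> s Ps t Pt; rewrite su_classD; apply: PD.
- by move=> s Ps; rewrite su_classN -scaleN1r; apply: PZ.
- by move=> s Ps t Pt; rewrite su_classM; apply: PM.
- by move=> k s Ps; rewrite su_classZ; apply: PZ.
Qed.

Lemma su_ab : su_a * su_b = qc *: (su_b * su_a).
Proof. by rewrite -!su_classM -su_classZ; apply/su_classE/SuRel/SuAB. Qed.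
Lemma su_ac : su_a * su_c = qc *: (su_c * su_a).
Proof. by rewrite -!su_classM -su_classZ; apply/su_classE/SuRel/SuAC. Qed.
Lemma su_bd : su_b * su_d = qc *: (su_d * su_b).
Proof. by rewrite -!su_classM -su_classZ; apply/su_classE/SuRel/SuBD. Qed.
Lemma su_cd : su_c * su_d = qc *: (su_d * su_c).
Proof. by rewrite -!su_classM -su_classZ; apply/su_classE/SuRel/SuCD. Qed.
Lemma su_cb : su_c * su_b = su_b * su_c.
Proof. by rewrite -!su_classM; apply/su_classE/SuSym/SuRel/SuBC. Qed.
Lemma su_ad : su_a * su_d = 1 + qc *: (su_b * su_c).
Proof.
apply/eqP; rewrite -subr_eq -!su_classM -su_classZ -su_classN -su_classD.
by apply/eqP/su_classE/SuRel/SuAD.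
Qed.
Lemma su_da : su_d * su_a = 1 + qc^-1 *: (su_b * su_c).
Proof.
apply/eqP; rewrite -subr_eq -!su_classM -su_classZ -su_classN -su_classD.
by apply/eqP/su_classE/SuRel/SuDA.
Qed.

Section LiftMorphism.
Variables (U : lmodType C) (one : U) (mul : U -> U -> U).
Variables (theta : {rmorphism C -> C}) (f : su_gen -> U).
Hypotheses (mulA : associative mul) (mul1l : left_id one mul).
Hypotheses (mul1r : right_id one mul) (bmul : bilin mul).
Hypothesis frel : forall s t, su_rel q s t ->
  su_eval one mul theta f s = su_eval one mul theta f t.
Local Notation F := (su_lift (q := q) one mul theta f).

Let FE t : F (su_class q t) = su_eval one mul theta f t.
Proof. exact: su_lift_class. Qed.

Lemma su_lift_morphism :
  [/\ F 1 = one, {morph F : x y / x + y >-> x + y},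
      {morph F : x y / x * y >-> mul x y}
    & forall k, {morph F : x / k *: x >-> theta k *: x}] /\
  [/\ F su_a = f Ga, F su_b = f Gb, F su_c = f Gc & F su_d = f Gd].
Proof.
split; last by split; rewrite FE.
split=> [|x y|x y|k x]; first by rewrite -su_class1 FE.
- have [s ->] := su_classP x; have [t ->] := su_classP y.
  by rewrite -su_classD !FE.
- have [s ->] := su_classP x; have [t ->] := su_classP y.
  by rewrite -su_classM !FE.
- by have [s ->] := su_classP x; rewrite -su_classZ !FE.
Qed.
End LiftMorphism.

Lemma su_counit_morphism :
  [/\ su_counit 1 = 1, {morph su_counit : x y / x + y},
      {morph su_counit : x y / x * y}
    & forall k, {morph su_counit : x / k *: x >-> k * x}] /\
  [/\ su_counit su_a = 1, su_counit su_b = 0, su_counit su_c = 0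
    & su_counit su_d = 1].
Proof.
apply: (su_lift_morphism _ _ _ _ counit_rel).
- exact: mulrA.
- exact: mul1r.
- exact: mulr1.
- exact: mulr_bilin.
Qed.

Definition antipode_gen (g : su_gen) : A :=
  match g with
  | Ga => su_d | Gb => - qc^-1 *: su_b | Gc => - qc *: su_c | Gd => su_a
  end.
Definition su_antipode (x : A) : A :=
  su_lift 1 (fun x y => y * x) idfun antipode_gen x.

Definition comul_gen (g : su_gen) : tensor A A :=
  match g with
  | Ga => tens su_a su_a + tens su_b su_c
  | Gb => tens su_a su_b + tens su_b su_d
  | Gc => tens su_c su_a + tens su_d su_c
  | Gd => tens su_c su_b + tens su_d su_d
  end.
Local Notation tmul := (tensor_act ( *%R : A -> A -> A) ( *%R : A -> A -> A)).
Definition su_comul (x : A) : tensor A A :=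
  su_lift (tens 1 1) tmul idfun comul_gen x.

Definition star_gen (g : su_gen) : A :=
  match g with
  | Ga => su_d | Gb => - qc *: su_c | Gc => - qc^-1 *: su_b | Gd => su_a
  end.
Definition su_star (x : A) : A :=
  su_lift 1 (fun x y => y * x) Num.conj star_gen x.

Hypothesis q0 : q != 0.

Let qc0 : qc != 0.
Proof. by rewrite fmorph_eq0. Qed.
Let qJ : Num.conj qc = qc.
Proof. exact: conjc_real. Qed.

Lemma opp_mulr_bilin : bilin (fun x y : A => y * x).
Proof. by have [l r] := mulr_bilin A; split. Qed.

Lemma su_antipode_morphism :
  [/\ su_antipode 1 = 1, {morph su_antipode : x y / x + y},
      {morph su_antipode : x y / x * y >-> y * x}
    & forall k, {morph su_antipode : x / k *: x}] /\
  [/\ su_antipode su_a = su_d, su_antipode su_b = - qc^-1 *: su_b,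
      su_antipode su_c = - qc *: su_c & su_antipode su_d = su_a].
Proof.
apply: su_lift_morphism.
- by move=> x y z; rewrite mulrA.
- exact: mulr1.
- exact: mul1r.
- exact: opp_mulr_bilin.
move=> s t; case=> /=; rewrite -?(scalerAl, scalerAr) ?su_ab ?su_ac ?su_bd
  ?su_cd ?su_cb ?su_ad ?su_da ?scalerA.
- by rewrite mulrC.
- by rewrite mulrC.
- by rewrite mulrC.
- by rewrite mulrC.
- by rewrite mulrC.
- by rewrite -mulrA mulrNN mulfV // mulr1 addrK.
- by rewrite -mulrA mulrNN mulfV // mulr1 addrK.
Qed.

Lemma su_star_morphism :
  [/\ su_star 1 = 1, {morph su_star : x y / x + y},
      {morph su_star : x y / x * y >-> y * x}
    & forall k, {morph su_star : x / k *: x >-> Num.conj k *: x}] /\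
  [/\ su_star su_a = su_d, su_star su_b = - qc *: su_c,
      su_star su_c = - qc^-1 *: su_b & su_star su_d = su_a].
Proof.
apply: su_lift_morphism.
- by move=> x y z; rewrite mulrA.
- exact: mulr1.
- exact: mul1r.
- exact: opp_mulr_bilin.
move=> s t; case=> /=; rewrite -?(scalerAl, scalerAr) ?su_ab ?su_ac ?su_bd
  ?su_cd ?su_cb ?su_ad ?su_da ?scalerA ?fmorphV /= ?qJ.
- by rewrite mulrC.
- by rewrite mulrC.
- by rewrite mulrC.
- by rewrite mulrC.
- by rewrite mulrC.
- by rewrite -mulrA mulrNN mulVf // mulr1 addrK.
- by rewrite -mulrA mulrNN mulVf // mulr1 addrK.
Qed.

Lemma su_starK : involutive su_star.
Proof.
have [[s1 sD sM sZ] [sa sb sc sd]] := su_star_morphism.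
apply: su_ind.
- by rewrite sa sd.
- by rewrite sb sZ sc scalerA rmorphN /= qJ mulrNN mulfV // scale1r.
- by rewrite sc sZ sb scalerA rmorphN fmorphV /= qJ mulrNN mulVf // scale1r.
- by rewrite sd sa.
- by rewrite !s1.
- by move=> x y xK yK; rewrite !sD xK yK.
- by move=> x y xK yK; rewrite !sM xK yK.
- by move=> k x xK; rewrite !sZ xK conjCK.
Qed.

Let comul_rel s t : su_rel q s t ->
  su_eval (tens 1 1) tmul idfun comul_gen s =
  su_eval (tens 1 1) tmul idfun comul_gen t.
Proof.
have [[? ? ? ?] [? ? ?]] :=
  tmul_rel qc0 su_ab su_ac su_bd su_cd su_cb su_ad su_da.
by case.
Qed.

Lemma su_comul_morphism :
  [/\ su_comul 1 = tens 1 1, {morph su_comul : x y / x + y},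
      {morph su_comul : x y / x * y >-> tmul x y}
    & forall k, {morph su_comul : x / k *: x}] /\
  [/\ su_comul su_a = tens su_a su_a + tens su_b su_c,
      su_comul su_b = tens su_a su_b + tens su_b su_d,
      su_comul su_c = tens su_c su_a + tens su_d su_c
    & su_comul su_d = tens su_c su_b + tens su_d su_d].
Proof.
exact: (su_lift_morphism (theta := idfun) (@tmulA _ A) (@tmul1l _ A) (@tmul1r _ A)
  (tmul_bilin A) comul_rel).
Qed.
End SUq2Algebra.

Section Calculi.
Variable C : numClosedFieldType.

Record star_alg := StarAlg {
  star_alg_sort :> algType C;
  star : star_alg_sort -> star_alg_sort;
  star_antilinear : forall k x y,
    star (k *: x + y) = Num.conj k *: star x + star y;
  starM : forall x y, star (x * y) = star y * star x;
  starK : involutive star }.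

Record fodc (A : algType C) := Fodc {
  fodc_sort :> lmodType C;
  lact : A -> fodc_sort -> fodc_sort;
  ract : fodc_sort -> A -> fodc_sort;
  fodc_d : A -> fodc_sort;
  lact_bilin : bilin lact;
  ract_bilin : bilin ract;
  lact1 : forall w, lact 1 w = w;
  ract1 : forall w, ract w 1 = w;
  lactM : forall x y w, lact (x * y) w = lact x (lact y w);
  ractM : forall w x y, ract w (x * y) = ract (ract w x) y;
  lractA : forall x w y, ract (lact x w) y = lact x (ract w y);
  fodc_d_linear : linear fodc_d;
  fodc_dM : forall x y, fodc_d (x * y) = lact x (fodc_d y) + ract (fodc_d x) y;
  fodc_d_span : forall w, exists s : seq (A * A * A),
    w = \sum_(t <- s) ract (lact t.1.1 (fodc_d t.1.2)) t.2 }.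

Record star_fodc (A : star_alg) := StarFodc {
  star_fodc_sort :> fodc A;
  fstar : star_fodc_sort -> star_fodc_sort;
  fstar_antilinear : forall k v w,
    fstar (k *: v + w) = Num.conj k *: fstar v + fstar w;
  fstarK : involutive fstar;
  fstarE : forall x y z, fstar (ract (lact x (fodc_d _ y)) z) =
    ract (lact (star z) (fodc_d _ (star y))) (star x) }.

Definition fodc_hom (A : algType C) (G1 G2 : fodc A) (rho : G1 -> G2) :=
  linear rho /\ forall x y z,
    rho (ract (lact x (fodc_d G1 y)) z) = ract (lact x (fodc_d G2 y)) z.

Definition star_fodc_hom (A : star_alg) (G1 G2 : star_fodc A) (rho : G1 -> G2) :=
  fodc_hom rho /\ forall w, rho (fstar w) = fstar (rho w).

Definition right_ideal_gen (A : algType C) (S : set A) : set A :=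
  [set x | exists s : seq (A * A),
     (forall p, p \in s -> S p.1) /\ x = \sum_(p <- s) p.1 * p.2].

Definition is_subspace (V : lmodType C) (S : set V) :=
  S 0 /\ forall k u v, S u -> S v -> S (k *: u + v).

Definition lin_span (V : lmodType C) (S : set V) : set V :=
  [set u | exists s : seq (C * V),
     (forall p, p \in s -> S p.2) /\ u = \sum_(p <- s) p.1 *: p.2].
End Calculi.

Section SUq2Calculi.
Variables (R : realType) (q : R) (hq : 0 < q < 1).
Local Notation A := (SUq2 q).

Let q0 : q != 0.
Proof. by case/andP: hq => /lt0r_neq0. Qed.

Let su_star_antilinear k (x y : A) :
  su_star (k *: x + y) = Num.conj k *: su_star x + su_star y.
Proof. by have [[_ sD _ sZ] _] := su_star_morphism q0; rewrite sD sZ. Qed.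
Let su_starM (x y : A) : su_star (x * y) = su_star y * su_star x.
Proof. by have [[_ _ sM _] _] := su_star_morphism q0; rewrite sM. Qed.

Definition SUq2_star : star_alg R[i] :=
  StarAlg su_star_antilinear su_starM (su_starK q0).

(* tensor_act turns A (x) G into a left module over the algebra A (x) A. *)
Definition left_covariant (G : fodc A) :=
  exists2 phi : G -> tensor A G, linear phi &
    forall x y, phi (lact x (fodc_d G y)) =
      tensor_act *%R (@lact _ _ G) (su_comul x)
        (tlift (fun y1 y2 => tens y1 (fodc_d G y2)) (su_comul y)).

(* S(x_(1)) d x_(2). *)
Definition omega (G : fodc A) (x : A) : G :=
  tlift (fun x1 x2 => lact (su_antipode x1) (fodc_d G x2)) (su_comul x).

Definition calc_ideal (G : fodc A) : set A :=
  [set x | su_counit x = 0 /\ omega G x = 0].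

Definition calc3D_gens : set A :=
  let a := su_a q in let b := su_b q in let c := su_c q in let d := su_d q in
  [set x | x \in [:: b ^+ 2; c ^+ 2; b * c; (a - 1) * b; (a - 1) * c;
                     (q ^+ 2)%:C *: a + d - (q ^+ 2 + 1)%:C *: 1]].

Definition is_calc3D (G : star_fodc SUq2_star) :=
  left_covariant G /\ calc_ideal G = right_ideal_gen calc3D_gens.
End SUq2Calculi.

Section Hilbert.
Variable R : realType.
Local Notation C := R[i].

Record hilbert := Hilbert {
  hilbert_sort :> completeNormedModType C;
  dotH : {dot hilbert_sort for Num.conj};
  hilbert_norm : forall u : hilbert_sort, `|u| ^+ 2 = dotH u u }.

Definition ip (H : hilbert) (u v : H) : C := dotH H u v.

Record star_rep (A : star_alg C) (H : hilbert) := StarRep {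
  rep :> A -> H -> H;
  rep_bilin : bilin rep;
  rep_bounded : forall x, exists M : R, forall u, `|rep x u| <= M%:C * `|u|;
  rep1 : forall u, rep 1 u = u;
  repM : forall x y u, rep (x * y) u = rep x (rep y u);
  rep_star : forall x u v, ip (rep x u) v = ip u (rep (star x) v) }.

(* An unbounded operator with domain dom; sop is a total function, but its
   values outside dom are junk and never used. *)
Record symop (H : hilbert) := Symop {
  dom : set H;
  sop :> H -> H;
  dom_subspace : is_subspace dom;
  dom_dense : dense dom;
  sop_linear : forall k u v, dom u -> dom v ->
    sop (k *: u + v) = k *: sop u + sop v;
  sop_symmetric : forall u v, dom u -> dom v -> ip (sop u) v = ip u (sop v) }.

Record comm_pair (A : star_alg C) := CommPair {
  cp_space : hilbert;
  cp_rep : star_rep A cp_space;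
  cp_op : symop cp_space;
  cp_dom : set cp_space;
  cp_dom_subspace : is_subspace cp_dom;
  cp_dom_dense : dense cp_dom;
  cp_dom_sub : cp_dom `<=` dom cp_op;
  cp_dom_rep : forall x u, cp_dom u -> dom cp_op (cp_rep x u) }.

Arguments cp_dom {A} _.

Section CommCalculus.
Variables (A : star_alg C) (P : comm_pair A).
Local Notation H := (cp_space P).
Local Notation pi := (cp_rep P).
Local Notation F := (cp_op P).
Local Notation D := (cp_dom P).

(* An operator with domain D is represented by its extension by 0 outside D. *)
Definition restr (T : H -> H) : H -> H := patch (fun=> 0) D T.

Definition comm_gen (x y z : A) : H -> H :=
  restr (fun u => pi x (F (pi y (pi z u)) - pi y (F (pi z u)))).

Definition comm_sum (s : seq (A * A * A)) : H -> H :=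
  \sum_(t <- s) comm_gen t.1.1 t.1.2 t.2.

(* The involution on the formal sum s; comm_adjP shows that it is a formal
   adjoint on D, whence it only depends on the operator comm_sum s. *)
Definition comm_adj (s : seq (A * A * A)) : H -> H :=
  \sum_(t <- s) restr (fun u =>
    pi (star t.2) (pi (star t.1.2) (F (pi (star t.1.1) u)) -
                   F (pi (star t.1.2) (pi (star t.1.1) u)))).

Definition comm_diff (x : A) : H -> H :=
  restr (fun u => 'i%R *: F (pi x u) - pi x ('i%R *: F u)).

Definition rscale (s : seq (A * A * A)) (w : A) :=
  [seq (t.1.1, t.1.2, t.2 * w) | t <- s].

Definition in_comm : {pred (H -> H)} := fun T => `[< exists s, T = comm_sum s >].

Lemma comm_genE x y z u : D u ->
  comm_gen x y z u = pi x (F (pi y (pi z u)) - pi y (F (pi z u))).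
Proof. by move=> Du; rewrite /comm_gen /restr /patch mem_set. Qed.

Lemma restr_out T u : ~ D u -> restr T u = 0.
Proof. by move=> Du; rewrite /restr /patch memNset. Qed.
Lemma restrE T u : D u -> restr T u = T u.
Proof. by move=> Du; rewrite /restr /patch mem_set. Qed.

Lemma restr_lin k (S T : H -> H) :
  restr (fun u => k *: S u + T u) = k *: restr S + restr T.
Proof.
apply/funext => u; rewrite !fctE; have [Du|Du] := pselect (D u).
  by rewrite !restrE.
by rewrite !restr_out // scaler0 addr0.
Qed.

Let repD x : {morph pi x : u v / u + v}.
Proof. by move=> u v; rewrite (bilinDr (rep_bilin pi)). Qed.
Let repZ x k : {morph pi x : u / k *: u}.
Proof. by move=> u; rewrite (bilinZr (rep_bilin pi)). Qed.
Let rep0 x : pi x 0 = 0.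
Proof. by rewrite (bilin0r (rep_bilin pi)). Qed.
Let repN x : {morph pi x : u / - u}.
Proof. by move=> u; rewrite -scaleN1r repZ scaleN1r. Qed.
Let repB x : {morph pi x : u v / u - v}.
Proof. by move=> u v; rewrite repD repN. Qed.
Let rep_sum x (I : Type) (r : seq I) (f : I -> H) :
  pi x (\sum_(i <- r) f i) = \sum_(i <- r) pi x (f i).
Proof. exact: (big_morph _ (repD x) (rep0 x)). Qed.
Let FZ k u : dom F u -> F (k *: u) = k *: F u.
Proof.
have F0 : F 0 = 0.
  have d0 := (dom_subspace F).1.
  have := sop_linear 1 d0 d0; rewrite !scale1r addr0 => /eqP.
  by rewrite -subr_eq subrr eq_sym => /eqP.
by move=> Du; have := sop_linear k Du (dom_subspace F).1; rewrite F0 !addr0.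
Qed.
Let FN u : dom F u -> F (- u) = - F u.
Proof. by move=> Du; rewrite -scaleN1r FZ // scaleN1r. Qed.

Let symF u v : dom F u -> dom F v -> ip (F u) v = ip u (F v).
Proof. exact: sop_symmetric. Qed.
Let DF x u : D u -> dom F (pi x u).
Proof. exact: cp_dom_rep. Qed.
Let DF2 x y u : D u -> dom F (pi x (pi y u)).
Proof. by rewrite -repM; exact: DF. Qed.

Lemma comm_sum_out s u : ~ D u -> comm_sum s u = 0.
Proof.
move=> Du; rewrite /comm_sum fct_sumE big1 // => t _.
by rewrite /comm_gen restr_out.
Qed.
Lemma comm_adj_out s u : ~ D u -> comm_adj s u = 0.
Proof.
by move=> Du; rewrite /comm_adj fct_sumE big1 // => t _; rewrite restr_out.
Qed.

Lemma comm_sum_in s u : D u -> comm_sum s u = \sum_(t <- s)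
  pi t.1.1 (F (pi t.1.2 (pi t.2 u)) - pi t.1.2 (F (pi t.2 u))).
Proof.
move=> Du; rewrite /comm_sum fct_sumE; apply: eq_bigr => t _.
by rewrite comm_genE.
Qed.
Lemma comm_adj_in s u : D u -> comm_adj s u = \sum_(t <- s)
  pi (star t.2) (pi (star t.1.2) (F (pi (star t.1.1) u)) -
                 F (pi (star t.1.2) (pi (star t.1.1) u))).
Proof.
move=> Du; rewrite /comm_adj fct_sumE; apply: eq_bigr => t _.
by rewrite restrE.
Qed.

Lemma ipBl (u v w : H) : ip (u - v) w = ip u w - ip v w.
Proof. exact: (linearBl (dotH H)). Qed.
Lemma ipBr (u v w : H) : ip u (v - w) = ip u v - ip u w.
Proof. exact: (linearBr (dotH H)). Qed.
Lemma ipC (u v : H) : ip u v = Num.conj (ip v u).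
Proof. by rewrite /ip hermC expr0 mul1r. Qed.
Lemma ip_suml (I : Type) (r : seq I) (f : I -> H) (v : H) :
  ip (\sum_(i <- r) f i) v = \sum_(i <- r) ip (f i) v.
Proof. exact: (linear_sumlz (dotH H)). Qed.
Lemma ip_sumr (I : Type) (r : seq I) (f : I -> H) (u : H) :
  ip u (\sum_(i <- r) f i) = \sum_(i <- r) ip u (f i).
Proof. exact: (linear_sumr (dotH H)). Qed.

Lemma comm_adjP s u v : D u -> D v ->
  ip (comm_sum s u) v = ip u (comm_adj s v).
Proof.
move=> Du Dv; rewrite comm_sum_in // comm_adj_in //.
rewrite ip_suml ip_sumr; apply: eq_bigr => -[[x y] z] _ /=.
rewrite rep_star ipBl.
rewrite symF; [|exact: DF2|exact: DF].
rewrite !(rep_star pi y) symF; [|exact: DF|exact: DF2].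
by rewrite !(rep_star pi z) repB ipBr.
Qed.

Lemma dense_orth w : (forall u, D u -> ip u w = 0) -> w = 0.
Proof.
move=> orth; apply: contrapT => /eqP w0.
have ww : 0 < `|w| by rewrite normr_gt0.
have [] := @cp_dom_dense _ P (ball w `|w|).
- by exists w; apply: ballxx.
- exact: ball_open.
move=> u [] + Du; rewrite -ball_normE /= => wu.
have : `|w - u| ^+ 2 < `|w| ^+ 2 by rewrite ltr_pXn2r // nnegrE.
rewrite !hilbert_norm -!/(ip _ _) ipBl !ipBr (ipC w u) (orth u Du) conjC0 subr0 sub0r opprK.
by rewrite -[X in _ < X]addr0 ltrD2l /ip -hilbert_norm le_gtF // exprn_ge0.
Qed.

Lemma comm_adj_eq s t : comm_sum s = comm_sum t -> comm_adj s = comm_adj t.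
Proof.
move=> st; apply/funext => v; have [Dv|Dv] := pselect (D v); last first.
  by rewrite !comm_adj_out.
apply/eqP; rewrite -subr_eq0; apply/eqP/dense_orth => u Du.
by rewrite ipBr -!comm_adjP // st subrr.
Qed.

Definition dag (s : seq (A * A * A)) :=
  [seq (- star t.2, star t.1.2, star t.1.1) | t <- s].

Let starN (x : A) : star (- x) = - star x.
Proof.
have starZ (y : A) : star ((-1) *: y) = (-1) *: star y.
  have := star_antilinear (-1) y 0; have := star_antilinear (-1) (0 : A) 0.
  rewrite scaler0 !addr0 rmorphN rmorph1 scaleN1r addNr => -> ->.
  by rewrite addr0.
by rewrite -scaleN1r starZ scaleN1r.
Qed.

Let repNl (x : A) u : pi (- x) u = - pi x u.
Proof. by rewrite -scaleN1r (bilinZl (rep_bilin pi)) scaleN1r. Qed.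

Lemma comm_adjE s : comm_adj s = comm_sum (dag s).
Proof.
apply/funext => u; have [Du|Du] := pselect (D u); last first.
  by rewrite comm_adj_out // comm_sum_out.
rewrite comm_adj_in // comm_sum_in // /dag big_map; apply: eq_bigr => t _ /=.
by rewrite repNl -repN opprB.
Qed.

Lemma comm_adj_dag s : comm_adj (dag s) = comm_sum s.
Proof.
apply/funext => u; have [Du|Du] := pselect (D u); last first.
  by rewrite comm_adj_out // comm_sum_out.
rewrite comm_adj_in // comm_sum_in // /dag big_map; apply: eq_bigr => t _ /=.
rewrite starN !starK !repNl repN (FN (DF _ Du)) (FN (DF2 _ _ Du)) repN.
by rewrite opprK addrC.
Qed.

Lemma comm_sum_eq s t : comm_adj s = comm_adj t -> comm_sum s = comm_sum t.
Proof.
by rewrite !comm_adjE => /comm_adj_eq; rewrite !comm_adj_dag.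
Qed.

Lemma comm_adj_rscale s w u :
  comm_adj (rscale s w) u = pi (star w) (comm_adj s u).
Proof.
have [Du|Du] := pselect (D u); last by rewrite !comm_adj_out // rep0.
rewrite !comm_adj_in // rep_sum /rscale big_map; apply: eq_bigr => t _ /=.
by rewrite starM repM.
Qed.

Lemma comm_sum_rscale s t w :
  comm_sum s = comm_sum t -> comm_sum (rscale s w) = comm_sum (rscale t w).
Proof.
move=> st; apply: comm_sum_eq; apply/funext => u.
by rewrite !comm_adj_rscale (comm_adj_eq st).
Qed.

Lemma comm_gen_linl y z : linear (fun x => comm_gen x y z).
Proof.
move=> k x x'; rewrite /comm_gen -restr_lin; congr restr; apply/funext => u.
by rewrite (rep_bilin pi).1.
Qed.

Lemma comm_gen_linr x y : linear (comm_gen x y).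
Proof.
move=> k z z'; rewrite /comm_gen -restr_lin; apply/funext => u.
have [Du|Du] := pselect (D u); last by rewrite !restr_out.
rewrite !restrE // (rep_bilin pi).1 (rep_bilin pi).2.
rewrite (sop_linear _ (DF2 y z Du) (DF2 y z' Du)).
rewrite (sop_linear _ (DF z Du) (DF z' Du)) (rep_bilin pi).2.
by rewrite opprD addrACA -scalerBr (rep_bilin pi).2.
Qed.

Lemma comm_gen_lact x' x y z :
  (fun u => pi x' (comm_gen x y z u)) = comm_gen (x' * x) y z.
Proof.
apply/funext => u; rewrite /comm_gen.
have [Du|Du] := pselect (D u); last by rewrite !restr_out ?rep0.
by rewrite !restrE // repM.
Qed.

Lemma comm_sum1 x y z : comm_sum [:: (x, y, z)] = comm_gen x y z.
Proof. by rewrite /comm_sum big_cons big_nil addr0. Qed.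

Lemma comm_diffE x : comm_diff x = comm_gen ('i%R)%:A x 1.
Proof.
rewrite /comm_diff /comm_gen; apply/funext => u.
have [Du|Du] := pselect (D u); last by rewrite !restr_out.
rewrite !restrE // (bilinZl (rep_bilin pi)) !rep1 repZ.
by rewrite -scalerBr.
Qed.

Definition lscale (k : C) (s : seq (A * A * A)) :=
  [seq (k *: t.1.1, t.1.2, t.2) | t <- s].

Lemma comm_sum_lin k s t :
  comm_sum (lscale k s ++ t) = k *: comm_sum s + comm_sum t.
Proof.
rewrite /comm_sum big_cat /=; congr (_ + _); rewrite scaler_sumr big_map.
apply: eq_bigr => p _ /=.
have [_ _ _ Z] := linear_spec (comm_gen_linl p.1.2 p.2); exact: Z.
Qed.

Lemma in_commP T : reflect (exists s, T = comm_sum s) (T \in in_comm).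
Proof. exact: asboolP. Qed.

Let in_comm_submod : submod_closed in_comm.
Proof.
split=> [|k S T /in_commP[s ->] /in_commP[t ->]]; apply/in_commP.
  by exists [::]; rewrite /comm_sum big_nil.
by exists (lscale k s ++ t); rewrite comm_sum_lin.
Qed.
HB.instance Definition _ :=
  GRing.isSubmodClosed.Build C (H -> H) in_comm in_comm_submod.

(* The elements of Gamma_{pi,F}. *)
Record comm_space := CommSpace {
  comm_val : H -> H;
  comm_valP : comm_val \in in_comm }.
HB.instance Definition _ := [isSub for comm_val].
HB.instance Definition _ := [Choice of comm_space by <:].
HB.instance Definition _ := [SubChoice_isSubLmodule of comm_space by <:].

Lemma comm_seq_ex (w : comm_space) : exists s, comm_val w = comm_sum s.
Proof. exact/in_commP/comm_valP. Qed.

Definition comm_seq (w : comm_space) := sval (cid (comm_seq_ex w)).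
Lemma comm_seqE w : comm_val w = comm_sum (comm_seq w).
Proof. exact: (svalP (cid (comm_seq_ex w))). Qed.

Let lact_in x (w : comm_space) : (fun u => pi x (comm_val w u)) \in in_comm.
Proof.
apply/in_commP; exists [seq (x * t.1.1, t.1.2, t.2) | t <- comm_seq w].
rewrite comm_seqE; apply/funext => u; rewrite /comm_sum !fct_sumE big_map rep_sum.
by apply: eq_bigr => t _ /=; rewrite -comm_gen_lact.
Qed.
Definition comm_lact x w : comm_space := CommSpace (lact_in x w).

Lemma comm_sum_in_comm s : comm_sum s \in in_comm.
Proof. by apply/in_commP; exists s. Qed.

(* The result does not depend on the chosen presentation of w as a sum, see
   comm_ractE. *)
Definition comm_ract w y : comm_space :=
  CommSpace (comm_sum_in_comm (rscale (comm_seq w) y)).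

Let diff_in x : comm_diff x \in in_comm.
Proof. by rewrite comm_diffE -comm_sum1 comm_sum_in_comm. Qed.
Definition comm_d x : comm_space := CommSpace (diff_in x).

Let star_in (w : comm_space) : comm_adj (comm_seq w) \in in_comm.
Proof. by rewrite comm_adjE comm_sum_in_comm. Qed.
(* Likewise independent of the presentation, see comm_starE. *)
Definition comm_star w : comm_space := CommSpace (star_in w).

Lemma comm_ractE w y s : comm_val w = comm_sum s ->
  comm_val (comm_ract w y) = comm_sum (rscale s y).
Proof. by move=> ws; apply: comm_sum_rscale; rewrite -comm_seqE. Qed.

Lemma comm_starE w s : comm_val w = comm_sum s ->
  comm_val (comm_star w) = comm_adj s.
Proof. by move=> ws; apply: comm_adj_eq; rewrite -comm_seqE. Qed.

Lemma comm_val_inj : injective comm_val. Proof. exact: val_inj. Qed.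

Lemma comm_val_lin k v w :
  comm_val (k *: v + w) = k *: comm_val v + comm_val w.
Proof. by []. Qed.

Lemma comm_valD v w : comm_val (v + w) = comm_val v + comm_val w.
Proof. by []. Qed.

Lemma comm_termE x y z :
  comm_val (comm_ract (comm_lact x (comm_d y)) z) = comm_gen ('i%R *: x) y z.
Proof.
rewrite (@comm_ractE _ _ [:: ('i%R *: x, y, 1)]) /=.
  by rewrite comm_sum1 mul1r.
rewrite comm_sum1 comm_diffE comm_gen_lact; congr comm_gen.
by rewrite -scalerAr mulr1.
Qed.

Let comm_lact_bilin : bilin comm_lact.
Proof.
split=> [w k x x'|x k v w]; apply: comm_val_inj; apply/funext => u.
  by rewrite comm_val_lin /= (rep_bilin pi).1.
by rewrite comm_val_lin /= (rep_bilin pi).2.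
Qed.

Let rscale_lscale k s y : rscale (lscale k s) y = lscale k (rscale s y).
Proof. by rewrite /rscale /lscale -!map_comp. Qed.

Let comm_ract_bilin : bilin comm_ract.
Proof.
split=> [y k v w|w k y y']; apply: comm_val_inj; rewrite comm_val_lin.
  rewrite -comm_sum_lin; rewrite -rscale_lscale /rscale -map_cat.
  apply: comm_ractE; rewrite comm_val_lin comm_sum_lin.
  by rewrite -!comm_seqE.
rewrite /= /comm_sum !big_map scaler_sumr -big_split /=.
apply: eq_bigr => t _; rewrite -comm_gen_linr; congr comm_gen.
by rewrite mulrDr scalerAr.
Qed.

Let comm_lact1 w : comm_lact 1 w = w.
Proof. by apply: comm_val_inj; apply/funext => u; rewrite /= rep1. Qed.
Let comm_ract1 w : comm_ract w 1 = w.
Proof.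
apply: comm_val_inj; rewrite comm_seqE [RHS]comm_seqE -comm_seqE /=.
congr comm_sum; rewrite /rscale -[RHS]map_id; apply: eq_map => -[[x y] z] /=.
by rewrite mulr1.
Qed.
Let comm_lactM x y w : comm_lact (x * y) w = comm_lact x (comm_lact y w).
Proof. by apply: comm_val_inj; apply/funext => u; rewrite /= repM. Qed.
Let comm_ractM w x y : comm_ract w (x * y) = comm_ract (comm_ract w x) y.
Proof.
apply: comm_val_inj; rewrite (@comm_ractE (comm_ract w x) y _ erefl) /=.
congr comm_sum; rewrite /rscale -map_comp; apply: eq_map => t /=.
by rewrite mulrA.
Qed.
Let comm_lractA x w y :
  comm_ract (comm_lact x w) y = comm_lact x (comm_ract w y).
Proof.
apply: comm_val_inj.
have lE s : (fun u => pi x (comm_sum s u)) =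
    comm_sum [seq (x * t.1.1, t.1.2, t.2) | t <- s].
  apply/funext => u; rewrite /comm_sum !fct_sumE big_map rep_sum.
  by apply: eq_bigr => t _ /=; rewrite -comm_gen_lact.
have h : comm_val (comm_lact x w) =
    comm_sum [seq (x * t.1.1, t.1.2, t.2) | t <- comm_seq w].
  by rewrite -lE -comm_seqE.
by rewrite (comm_ractE y h) /= lE /rscale -!map_comp.
Qed.
Let comm_d_linear : linear comm_d.
Proof.
move=> k x y; apply: comm_val_inj; rewrite comm_val_lin /= /comm_diff.
rewrite -restr_lin; apply/funext => u.
have [Du|Du] := pselect (D u); last by rewrite !restr_out.
rewrite !restrE // !(rep_bilin pi).1 (sop_linear _ (DF x Du) (DF y Du)).
rewrite scalerDr opprD addrACA scalerBr !scalerA.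
by rewrite [_ * k]mulrC.
Qed.
Let comm_dM x y :
  comm_d (x * y) = comm_lact x (comm_d y) + comm_ract (comm_d x) y.
Proof.
apply: comm_val_inj; rewrite -[X in comm_ract X y]comm_lact1 comm_valD.
rewrite comm_termE; apply/funext => u; rewrite fctE /= /comm_diff /comm_gen.
have [Du|Du] := pselect (D u); last by rewrite !restr_out // rep0 addr0.
rewrite !restrE // !repM (bilinZl (rep_bilin pi)) rep1 !repB !repZ.
by rewrite scalerBr addrC addrA subrK.
Qed.
Let comm_d_span w : exists s : seq (A * A * A),
  w = \sum_(t <- s) comm_ract (comm_lact t.1.1 (comm_d t.1.2)) t.2.
Proof.
exists (lscale (- 'i%R) (comm_seq w)); apply: comm_val_inj.
rewrite (big_morph comm_val comm_valD (erefl : comm_val 0 = 0)) big_map comm_seqE.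
apply: eq_bigr => t _; rewrite /= [RHS]comm_termE scalerA mulrN -expr2 sqrCi.
by rewrite opprK scale1r.
Qed.

Definition comm_fodc : fodc A :=
  Fodc comm_lact_bilin comm_ract_bilin comm_lact1 comm_ract1 comm_lactM
    comm_ractM comm_lractA comm_d_linear comm_dM comm_d_span.

Let starZ k (x : A) : star (k *: x) = Num.conj k *: star x.
Proof.
have := star_antilinear k x 0; have := star_antilinear 1 (0 : A) 0.
rewrite rmorph1 !scale1r !addr0 => /eqP.
by rewrite -subr_eq subrr eq_sym => /eqP ->; rewrite addr0.
Qed.
Let comm_genZl k x y z : comm_gen (k *: x) y z = k *: comm_gen x y z.
Proof. by have [_ _ _ Z] := linear_spec (comm_gen_linl y z); exact: Z. Qed.
Let comm_genZr k x y z : comm_gen x y (k *: z) = k *: comm_gen x y z.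
Proof. by have [_ _ _ Z] := linear_spec (comm_gen_linr x y); exact: Z. Qed.
Let comm_star_antilinear k v w :
  comm_star (k *: v + w) = Num.conj k *: comm_star v + comm_star w.
Proof.
apply: comm_val_inj; rewrite comm_val_lin.
rewrite (@comm_starE _ (lscale k (comm_seq v) ++ comm_seq w)); last first.
  by rewrite comm_val_lin comm_sum_lin -!comm_seqE.
rewrite /= !comm_adjE /comm_sum /dag map_cat big_cat !big_map scaler_sumr.
congr (_ + _); apply: eq_bigr => t _ /=.
by rewrite starZ comm_genZr.
Qed.
Let comm_starK : involutive comm_star.
Proof.
move=> w; apply: comm_val_inj; rewrite (@comm_starE _ (dag (comm_seq w))) /=.
  by rewrite comm_adj_dag -comm_seqE.
by rewrite comm_adjE.
Qed.
Let comm_star_term x y z : comm_star (comm_ract (comm_lact x (comm_d y)) z) =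
  comm_ract (comm_lact (star z) (comm_d (star y))) (star x).
Proof.
apply: comm_val_inj; rewrite comm_termE.
rewrite (@comm_starE _ [:: ('i%R *: x, y, z)]) ?comm_termE ?comm_sum1 //.
rewrite comm_adjE comm_sum1 /= starZ comm_genZr -scaleN1r !comm_genZl.
by rewrite conjCi scalerA mulrN1 opprK.
Qed.

Definition comm_star_fodc : star_fodc A :=
  @StarFodc _ A comm_fodc comm_star comm_star_antilinear comm_starK
    comm_star_term.
End CommCalculus.

(* Equality of the closures of the graphs of F restricted to D and of F. *)
Definition is_core (H : hilbert) (F : symop H) (D : set H) :=
  closure [set (u, F u) | u in D] = closure [set (u, F u) | u in dom F].
End Hilbert.

Arguments cp_dom {R A} _.

Section Admissible.
Variables (R : realType) (q : R) (hq : 0 < q < 1).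
Local Notation A := (SUq2_star hq).

Definition faithful_commutator_rep (G : star_fodc A) (P : comm_pair A) :=
  exists2 rho : G -> comm_star_fodc P, star_fodc_hom rho & injective rho.

Definition admissible (P : comm_pair A) :=
  let pi := cp_rep P in
  exists E D0 : set (cp_space P),
    [/\ is_subspace E, is_subspace D0,
        (forall u, E u -> [/\ pi (su_c q) u = 0, E (pi (su_a q) u)
                            & E (pi (su_d q) u)]),
        (forall u, D0 u -> [/\ pi (su_a q) u = 0, D0 (pi (su_b q) u)
                             & D0 (pi (su_c q) u)]) &
        cp_dom P = [set u + v | u in E & v in
           lin_span [set w | exists n, exists2 u, D0 u & w = pi (su_d q ^+ n) u]]
        /\ is_core (cp_op P) (cp_dom P)].
End Admissible.

(* Main.v *)
Require Import Defs.
From HB Require Import structures.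
From mathcomp Require Import all_boot all_order all_algebra.
From mathcomp Require Import sesquilinear complex ring lra zify.
From mathcomp Require Import boolp classical_sets functions reals topology.
From mathcomp Require Import normedtype sequences.

Set Implicit Arguments.
Unset Strict Implicit.
Unset Printing Implicit Defensive.

Import Order.TTheory GRing.Theory Num.Theory.
Import numFieldNormedType.Exports.

Local Open Scope classical_set_scope.
Local Open Scope ring_scope.
Local Open Scope complex_scope.

(** The 3D-calculus is pinned down by a short list of relations.  Write omega for
    the left-invariant form S(x_(1)) d x_(2) and put theta0 = omega(b),
    theta1 = omega(a), theta2 = omega(c).  Then

      theta_j x = sigma_j(x) theta_j, where sigma_0 = sigma_2 = sigma scales a, c
      by q^-1 and b, d by q, and sigma_1 = sigma^2;

      da = a theta1 + b theta2,   db = a theta0 - q^2 b theta1,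
      dc = c theta1 + d theta2,   dd = c theta0 - q^2 d theta1,

    and the theta_j form a basis of the left module of forms.  The displayed
    equations rewrite every sum of terms x dy z as a combination of the theta_j
    whose coefficients do not depend on the calculus, and freeness says that the
    sum vanishes exactly when these coefficients do.  Hence any two calculi with
    these two properties have the same relations and are isomorphic
    (structure_hom), and the isomorphism respects the involutions
    (fodc_hom_star).  It remains to see both properties for the given calculus
    and for the commutators with one concrete operator.

    For the given calculus the equations follow from the right ideal by means of
    omega(xy) = eps(x) omega(y) + S(y_(1)) omega(x) y_(2) (calc3D_structure).
    Freeness uses covariance (calc3D_free): the coaction sends theta_j to
    1 (x) theta_j, so that from z_0 theta0 + z_1 theta1 + z_2 theta2 = 0 one
    deduces h(z_0) theta0 + h(z_1) theta1 + h(z_2) theta2 = 0 for every linear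
    functional h.  The theta_j are linearly independent because three
    representations by triangular 2 x 2 matrices separate b, a - 1 and c modulo
    the right ideal (frame_indep), and enough functionals h are supplied by the
    matrix coefficients of a faithful representation (pi0_faithful).

    The representation pi0 acts on the square-summable families over
    nat * int * bool, that is, on two copies (sheets) of a space with basis e_nm.
    With s_n = sqrt(1 - q^2n), on both sheets,

      a e_nm = s_n e_(n-1,m),        d e_nm = s_(n+1) e_(n+1,m),
      c e_nm = q^n e_(n,m+1),        b e_nm = - q^(n+1) e_(n,m-1).

    It is faithful because the monomials a^i b^j c^k, d^i b^j c^k span the algebra
    and a polynomial that vanishes at infinitely many powers of q is zero.

    The operator F has, on the finitely supported families, the sheet matrix with
    diagonal entries L and off-diagonal entries E and its formal adjoint E*, where

      Omega e_nm = q^(n-m) e_nm,     L = q^2 / (1 - q^2) Omega^2,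
      E e_nm = q^-m s_n / (1 - q^2) e_(n-1,m+1).

    Here E commutes with a and c, while [E,b] = a Omega and [E,d] = c Omega;
    E* commutes with b and d, while [E*,a] = b Omega and [E*,c] = d Omega; and
    [L,x] is x Omega^2 for x = a, c and - q^2 x Omega^2 for x = b, d.  So the
    differentials i[F,x] satisfy the four equations above (d_gens), with theta1 acting as
    i Omega^2 on each sheet and with theta0 and theta2 acting as i Omega from one
    sheet to the other, in opposite directions.  Thus the three coefficients of a
    vanishing combination can be read off on different sheets, and each is zero
    because pi0 is faithful on one sheet (dirac_free).

    The pair is admissible with the zero space inside ker pi(c) and the finitely
    supported families concentrated at n = 0 inside ker pi(a): applying the powers
    of d to the latter generates the whole domain of F (dirac_admissible). *)

(** * Sums over a countable index set *)

Section Summation.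
Variables (R : realType) (I : countType).

(** Extending by 0 along the enumeration turns families over I into sequences, so
    that sums become limits of partial sums. *)
Definition zero_ext (u : I -> R) (k : nat) : R := oapp u 0 (pickle_inv k : option I).
Definition summable (u : I -> R) := cvgn (series (zero_ext u)).
Definition rsum (u : I -> R) : R := limn (series (zero_ext u)).

Lemma zero_ext_lin a (u v : I -> R) :
  zero_ext (fun i => a * u i + v i) = a *: zero_ext u + zero_ext v.
Proof.
apply/funext => k; rewrite /zero_ext !fctE; case: pickle_inv => [i|] //=.
by rewrite scaler0 addr0.
Qed.

Lemma summable_lin a (u v : I -> R) :
  summable u -> summable v -> summable (fun i => a * u i + v i).
Proof.
move=> su sv; rewrite /summable zero_ext_lin.
by apply: is_cvg_seriesD => //; apply: is_cvg_seriesZ.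
Qed.

Lemma rsum_lin a (u v : I -> R) : summable u -> summable v ->
  rsum (fun i => a * u i + v i) = a * rsum u + rsum v.
Proof.
move=> su sv; have sau : cvgn (series (a *: zero_ext u)) by apply: is_cvg_seriesZ.
by rewrite /rsum zero_ext_lin lim_seriesD // lim_seriesZ.
Qed.

Lemma summable0 : summable (fun=> 0).
Proof.
rewrite /summable (_ : series _ = fun=> 0); first exact: is_cvg_cst.
apply/funext => n; rewrite /series /= big1 // => k _.
by rewrite /zero_ext; case: pickle_inv.
Qed.

Lemma rsum0 : rsum (fun=> 0) = 0.
Proof.
have := rsum_lin 1 summable0 summable0.
under eq_fun do rewrite mulr0 addr0.
by rewrite mul1r => /eqP; rewrite -subr_eq subrr eq_sym => /eqP.
Qed.

Lemma summableZ a u : summable u -> summable (fun i => a * u i).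
Proof.
move=> su; have := summable_lin (a := a) su summable0.
by under eq_fun do rewrite addr0.
Qed.

Lemma summableD u v : summable u -> summable v -> summable (fun i => u i + v i).
Proof.
move=> su sv; have := summable_lin (a := 1) su sv.
by under eq_fun do rewrite mul1r.
Qed.

Lemma rsumZ a u : summable u -> rsum (fun i => a * u i) = a * rsum u.
Proof.
move=> su; have := rsum_lin a su summable0; rewrite rsum0 addr0 => <-.
by congr rsum; apply/funext => i; rewrite addr0.
Qed.

Lemma zero_ext_ge0 u k : (forall i, 0 <= u i) -> 0 <= zero_ext u k.
Proof. by move=> u0; rewrite /zero_ext; case: pickle_inv => //=. Qed.

Lemma le_zero_ext u v k : (forall i, u i <= v i) -> zero_ext u k <= zero_ext v k.
Proof. by move=> uv; rewrite /zero_ext; case: pickle_inv => //=. Qed.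

Lemma le_summable u v : (forall i, 0 <= u i <= v i) -> summable v -> summable u.
Proof.
move=> uv; apply: series_le_cvg => k.
- by apply: zero_ext_ge0 => i; case/andP: (uv i).
- by apply: zero_ext_ge0 => i; case/andP: (uv i); apply: le_trans.
- by apply: le_zero_ext => i; case/andP: (uv i).
Qed.

Lemma abs_summable u v : (forall i, `|u i| <= v i) -> summable v -> summable u.
Proof.
move=> uv sv; have su : summable (fun i => `|u i|).
  by apply: le_summable sv => i; rewrite normr_ge0 uv.
have extE : zero_ext (fun i => `|u i|) = fun k => `|zero_ext u k|.
  by apply/funext => k; rewrite /zero_ext /=; case: pickle_inv; rewrite /= ?normr0.
by apply: normed_cvg; move: su; rewrite /summable extE.
Qed.

Definition partial (u : I -> R) (s : seq I) := \sum_(i <- s) u i.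

Definition upto n : seq I := pmap (@pickle_inv I) (iota 0 n).

Lemma mem_upto n i : (i \in upto n) = (pickle i < n)%N.
Proof.
rewrite mem_pmap; apply/mapP/idP => [[k]|lt].
  rewrite mem_iota add0n /= => kn ik.
  by have := @pickle_invK I k; rewrite -ik /= => ->.
by exists (pickle i); rewrite ?mem_iota // pickleK_inv.
Qed.

Lemma upto_uniq n : uniq (upto n).
Proof.
apply: (pmap_uniq (g := @pickle I)); last exact: iota_uniq.
exact: pickle_invK.
Qed.

Lemma seriesE u n : series (zero_ext u) n = partial u (upto n).
Proof.
rewrite /series /= /partial /upto /index_iota subn0.
elim: (iota 0 n) => [|k s IH]; first by rewrite !big_nil.
rewrite big_cons IH /= /zero_ext; case: pickle_inv => [i|] /=; last by rewrite add0r.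
by rewrite big_cons.
Qed.

Lemma partial_sub u s t : (forall i, 0 <= u i) -> uniq s -> uniq t ->
  {subset s <= t} -> partial u s <= partial u t.
Proof.
move=> u0 us ut st; rewrite /partial [leRHS](bigID (mem s)) /= -[leLHS]addr0.
rewrite lerD ?sumr_ge0 // -[leRHS]big_filter [leRHS](perm_big s) //.
apply: uniq_perm => //; first exact: filter_uniq.
by move=> i; rewrite mem_filter; apply/andP/idP => [[]|si] //; rewrite si st.
Qed.

Lemma sub_upto (s : seq I) : {subset s <= upto (\max_(i <- s) (pickle i).+1)}.
Proof.
move=> i si; rewrite mem_upto -/((pickle i).+1 <= _)%N.
by rewrite (big_rem i) //= leq_maxl.
Qed.

Lemma series_homo u : (forall i, 0 <= u i) ->
  {homo series (zero_ext u) : n m / (n <= m)%N >-> n <= m}.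
Proof.
by move=> u0; apply: nondecreasing_series => k _ _; apply: zero_ext_ge0.
Qed.

Lemma partial_le u s : (forall i, 0 <= u i) -> summable u -> uniq s ->
  partial u s <= rsum u.
Proof.
move=> u0 su us; apply: le_trans (partial_sub u0 us (upto_uniq _) (@sub_upto s)) _.
by rewrite -seriesE; apply: nondecreasing_cvgn_le => //; apply: series_homo.
Qed.

(** The partial sums along the enumeration form a monotone sequence. *)
Lemma bounded_summable u M : (forall i, 0 <= u i) ->
  (forall s, uniq s -> partial u s <= M) -> summable u /\ rsum u <= M.
Proof.
move=> u0 uM; have su : summable u.
  apply: nondecreasing_is_cvgn; first exact: series_homo.
  by exists M => _ [n _ <-]; rewrite seriesE uM ?upto_uniq.
split=> //; apply: limr_le => //.
by near=> n; rewrite seriesE uM ?upto_uniq.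
Unshelve. all: by end_near. Qed.

Lemma rsum_ge0 u : (forall i, 0 <= u i) -> summable u -> 0 <= rsum u.
Proof.
move=> u0 su; have := partial_le u0 su (isT : uniq [::]).
by rewrite /partial big_nil.
Qed.

(** Finite truncations approximate a convergent sum; this gives the density of the
    finitely supported families. *)
Lemma rsum_tail u e : (forall i, 0 <= u i) -> summable u -> 0 < e ->
  exists n, rsum u - partial u (upto n) < e.
Proof.
move=> u0 su e0; have /cvgrPdist_lt /(_ _ e0) [n _ /(_ n (leqnn n))] := su.
rewrite seriesE -/(rsum u) => h; exists n.
by apply: le_lt_trans h; apply: ler_norm.
Qed.

Lemma rsum_supp u s : uniq s -> (forall i, i \notin s -> u i = 0) ->
  summable u /\ rsum u = partial u s.
Proof.
move=> us u0; set N := \max_(i <- s) (pickle i).+1.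
have sE n : (N <= n)%N -> series (zero_ext u) n = partial u s.
  move=> Nn; rewrite seriesE /partial (bigID (mem s)) /= [X in _ + X]big1 ?addr0.
    rewrite -big_filter; apply/perm_big/uniq_perm => //.
      by rewrite filter_uniq ?upto_uniq.
    move=> i; rewrite mem_filter; apply/andP/idP => [[]//|si]; split=> //.
    by have := sub_upto si; rewrite !mem_upto => /leq_trans; apply.
  by move=> i; apply: u0.
have h : series (zero_ext u) n @[n --> \oo] --> partial u s.
  by apply: cvg_near_cst; exists N => // n /= Nn; apply/eqP/sE.
split; first by apply/cvg_ex; exists (partial u s).
exact/cvg_lim.
Qed.
End Summation.

(** * Square-summable families and their inner product *)

Section SquareSummable.
Variables (R : realType) (I : countType).
Local Notation C := R[i].

(** The squared modulus, as a real number. *)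
Definition nsq (z : C) : R := complex.Re z ^+ 2 + complex.Im z ^+ 2.

Lemma nsq_ge0 z : 0 <= nsq z. Proof. by rewrite addr_ge0 ?sqr_ge0. Qed.

Lemma nsq0 : nsq 0 = 0. Proof. by rewrite /nsq /= expr0n /= addr0. Qed.

Lemma nsq_eq0 z : nsq z = 0 -> z = 0.
Proof.
case: z => x y /eqP; rewrite /nsq /= paddr_eq0 ?sqr_ge0 // !sqrf_eq0.
by case/andP => /eqP -> /eqP ->.
Qed.

Lemma nsqM z w : nsq (z * w) = nsq z * nsq w.
Proof. by case: z w => [a b] [c d]; rewrite /nsq /=; ring. Qed.

Lemma nsqJ z : z * Num.conj z = (nsq z)%:C.
Proof.
case: z => a b; apply/eqP; rewrite eq_complex /nsq /=.
by apply/andP; split; apply/eqP; ring.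
Qed.

Lemma nsqD_le z w : nsq (z + w) <= 2 * nsq z + 2 * nsq w.
Proof.
case: z w => [a b] [c d]; rewrite /nsq /= -subr_ge0.
have -> : 2 * (a ^+ 2 + b ^+ 2) + 2 * (c ^+ 2 + d ^+ 2) -
  ((a + c) ^+ 2 + (b + d) ^+ 2) = (a - c) ^+ 2 + (b - d) ^+ 2 by ring.
by rewrite addr_ge0 ?sqr_ge0.
Qed.

Lemma abs_re_le z w : `|complex.Re (z * Num.conj w)| <= nsq z + nsq w.
Proof.
case: z w => [a b] [c d]; rewrite /nsq /= ler_norml.
have := (sqr_ge0 (a + c), sqr_ge0 (b + d), sqr_ge0 (a - c), sqr_ge0 (b - d)).
have := (sqr_ge0 a, sqr_ge0 b, sqr_ge0 c, sqr_ge0 d).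
by move=> [[[? ?] ?] ?] [[[? ?] ?] ?]; apply/andP; split; nra.
Qed.

Lemma abs_im_le z w : `|complex.Im (z * Num.conj w)| <= nsq z + nsq w.
Proof.
case: z w => [a b] [c d]; rewrite /nsq /= ler_norml.
have := (sqr_ge0 (a + d), sqr_ge0 (b + c), sqr_ge0 (a - d), sqr_ge0 (b - c)).
have := (sqr_ge0 a, sqr_ge0 b, sqr_ge0 c, sqr_ge0 d).
by move=> [[[? ?] ?] ?] [[[? ?] ?] ?]; apply/andP; split; nra.
Qed.

Definition csummable (u : I -> C) :=
  summable (fun i => complex.Re (u i)) /\ summable (fun i => complex.Im (u i)).
Definition csum (u : I -> C) : C :=
  rsum (fun i => complex.Re (u i)) +i* rsum (fun i => complex.Im (u i)).

Lemma csum_lin k u v : csummable u -> csummable v ->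
  csummable (fun i => k * u i + v i) /\
  csum (fun i => k * u i + v i) = k * csum u + csum v.
Proof.
case: k => a b [u1 u2] [v1 v2].
have reE i : complex.Re ((a +i* b) * u i + v i) =
    a * complex.Re (u i) + ((- b) * complex.Im (u i) + complex.Re (v i)).
  by case: (u i) (v i) => [x y] [x' y'] /=; ring.
have imE i : complex.Im ((a +i* b) * u i + v i) =
    a * complex.Im (u i) + (b * complex.Re (u i) + complex.Im (v i)).
  by case: (u i) (v i) => [x y] [x' y'] /=; ring.
rewrite /csummable /csum (funext reE) (funext imE).
split; first by split; apply: summable_lin => //; apply: summable_lin.
rewrite !rsum_lin //; [|exact: summable_lin..].
by apply/eqP; rewrite eq_complex /=; apply/andP; split; apply/eqP; ring.
Qed.

Lemma csum_conj u : csummable u ->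
  csum (fun i => Num.conj (u i)) = Num.conj (csum u).
Proof.
move=> [_ su]; rewrite /csum.
have reE i : complex.Re (Num.conj (u i)) = complex.Re (u i) by case: (u i).
have imE i : complex.Im (Num.conj (u i)) = (-1) * complex.Im (u i).
  by case: (u i) => x y; rewrite mulN1r.
by rewrite (funext reE) (funext imE) rsumZ // mulN1r.
Qed.

Lemma csum_real (u : I -> R) : csum (fun i => (u i)%:C) = (rsum u)%:C.
Proof. by rewrite /csum /= rsum0. Qed.

Lemma csum_supp u (s : seq I) : uniq s -> (forall i, i \notin s -> u i = 0) ->
  csum u = \sum_(i <- s) u i.
Proof.
move=> us u0; rewrite /csum !(fun f h => (@rsum_supp R I f s us h).2).
- rewrite /partial; elim: s {us u0} => [|i s IH]; rewrite ?big_nil //.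
  by rewrite !big_cons -IH; case: (u i).
- by move=> i /u0 ->.
- by move=> i /u0 ->.
Qed.

Definition l2_pred : {pred (I -> C)} :=
  fun f => `[< summable (fun i => nsq (f i)) >].

Lemma l2_predP f : reflect (summable (fun i => nsq (f i))) (f \in l2_pred).
Proof. exact: asboolP. Qed.

Let l2_submod : submod_closed l2_pred.
Proof.
split=> [|k f g /l2_predP sf /l2_predP sg]; apply/l2_predP.
  have -> : (fun i => nsq ((0 : I -> C) i)) = fun=> 0 :> R.
    by apply/funext => i; apply: nsq0.
  exact: summable0.
apply: (@le_summable _ _ _ (fun i => 2 * nsq k * nsq (f i) + 2 * nsq (g i))).
  move=> i; rewrite nsq_ge0; apply: le_trans (nsqD_le _ _) _.
  by rewrite nsqM mulrA.
by apply: summable_lin => //; apply: summableZ.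
Qed.
HB.instance Definition _ := GRing.isSubmodClosed.Build C (I -> C) l2_pred l2_submod.

Record l2 := L2 { l2_val :> I -> C; l2_valP : l2_val \in l2_pred }.
HB.instance Definition _ := [isSub for l2_val].
HB.instance Definition _ := [Choice of l2 by <:].
HB.instance Definition _ := [SubChoice_isSubLmodule of l2 by <:].

Lemma l2P (f g : l2) : (forall i, f i = g i) -> f = g.
Proof. by move=> fg; apply: val_inj; apply/funext. Qed.

Lemma l2_sq (f : l2) : summable (fun i => nsq (f i)).
Proof. exact/l2_predP/l2_valP. Qed.
Arguments l2_sq : clear implicits.

Lemma l2E k (f g : l2) i : (k *: f + g) i = k * f i + g i.
Proof. by []. Qed.
Lemma l2D (f g : l2) i : (f + g) i = f i + g i. Proof. by []. Qed.
Lemma l2N (f : l2) i : (- f) i = - f i. Proof. by []. Qed.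
Lemma l2Z k (f : l2) i : (k *: f) i = k * f i. Proof. by []. Qed.
Lemma l2_0 i : (0 : l2) i = 0. Proof. by []. Qed.

Definition l2_ip (f g : l2) : C := csum (fun i => f i * Num.conj (g i)).

(** The real and imaginary parts of each term are at most |f i|^2 + |g i|^2. *)
Lemma l2_ip_summable (f g : l2) : csummable (fun i => f i * Num.conj (g i)).
Proof.
have sfg := summableD (l2_sq f) (l2_sq g).
split; apply: abs_summable sfg => i; [exact: abs_re_le | exact: abs_im_le].
Qed.

Lemma l2_ip_linl k f f' g :
  l2_ip (k *: f + f') g = k * l2_ip f g + l2_ip f' g.
Proof.
have [_ <-] := csum_lin k (l2_ip_summable f g) (l2_ip_summable f' g).
by congr csum; apply/funext => i; rewrite l2E mulrDl mulrA.
Qed.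

Lemma l2_ipC f g : l2_ip f g = Num.conj (l2_ip g f).
Proof.
rewrite /l2_ip -csum_conj; last exact: l2_ip_summable.
by congr csum; apply/funext => i; rewrite rmorphM /= conjCK mulrC.
Qed.

Lemma l2_ip_linr k f g g' :
  l2_ip f (k *: g + g') = Num.conj k * l2_ip f g + l2_ip f g'.
Proof.
by rewrite l2_ipC l2_ip_linl rmorphD rmorphM /= -!l2_ipC.
Qed.

Definition l2_sqnorm (f : l2) : R := rsum (fun i => nsq (f i)).

Lemma l2_ip_sq f : l2_ip f f = (l2_sqnorm f)%:C.
Proof. by rewrite -csum_real; congr csum; apply/funext => i; rewrite nsqJ. Qed.

Lemma l2_sqnorm_ge (f : l2) s : uniq s -> \sum_(i <- s) nsq (f i) <= l2_sqnorm f.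
Proof. by move=> us; apply: partial_le => // [i|]; [exact: nsq_ge0|exact: l2_sq]. Qed.

Lemma l2_ip_gt0 f : f != 0 -> 0 < l2_ip f f.
Proof.
move=> f0; rewrite l2_ip_sq -[0]/(0%:C) ltcR lt_def rsum_ge0 ?andbT; last first.
- exact: l2_sq.
- by move=> i; exact: nsq_ge0.
apply: contra f0 => /eqP n0; apply/eqP/l2P => i; apply: nsq_eq0.
have := @l2_sqnorm_ge f [:: i] isT; rewrite big_seq1 n0 => le0.
by apply/le_anti; rewrite le0 nsq_ge0.
Qed.

Let l2_ip_0 f : l2_ip f 0 = 0.
Proof.
have := l2_ip_linr 1 f 0 0; rewrite rmorph1 mul1r scaler0 addr0 => /eqP.
by rewrite -subr_eq subrr eq_sym => /eqP.
Qed.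
Let l2_ip_0l f : l2_ip 0 f = 0.
Proof. by rewrite l2_ipC l2_ip_0 conjC0. Qed.

Let l2_ip_additivel g : zmod_morphism (l2_ip^~ g).
Proof. by move=> f f'; rewrite addrC -scaleN1r l2_ip_linl mulN1r addrC. Qed.
Let l2_ip_additiver f : zmod_morphism (l2_ip f).
Proof.
by move=> g g'; rewrite addrC -scaleN1r l2_ip_linr rmorphN rmorph1 mulN1r addrC.
Qed.
Let l2_ip_scalel g : scalable_for *%R (l2_ip^~ g).
Proof. by move=> k f; have := l2_ip_linl k f 0 g; rewrite l2_ip_0l !addr0. Qed.
Let l2_ip_scaler f : scalable_for (Num.conj \; *%R) (l2_ip f).
Proof. by move=> k g; have := l2_ip_linr k f g 0; rewrite l2_ip_0 !addr0. Qed.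

HB.instance Definition _ := isBilinear.Build C l2 l2 C *%R (Num.conj \; *%R) l2_ip
  l2_ip_additivel l2_ip_additiver l2_ip_scalel l2_ip_scaler.
Let l2_ip_herm f g : l2_ip f g = (-1) ^+ false * Num.conj (l2_ip g f).
Proof. by rewrite mul1r -l2_ipC. Qed.
HB.instance Definition _ :=
  isHermitianSesquilinear.Build C l2 false Num.conj l2_ip l2_ip_herm.
HB.instance Definition _ := isDotProduct.Build C l2 l2_ip l2_ip_gt0.

Definition l2_dot : {dot l2 for Num.conj} := l2_ip.

End SquareSummable.
Arguments l2_sq {R I} f.

(** * The norm and completeness *)

Section CauchySchwarz.
Variables (C : numClosedFieldType) (U : lmodType C) (form : {dot U for Num.conj}).
Local Notation "''[' u , v ]" := (form u%R v%R) : ring_scope.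
Local Notation "''[' u ]" := (form u%R u%R) : ring_scope.

(** Expand the square of the component of u orthogonal to v. *)
Lemma dot_CauchySchwarz u v : `|'[u, v]| ^+ 2 <= '[u] * '[v].
Proof.
have [->|v0] := eqVneq v 0; first by rewrite linear0r normr0 expr0n /= linear0r mulr0.
have n0 : 0 < '[v] by rewrite dnorm_gt0.
have nJ : Num.conj '[v] = '[v] by apply/CrealP; rewrite gtr0_real.
set c := '[u, v]; have := dnorm_ge0 form (u - (c / '[v]) *: v).
rewrite dnormB dnormZ linearZr_LR /= -/c rmorphM fmorphV /= nJ.
have -> : Num.conj c / '[v] * c = `|c| ^+ 2 / '[v] by rewrite normCK mulrAC [Num.conj c * c]mulrC.
have dR : Num.conj (`|c| ^+ 2 / '[v]) = `|c| ^+ 2 / '[v].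
  by apply/CrealP; rewrite ger0_real // divr_ge0 ?exprn_ge0 ?(ltW n0).
have -> : `|c / '[v]| ^+ 2 * '[v] = `|c| ^+ 2 / '[v].
  by rewrite normrM normfV (gtr0_norm n0) exprMn exprVn -mulrA expr2 invfM mulrVK
    ?unitfE ?gt_eqF.
by rewrite dR opprD addrA addrK subr_ge0 ler_pdivrMr.
Qed.

Lemma dot_triangle u v : sqrtC '[u + v] <= sqrtC '[u] + sqrtC '[v].
Proof.
rewrite -(@ler_pXn2r _ 2) ?nnegrE ?addr_ge0 ?sqrt_dnorm_ge0 //.
rewrite sqrrD !sqrtCK dnormD [leRHS]addrAC lerD2l.
set d := '[u, v]; apply: (@le_trans _ _ (`|d| *+ 2)).
  apply: (@le_trans _ _ `|d + Num.conj d|).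
    apply: real_ler_norm; apply/CrealP.
    by rewrite rmorphD /= conjCK addrC.
  by apply: le_trans (ler_normD _ _) _; rewrite norm_conjC.
rewrite lerMn2r /= -sqrtCM ?nnegrE ?dnorm_ge0 //.
rewrite -[`|d|]sqrCK // ler_sqrtC ?nnegrE ?exprn_ge0 ?mulr_ge0 ?dnorm_ge0 //.
exact: dot_CauchySchwarz.
Qed.
End CauchySchwarz.

Section HilbertSpace.
Variables (R : realType) (I : countType).
Local Notation C := R[i].
Local Notation l2 := (l2 R I).

Definition l2_norm (f : l2) : C := sqrtC (l2_dot R I f f).

Let l2_normD f g : l2_norm (f + g) <= l2_norm f + l2_norm g.
Proof. exact: dot_triangle. Qed.

Let l2_normZ k f : l2_norm (k *: f) = `|k| * l2_norm f.
Proof.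
rewrite /l2_norm dnormZ sqrtCM ?nnegrE ?exprn_ge0 ?dnorm_ge0 //.
by rewrite sqrCK.
Qed.

Let l2_norm0 f : l2_norm f = 0 -> f = 0.
Proof. by move=> /eqP; rewrite sqrt_dnorm_eq0 => /eqP. Qed.

HB.instance Definition _ :=
  Lmodule_isNormed.Build C l2 l2_normD l2_normZ l2_norm0.

Lemma l2_normE (f : l2) : `|f| ^+ 2 = (l2_sqnorm f)%:C.
Proof. by rewrite -l2_ip_sq; exact: sqrtCK. Qed.

Lemma l2_norm_lt (f : l2) (e : R) : 0 < e -> (`|f| < e%:C) = (l2_sqnorm f < e ^+ 2).
Proof.
move=> e0; rewrite -(@ltr_pXn2r _ 2) ?nnegrE //; last by rewrite ler0c ltW.
by rewrite l2_normE -rmorphXn ltcR.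
Qed.

Lemma l2_norm_le (f : l2) (e : R) : 0 <= e -> (`|f| <= e%:C) = (l2_sqnorm f <= e ^+ 2).
Proof.
move=> e0; rewrite -(@ler_pXn2r _ 2) ?nnegrE //; last by rewrite ler0c.
by rewrite l2_normE -rmorphXn lecR.
Qed.

End HilbertSpace.

Section Completeness.
Variables (R : realType) (I : countType).
Local Notation C := R[i].
Local Notation l2 := (l2 R I).

Lemma l2_coord (f : l2) i : nsq (f i) <= l2_sqnorm f.
Proof. by have := @l2_sqnorm_ge R I f [:: i] isT; rewrite big_seq1. Qed.

Lemma re_lt (z : C) e : 0 < e -> nsq z < e ^+ 2 -> `|complex.Re z| < e.
Proof.
move=> e0 ze; rewrite -(@ltr_pXn2r _ 2) ?nnegrE ?(ltW e0) //.
by rewrite real_normK ?num_real //; apply: le_lt_trans ze; rewrite lerDl sqr_ge0.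
Qed.
Lemma im_lt (z : C) e : 0 < e -> nsq z < e ^+ 2 -> `|complex.Im z| < e.
Proof.
move=> e0 ze; rewrite -(@ltr_pXn2r _ 2) ?nnegrE ?(ltW e0) //.
by rewrite real_normK ?num_real //; apply: le_lt_trans ze; rewrite lerDr sqr_ge0.
Qed.

Lemma gt0C_real (e : C) : 0 < e -> exists2 r : R, 0 < r & e = r%:C.
Proof.
case: e => x y; rewrite ltcE /= => /andP[/eqP -> x0]; by exists x.
Qed.

Section CauchyFilter.
Variable F : set_system l2.
Hypotheses (PF : ProperFilter F) (cF : cauchy F).

Let cFe (e : R) : 0 < e -> exists f, F (fun g => l2_sqnorm (f - g) < e ^+ 2).
Proof.
move=> e0; have /cauchyP/(_ e%:C) [|f Ff] := cF; first by rewrite -[0]/(0%:C) ltcR.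
exists f; apply: filterS Ff => g; rewrite -ball_normE /= => fg.
by rewrite -l2_norm_lt.
Qed.

(** A bound on the squared norm bounds each coordinate, so coordinates of a Cauchy
    filter are Cauchy; p stands for the real or the imaginary part. *)
Let coord_cvg (p : C -> R) i :
  (forall z w, p (z - w) = p z - p w) ->
  (forall z e, 0 < e -> nsq z < e ^+ 2 -> `|p z| < e) ->
  cvg ((fun f : l2 => p (f i)) @ F).
Proof.
move=> pB pe; apply: cauchy_cvg; apply/cauchyP => e e0.
have [f Ff] := cFe e0; exists (p (f i)).
suff : F [set g | ball (p (f i)) e (p (g i))] by [].
apply: filterS Ff => g /= fg; rewrite -ball_normE /= -pB; apply: pe => //.
by apply: le_lt_trans fg; apply: l2_coord (f - g) i.
Qed.

Let reB (z w : C) : complex.Re (z - w) = complex.Re z - complex.Re w.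
Proof. by case: z w => [? ?] []. Qed.
Let imB (z w : C) : complex.Im (z - w) = complex.Im z - complex.Im w.
Proof. by case: z w => [? ?] []. Qed.

Let g i : C := lim ((fun f : l2 => complex.Re (f i)) @ F) +i*
  lim ((fun f : l2 => complex.Im (f i)) @ F).

Let nsq_cvg (f : l2) i : (fun h : l2 => nsq (f i - h i)) @ F --> nsq (f i - g i).
Proof.
rewrite /nsq /=; under eq_cvg do rewrite reB imB.
rewrite reB imB /= !expr2.
have c1 := coord_cvg (i := i) reB (@re_lt).
have c2 := coord_cvg (i := i) imB (@im_lt).
by apply: cvgD; apply: cvgM; apply: cvgB => //; apply: cvg_cst.
Qed.

Let partial_cvg (f : l2) (s : seq I) :
  (fun h : l2 => \sum_(i <- s) nsq (f i - h i)) @ F --> \sum_(i <- s) nsq (f i - g i).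
Proof.
elim: s => [|i s IH].
  by under eq_cvg do rewrite big_nil; rewrite big_nil; apply: cvg_cst.
under eq_cvg do rewrite big_cons.
by rewrite big_cons; apply: cvgD.
Qed.

(** The tail estimate survives the passage to the coordinatewise limit, because it
    only involves finite sums. *)
Let partial_bound (f : l2) e : F (fun h => l2_sqnorm (f - h) < e ^+ 2) ->
  forall s, uniq s -> \sum_(i <- s) nsq (f i - g i) <= e ^+ 2.
Proof.
move=> Fe s us; rewrite -(cvg_lim _ (@partial_cvg f s)) //.
apply: limr_le; first by apply/cvg_ex; eexists; exact: partial_cvg.
apply: filterS Fe => h he; apply: ltW; apply: le_lt_trans he.
exact: (@l2_sqnorm_ge R I (f - h)).
Qed.

(** The coordinatewise limit g differs from one member of the filter by a
    square-summable family, so g is square-summable itself; the same finite-sum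
    bound shows that the filter converges to it in norm. *)
Lemma l2_cauchy_cvg : cvg F.
Proof.
have dif f e : F (fun h => l2_sqnorm (f - h) < e ^+ 2) ->
    (fun i => f i - g i) \in @l2_pred R I /\ rsum (fun i => nsq (f i - g i)) <= e ^+ 2.
  move=> Fe; have nn i : 0 <= nsq (f i - g i) by apply: nsq_ge0.
  have [sm le] := bounded_summable nn (partial_bound Fe).
  by split=> //; apply/l2_predP.
have [f1 /dif [in1 _]] := cFe (@ltr01 R).
pose G : l2 := f1 - L2 in1.
have GE i : G i = g i by rewrite /G l2D l2N /= opprB addrC subrK.
apply: (cvgP G); apply/fcvgrPdist_lt => e /gt0C_real[r r0 ->].
have r2 : 0 < r / 2 by rewrite divr_gt0.
have [f Ff] := cFe r2.
have fG : `|f - G| <= (r / 2)%:C.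
  rewrite l2_norm_le ?(ltW r2) //; have [_] := dif _ _ Ff.
  rewrite /l2_sqnorm; under [in X in _ -> X]eq_fun do rewrite l2D l2N GE.
  by [].
apply: filterS Ff => h; rewrite -l2_norm_lt // => fh.
have -> : G - h = (G - f) + (f - h) by rewrite addrA subrK.
rewrite [r]splitr rmorphD /=; apply: le_lt_trans (ler_normD _ _) _.
by rewrite distrC ler_ltD.
Qed.
End CauchyFilter.

HB.instance Definition _ := Uniform_isComplete.Build l2 l2_cauchy_cvg.

Definition l2_hilbert : hilbert R := @Hilbert R l2 (l2_dot R I) (fun u => sqrtCK _).
End Completeness.

(** * Finitely supported vectors and weighted composition operators *)

Section Operators.
Variables (R : realType) (I : countType).
Local Notation C := R[i].
Local Notation l2 := (l2 R I).

(** The family u itself when u is square-summable, and the zero vector otherwise.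
    The construction sits inside an opaque proof, here and for the operators below,
    so that unification treats these vectors and operators as atoms. *)
Lemma mkl2_ex (u : I -> C) :
  {f : l2 | u \in @l2_pred R I -> forall i, f i = u i}.
Proof. by exists (insubd (0 : l2) u) => hu i; rewrite insubdK. Qed.

Definition mkl2 (u : I -> C) : l2 := sval (mkl2_ex u).

Lemma mkl2E u : u \in @l2_pred R I -> forall i, mkl2 u i = u i.
Proof. exact: (svalP (mkl2_ex u)). Qed.

Definition fin_supp (u : I -> C) := exists s : seq I, forall i, i \notin s -> u i = 0.

Lemma fin_supp_l2 u : fin_supp u -> u \in @l2_pred R I.
Proof.
move=> [s us]; apply/l2_predP.
have h i : i \notin undup s -> nsq (u i) = 0 by rewrite mem_undup => /us ->; apply: nsq0.
by have [] := rsum_supp (undup_uniq s) h.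
Qed.

Lemma fin_supp_subspace : is_subspace [set f : l2 | fin_supp f].
Proof.
split=> [|k f g [s fs] [t gt]]; first by exists [::].
exists (s ++ t) => i; rewrite mem_cat negb_or => /andP[/fs fi /gt gi].
by rewrite l2E fi gi mulr0 addr0.
Qed.

Lemma ket_ex : {k : I -> l2 | forall i j, k i j = (j == i)%:R}.
Proof.
exists (fun i => mkl2 (fun j => (j == i)%:R)) => i j.
by apply/mkl2E/fin_supp_l2; exists [:: i] => k; rewrite inE; move/negbTE => ->.
Qed.

Definition ket : I -> l2 := sval ket_ex.

Lemma ketE i j : ket i j = (j == i)%:R.
Proof. exact: (svalP ket_ex). Qed.

Lemma ket_fin_supp i : fin_supp (ket i).
Proof. by exists [:: i] => k; rewrite inE ketE => /negbTE ->. Qed.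

Lemma l2_sum_coord (J : Type) (r : seq J) (f : J -> l2) i :
  (\sum_(j <- r) f j) i = \sum_(j <- r) f j i.
Proof. by elim: r => [|j r IH]; rewrite ?big_nil ?big_cons //= -IH. Qed.

Definition trunc (f : l2) (s : seq I) : l2 := \sum_(i <- s) f i *: ket i.

Lemma truncE f s i : uniq s -> trunc f s i = if i \in s then f i else 0.
Proof.
move=> us; rewrite l2_sum_coord.
under eq_bigr do rewrite l2Z ketE.
case: ifPn => [si|nsi]; last first.
  rewrite big_seq big1 // => j sj; case: eqVneq => [ij|]; last by rewrite mulr0.
  by rewrite ij sj in nsi.
rewrite (bigD1_seq i) //= eqxx mulr1 big1 ?addr0 // => j ji.
by rewrite eq_sym (negbTE ji) mulr0.
Qed.

Lemma fin_supp_ket (f : l2) : fin_supp f -> exists2 s, uniq s & f = trunc f s.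
Proof.
move=> [s fs]; exists (undup s); rewrite ?undup_uniq //; apply: l2P => i.
rewrite truncE ?undup_uniq // mem_undup; by case: ifPn => // /fs.
Qed.

Lemma trunc_fin_supp (f : l2) s : uniq s -> fin_supp (trunc f s).
Proof. by move=> us; exists s => i si; rewrite truncE // (negbTE si). Qed.

Lemma trunc_approx (f : l2) e : 0 < e -> exists n, `|f - trunc f (upto I n)| < e.
Proof.
move=> /gt0C_real[r r0 ->]; have r2 : 0 < r ^+ 2 by rewrite exprn_gt0.
have [n hn] := rsum_tail (fun i => nsq_ge0 (f i)) (l2_sq f) r2.
exists n; rewrite l2_norm_lt //; apply: le_lt_trans hn.
have us := upto_uniq I n; set s := upto I n in us *.
have h i : i \notin s -> (if i \in s then nsq (f i) else 0) = 0 by move/negbTE ->.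
have [sm sE] := rsum_supp us h.
rewrite lerBrDr -[X in _ + X]mul1r /l2_sqnorm.
have -> : partial (fun i => nsq (f i)) s = rsum (fun i => if i \in s then nsq (f i) else 0).
  by rewrite sE /partial; apply: eq_big_seq => i ->.
rewrite addrC -rsum_lin //; last exact: l2_sq.
rewrite le_eqVlt; apply/orP; left; apply/eqP; congr rsum; apply/funext => i.
rewrite mul1r l2D l2N truncE //; case: ifP => _; first by rewrite subrr nsq0 addr0.
by rewrite subr0 add0r.
Qed.

Lemma fin_supp_dense : dense [set f : l2 | fin_supp f].
Proof.
move=> O [f Of] oO; have /nbhs_ballP[e /= e0 fO] : nbhs f O by apply: open_nbhs_nbhs.
have [n fn] := trunc_approx f e0; exists (trunc f (upto I n)); split; last first.
  by apply: trunc_fin_supp; apply: upto_uniq.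
by apply: fO; rewrite -ball_normE.
Qed.

(** The functional kills truncations, and these approximate every vector. *)
Lemma bounded_eq0 (phi : l2 -> C) (K : R) :
  (forall f g, phi (f - g) = phi f - phi g) ->
  (forall f, `|phi f| <= K%:C * `|f|) ->
  (forall k i, phi (k *: ket i) = 0) -> forall f, phi f = 0.
Proof.
move=> phiB phiK phi0 f.
have p0 : phi 0 = 0 by rewrite -(subrr 0) phiB subrr.
have phiD f' g : phi (f' + g) = phi f' + phi g.
  by rewrite -{1}[g]opprK -[- g]sub0r !phiB p0 sub0r opprK.
have phit s : phi (trunc f s) = 0.
  by rewrite (big_morph phi phiD p0) big1.
apply/eqP; rewrite -normr_le0; apply/ler_addgt0Pr => e /gt0C_real[r r0 ->].
rewrite add0r.
pose M := `|K| + 1; have M0 : 0 < M by rewrite ltr_wpDl.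
have rM : 0 < (r / M)%:C by rewrite -[0]/(0%:C) ltcR divr_gt0.
have [n hn] := trunc_approx f rM.
rewrite -[phi f]subr0 -(phit (upto I n)) -phiB; apply: le_trans (phiK _) _.
apply: (@le_trans _ _ (M%:C * (r / M)%:C)); last first.
  by rewrite -rmorphM /= mulrCA mulfV ?mulr1 // gt_eqF.
apply: (@le_trans _ _ (M%:C * `|f - trunc f (upto I n)|)).
  by rewrite ler_wpM2r // lecR /M (le_trans (ler_norm K)) // lerDl.
by rewrite ler_wpM2l ?ltW // -[0]/(0%:C) ltcR.
Qed.

Lemma l2_ip_ket (f : l2) i : l2_ip f (ket i) = f i.
Proof.
rewrite /l2_ip (@csum_supp _ _ _ [:: i]) //.
  by rewrite big_seq1 ketE eqxx conjC1 mulr1.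
by move=> j; rewrite inE ketE => /negbTE ->; rewrite conjC0 mulr0.
Qed.

Lemma l2_ip_bound (f g : l2) : `|l2_ip f g| <= `|f| * `|g|.
Proof.
rewrite -(@ler_pXn2r _ 2) ?nnegrE ?mulr_ge0 // exprMn !l2_normE -!l2_ip_sq.
exact: (dot_CauchySchwarz (l2_dot R I)).
Qed.

(** The generators of the algebra act by operators (T f)(i) = w i * f (t i).  Such an
    operator is a contraction as soon as the weights have modulus at most 1 and t is
    injective where the weight does not vanish. *)
Section WeightedComposition.
Variables (w : I -> C) (t : I -> I).

Definition wcomp_raw (f : I -> C) i := w i * f (t i).
Definition wcomp (f : l2) : l2 := mkl2 (wcomp_raw f).

Definition contractive := (forall i, nsq (w i) <= 1) /\
  (forall i j, w i != 0 -> w j != 0 -> t i = t j -> i = j).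

Hypothesis cw : contractive.

(** The indices with nonzero weight are sent by t to distinct indices, so a finite
    partial sum for T f is dominated by one for f. *)
Lemma wcomp_partial (f : l2) s : uniq s ->
  partial (fun i => nsq (wcomp_raw f i)) s <= l2_sqnorm f.
Proof.
move=> us; pose r := [seq i <- s | w i != 0].
apply: (@le_trans _ _ (\sum_(i <- r) nsq (f (t i)))).
  rewrite /partial (bigID (fun i => w i != 0)) /= [X in _ + X]big1 ?addr0; last first.
    by move=> i /negPn/eqP wi; rewrite /wcomp_raw wi mul0r nsq0.
  rewrite big_filter; apply: ler_sum => i _; rewrite nsqM.
  by rewrite -[leRHS]mul1r ler_wpM2r ?nsq_ge0 //; case: cw.
rewrite -(big_map t xpredT (fun j => nsq (f j))); apply: l2_sqnorm_ge.
rewrite map_inj_in_uniq ?filter_uniq // => i j; rewrite !mem_filter.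
by case/andP => wi _ /andP[wj _]; case: cw => _; apply.
Qed.

Lemma wcomp_l2 (f : l2) : wcomp_raw f \in @l2_pred R I.
Proof.
apply/l2_predP; have nn i := nsq_ge0 (wcomp_raw f i).
by have [] := bounded_summable nn (@wcomp_partial f).
Qed.

Lemma wcompE (f : l2) i : wcomp f i = w i * f (t i).
Proof. exact/mkl2E/wcomp_l2. Qed.

Lemma wcomp_linear : linear wcomp.
Proof.
by move=> k f g; apply: l2P => i; rewrite l2E !wcompE l2E mulrDr mulrCA.
Qed.

Lemma wcomp_contr (f : l2) : `|wcomp f| <= `|f|.
Proof.
rewrite -(@ler_pXn2r _ 2) ?nnegrE // !l2_normE lecR.
have nn i := nsq_ge0 (wcomp_raw f i).
have [_] := bounded_summable nn (@wcomp_partial f).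
rewrite /l2_sqnorm; under [in X in _ -> X]eq_fun do rewrite wcompE.
by [].
Qed.
End WeightedComposition.

(** Where w does not vanish, t' undoes t and w' carries the conjugate weight.  The
    condition is one-sided, since t need not be invertible at the boundary. *)
Definition half_adjoint (w w' : I -> C) (t t' : I -> I) :=
  forall i, w i != 0 -> w' (t i) = Num.conj (w i) /\ t' (t i) = i.

(** Both sides are bounded in g, so it is enough to compare them on basis vectors,
    where the adjoint is visible from the weights. *)
Lemma wcomp_adjoint w w' t t' : contractive w t -> contractive w' t' ->
  half_adjoint w w' t t' -> half_adjoint w' w t' t ->
  forall f g, l2_ip (wcomp w t f) g = l2_ip f (wcomp w' t' g).
Proof.
move=> cw cw' ad ad' f g.
have Tb j : wcomp w' t' (ket j) = Num.conj (w j) *: ket (t j).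
  apply: l2P => k; rewrite wcompE // l2Z !ketE.
  have [wj|wj] := eqVneq (w j) 0.
    rewrite wj conjC0 mul0r; case: eqVneq => [kj|_]; last by rewrite mulr0.
    have [->|w'k] := eqVneq (w' k) 0; first by rewrite mul0r.
    have [e _] := ad' k w'k; move: w'k; rewrite kj wj in e.
    by rewrite -[w' k]conjCK -e conjC0 eqxx.
  have [e1 e2] := ad j wj; have [->|kt] := eqVneq k (t j).
    by rewrite e1 e2 eqxx.
  rewrite mulr0; case: eqVneq => [kj|_]; last by rewrite mulr0.
  have [->|w'k] := eqVneq (w' k) 0; first by rewrite mul0r.
  by have [_ e] := ad' k w'k; rewrite -e kj eqxx in kt.
apply/eqP; rewrite -subr_eq0; apply/eqP.
pose phi g := l2_ip (wcomp w t f) g - l2_ip f (wcomp w' t' g).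
have wl := linear_spec (wcomp_linear cw'); have [_ wD wN wZ] := wl.
have ipZ k (u v : l2) : l2_ip u (k *: v) = Num.conj k * l2_ip u v.
  exact: (linearZr_LR (l2_dot R I)).
apply: (@bounded_eq0 phi (2 * complex.Re `|f|)).
- move=> g1 g2; rewrite /phi wD wN !(linearBr (l2_dot R I)) /=.
  by rewrite !opprB [LHS]addrACA [RHS]addrACA [X in _ + X = _]addrC.
- move=> h; rewrite rmorphM /= RRe_real ?normr_real //.
  apply: le_trans (ler_normB _ _) _.
  rewrite rmorph_nat -mulrA mulr_natl mulr2n lerD //.
    apply: le_trans (l2_ip_bound _ _) _.
    by rewrite ler_wpM2r // wcomp_contr.
  apply: le_trans (l2_ip_bound _ _) _.
  by rewrite ler_wpM2l // wcomp_contr.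
- move=> k j; rewrite /phi wZ Tb !ipZ conjCK !l2_ip_ket wcompE //.
  by rewrite subrr.
Qed.

End Operators.

(** * A bounded representation of the algebra *)

Section Endomorphisms.
Variables (K : fieldType) (V : lmodType K).

(** Linear endomorphisms form a module with a bilinear composition, which is the
    kind of target that the universal property of the algebra requires. *)
Definition endo_pred : {pred (V -> V)} := fun f => `[< linear f >].

Let endo_submod : submod_closed endo_pred.
Proof.
split=> [|k f g /asboolP lf /asboolP lg]; apply/asboolP => c u v.
  by rewrite /= scaler0 addr0.
rewrite !fctE lf lg !scalerDr !scalerA [k * c]mulrC.
by rewrite addrACA.
Qed.
HB.instance Definition _ := GRing.isSubmodClosed.Build K (V -> V) endo_pred endo_submod.

Record endo := Endo { endo_val :> V -> V; endo_valP : endo_val \in endo_pred }.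
HB.instance Definition _ := [isSub for endo_val].
HB.instance Definition _ := [Choice of endo by <:].
HB.instance Definition _ := [SubChoice_isSubLmodule of endo by <:].

Lemma endo_linear (f : endo) : linear f.
Proof. exact/asboolP/endo_valP. Qed.

Lemma endoP (f g : endo) : (forall v, f v = g v) -> f = g.
Proof. by move=> fg; apply: val_inj; apply/funext. Qed.

Definition mk_endo (f : V -> V) (lf : linear f) : endo :=
  @Endo f (introT (asboolP _) lf).

Definition endo1 : endo := @mk_endo id (fun _ _ _ => erefl).
Definition endo_comp (f g : endo) : endo :=
  @mk_endo (f \o g) (fun k u v =>
    etrans (congr1 f (endo_linear g k u v)) (endo_linear f k (g u) (g v))).

Lemma endo_compA : associative endo_comp. Proof. by move=> f g h; apply: endoP. Qed.
Lemma endo_comp1l : left_id endo1 endo_comp. Proof. by move=> f; apply: endoP. Qed.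
Lemma endo_comp1r : right_id endo1 endo_comp. Proof. by move=> f; apply: endoP. Qed.
Lemma endo_comp_bilin : bilin endo_comp.
Proof.
by split=> [g k f f'|f k g g']; apply: endoP => v //=; exact: endo_linear.
Qed.
End Endomorphisms.

Section Representation.
Variables (R : realType) (q : R) (hq : 0 < q < 1).
Local Notation C := R[i].
Local Notation I := (nat * int * bool)%type.
Local Notation V := (l2 R I).
Local Notation A := (SUq2_star hq).

Lemma q_gt0 : 0 < q. Proof. by case/andP: hq. Qed.
Lemma q_lt1 : q < 1. Proof. by case/andP: hq. Qed.
Lemma q_neq0 : q != 0. Proof. by rewrite gt_eqF ?q_gt0. Qed.

(** The coefficients s_n of a and d; s_0 = 0 makes the lowering operator stop. *)
Definition ladder (n : nat) : R := Num.sqrt (1 - q ^+ (2 * n)).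

Lemma ladder_sqr n : ladder n ^+ 2 = 1 - q ^+ (2 * n).
Proof. by rewrite sqr_sqrtr // subr_ge0 exprn_ile1 // ltW ?q_gt0 ?q_lt1. Qed.

Lemma ladder0 : ladder 0 = 0.
Proof. by rewrite /ladder muln0 expr0 subrr sqrtr0. Qed.

Lemma ladder_gt0 n : (0 < n)%N -> 0 < ladder n.
Proof.
move=> n0; rewrite sqrtr_gt0 subr_gt0 exprn_ilt1 ?q_lt1 ?(ltW q_gt0) //.
by rewrite muln_eq0 /= -lt0n.
Qed.

(** The operators in coordinates: the value at i is gen_wgt g i times the value at
    gen_shift g i.  The predecessor of 0 in the shift of d is harmless, because the
    weight s_0 vanishes there. *)
Definition gen_wgt (g : su_gen) (i : I) : C :=
  match g with
  | Ga => (ladder i.1.1.+1)%:C | Gb => - q%:C ^+ i.1.1.+1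
  | Gc => q%:C ^+ i.1.1 | Gd => (ladder i.1.1)%:C
  end.

Definition gen_shift (g : su_gen) (i : I) : I :=
  match g with
  | Ga => (i.1.1.+1, i.1.2, i.2) | Gb => (i.1.1, i.1.2 + 1, i.2)
  | Gc => (i.1.1, i.1.2 - 1, i.2) | Gd => (i.1.1.-1, i.1.2, i.2)
  end.

Lemma gen_contractive g : contractive (gen_wgt g) (gen_shift g).
Proof.
have nsqR (x : R) : nsq x%:C = x ^+ 2 by rewrite /nsq /= expr0n addr0.
have q1 n : (q ^+ n) ^+ 2 <= 1.
  by rewrite -exprM exprn_ile1 // ltW ?q_gt0 ?q_lt1.
have s1 n : ladder n ^+ 2 <= 1.
  by rewrite ladder_sqr lerBlDr lerDl exprn_ge0 // ltW // q_gt0.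
split.
  by case: g => i; rewrite /= -?rmorphXn -?rmorphN /= nsqR ?sqrrN.
move=> [[n m] s] [[n' m'] s']; case: g => /= wi wj [].
- by move=> -> -> ->.
- by move=> -> /addIr -> ->.
- by move=> -> /addIr -> ->.
have n0 k : (ladder k)%:C != 0 :> C -> k = k.-1.+1.
  by case: k => // /eqP; rewrite ladder0.
by move: wi wj => /n0 -> /n0 -> /= -> -> ->.
Qed.

Lemma gen_op_ex : {T : su_gen -> endo V |
  forall g f i, T g f i = gen_wgt g i * f (gen_shift g i)}.
Proof.
exists (fun g => mk_endo (wcomp_linear (gen_contractive g))) => g f i.
exact: (wcompE (gen_contractive g)).
Qed.

Definition gen_op : su_gen -> endo V := sval gen_op_ex.

Lemma gen_opE g (f : V) i : gen_op g f i = gen_wgt g i * f (gen_shift g i).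
Proof. exact: (svalP gen_op_ex). Qed.

Lemma gen_op_wcomp g (f : V) : gen_op g f = wcomp (gen_wgt g) (gen_shift g) f.
Proof. by apply: l2P => i; rewrite gen_opE (wcompE (gen_contractive g)). Qed.

Lemma endoD (f g : endo V) v : (f + g) v = f v + g v. Proof. by []. Qed.
Lemma endoN (f : endo V) v : (- f) v = - f v. Proof. by []. Qed.
Lemma endoZ k (f : endo V) v : (k *: f) v = k *: f v. Proof. by []. Qed.
Lemma endo_compE (f g : endo V) v : endo_comp f g v = f (g v). Proof. by []. Qed.
Lemma endo1E v : endo1 V v = v. Proof. by []. Qed.

(** The only analytic input in the defining relations is s_n^2 = 1 - q^2n; at n = 0
    the terms with truncated shifts disappear since s_0 = 0. *)
Lemma gen_rel s t : su_rel q s t ->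
  su_eval (endo1 V) (@endo_comp _ V) idfun gen_op s =
  su_eval (endo1 V) (@endo_comp _ V) idfun gen_op t.
Proof.
have sqq n : (ladder n)%:C * (ladder n)%:C = 1 - (q%:C) ^+ n * q%:C ^+ n :> C.
  by rewrite -rmorphM -expr2 ladder_sqr rmorphB rmorph1 -exprD addnn -mul2n rmorphXn.
have q0 : q%:C != 0 by rewrite -[0]/(0%:C) (inj_eq (@complexI _)) q_neq0.
case; apply: endoP => f; apply: l2P => -[[n m] s'];
  rewrite /su_eval ?(endoD, endoN, endoZ, endo_compE, endo1E, l2D, l2N, l2Z);
  rewrite !gen_opE /gen_wgt /gen_shift /= ?addrK ?subrK ?exprS.
- by move: (f _) (_%:C) (_%:C) (_ ^+ _) => x y z w; ring.
- by move: (f _) (_%:C) (_%:C) (_ ^+ _) => x y z w; ring.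
- case: n => [|n]; first by rewrite ladder0 !mul0r !mulr0.
  by rewrite exprS /=; move: (f _) (_%:C) (_%:C) (_ ^+ _) => x y z w; ring.
- case: n => [|n]; first by rewrite ladder0 !mul0r !mulr0.
  by rewrite exprS /=; move: (f _) (_%:C) (_%:C) (_ ^+ _) => x y z w; ring.
- by move: (f _) (_%:C) (_ ^+ _) => x z w; ring.
- rewrite mulrA sqq !exprS.
  by move: (f _) (_%:C) (_ ^+ _) => x z w; ring.
- have [->|n0] := posnP n.
    rewrite ladder0 !mul0r !expr0 /= sub0r; move: (f _) (_%:C) q0 => x z q0.
    by field.
  rewrite (prednK n0) mulrA sqq.
  by move: (f _) (_%:C) (_ ^+ _) q0 => x z w q0; field.
Qed.

Lemma rep_morphism_hyps :
  [/\ associative (@endo_comp _ V), left_id (endo1 V) (@endo_comp _ V),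
      right_id (endo1 V) (@endo_comp _ V) & bilin (@endo_comp _ V)].
Proof.
split; [exact: endo_compA|exact: endo_comp1l|exact: endo_comp1r|].
exact: endo_comp_bilin.
Qed.

Lemma pi_ex : {P : SUq2 q -> endo V |
  [/\ P 1 = endo1 V, {morph P : x y / x + y},
     {morph P : x y / x * y >-> endo_comp x y} & forall k, {morph P : x / k *: x}] /\
  [/\ P (su_a q) = gen_op Ga, P (su_b q) = gen_op Gb, P (su_c q) = gen_op Gc
    & P (su_d q) = gen_op Gd]}.
Proof.
exists (su_lift (endo1 V) (@endo_comp _ V) idfun gen_op).
have [h1 h2 h3 h4] := rep_morphism_hyps.
exact: (su_lift_morphism (theta := idfun) h1 h2 h3 h4 gen_rel).
Qed.

Definition pi0 : SUq2 q -> endo V := sval pi_ex.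

Lemma pi0_1 v : pi0 1 v = v.
Proof. by have [[e _ _ _] _] := svalP pi_ex; rewrite /pi0 e. Qed.
Lemma pi0D x y v : pi0 (x + y) v = pi0 x v + pi0 y v.
Proof. by have [[_ e _ _] _] := svalP pi_ex; rewrite /pi0 e. Qed.
Lemma pi0M x y v : pi0 (x * y) v = pi0 x (pi0 y v).
Proof. by have [[_ _ e _] _] := svalP pi_ex; rewrite /pi0 e. Qed.
Lemma pi0Z k x v : pi0 (k *: x) v = k *: pi0 x v.
Proof. by have [[_ _ _ e] _] := svalP pi_ex; rewrite /pi0 e. Qed.
Lemma pi0_gen : [/\ pi0 (su_a q) = gen_op Ga, pi0 (su_b q) = gen_op Gb,
  pi0 (su_c q) = gen_op Gc & pi0 (su_d q) = gen_op Gd].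
Proof. by have [_ e] := svalP pi_ex. Qed.

Lemma pi0_bilin : bilin (fun x => pi0 x : V -> V).
Proof.
by split=> [v k x y|x]; [rewrite pi0D pi0Z | exact: endo_linear].
Qed.

Lemma pi0_bounded_ge0 x : exists M : R, 0 <= M /\ forall u, `|pi0 x u| <= M%:C * `|u|.
Proof.
have gb g : exists M : R, 0 <= M /\ forall u, `|gen_op g u| <= M%:C * `|u|.
  exists 1; split=> // u; rewrite gen_op_wcomp mul1r.
  exact/wcomp_contr/gen_contractive.
have [ga gb' gc gd] := pi0_gen.
move: x; apply: su_ind; first by rewrite ga.
- by rewrite gb'.
- by rewrite gc.
- by rewrite gd.
- by exists 1; split=> // u; rewrite pi0_1 mul1r.
- move=> x y [M [M0 hM]] [N [N0 hN]]; exists (M + N); split=> [|u].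
    exact: addr_ge0.
  by rewrite pi0D rmorphD mulrDl (le_trans (ler_normD _ _)) // lerD.
- move=> x y [M [M0 hM]] [N [N0 hN]]; exists (M * N); split=> [|u].
    exact: mulr_ge0.
  rewrite pi0M (le_trans (hM _)) // rmorphM -mulrA ler_wpM2l //.
  by rewrite -[0]/(0%:C) lecR.
- move=> k x [M [M0 hM]]; exists (complex.Re `|k| * M); split=> [|u].
    apply: mulr_ge0 => //; rewrite -lecR RRe_real ?normr_real //.
    exact: normr_ge0.
  have -> : (complex.Re `|k| * M)%:C = `|k| * M%:C.
    by rewrite -[in RHS](RRe_real (normr_real k)) -rmorphM.
  by rewrite pi0Z normrZ -mulrA ler_wpM2l.
Qed.

Lemma conjR (x : R) : Num.conj x%:C = x%:C :> C.
Proof. exact: conjc_real. Qed.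

Lemma conjNR (x : R) : Num.conj (- x%:C) = - x%:C :> C.
Proof. by rewrite rmorphN /= conjR. Qed.

Lemma wgt_real g i : Num.conj (gen_wgt g i) = gen_wgt g i.
Proof.
by case: g => /=; rewrite ?rmorphN ?rmorphXn /= conjR.
Qed.

Lemma gen_adjoint_ad f g : l2_ip (gen_op Ga f) g = l2_ip f (gen_op Gd g).
Proof.
rewrite !gen_op_wcomp; apply: wcomp_adjoint; try exact: gen_contractive.
  by move=> [[n m] s] _; rewrite wgt_real.
move=> [[n m] s] /= wi; rewrite conjR.
by case: n wi => [|n] //; rewrite ladder0 eqxx.
Qed.

Lemma ipZl k (u v : V) : l2_ip (k *: u) v = k * l2_ip u v.
Proof. exact: (linearZl_LR (l2_dot R I)). Qed.
Lemma ipZr k (u v : V) : l2_ip u (k *: v) = Num.conj k * l2_ip u v.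
Proof. exact: (linearZr_LR (l2_dot R I)). Qed.
Lemma ipDl (u u' v : V) : l2_ip (u + u') v = l2_ip u v + l2_ip u' v.
Proof. exact: (linearDl (l2_dot R I)). Qed.
Lemma ipDr (u v v' : V) : l2_ip u (v + v') = l2_ip u v + l2_ip u v'.
Proof. exact: (linearDr (l2_dot R I)). Qed.

(** The extra factor q in b relative to the adjoint of c is pulled out first, which
    leaves two shifts with the same real weight and opposite directions. *)
Lemma gen_adjoint_bc f g :
  l2_ip (gen_op Gb f) g = l2_ip f (- q%:C *: gen_op Gc g).
Proof.
have -> : gen_op Gb f = - q%:C *: wcomp (gen_wgt Gc)
    (fun i => (i.1.1, i.1.2 + 1, i.2)) f.
  apply: l2P => i; rewrite l2Z wcompE ?gen_opE /= ?exprS; first by ring.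
  split; first by case: (gen_contractive Gc).
  by move=> [[n m] s] [[n' m'] s'] /= _ _ [-> /addIr -> ->].
rewrite ipZl ipZr conjNR gen_op_wcomp; congr (_ * _).
apply: wcomp_adjoint; try exact: gen_contractive.
- split; first by case: (gen_contractive Gc).
  by move=> [[n m] s] [[n' m'] s'] /= _ _ [-> /addIr -> ->].
- move=> [[n m] s] /= wi.
  by have /= -> := wgt_real Gc (n, m, s); rewrite addrK.
- move=> [[n m] s] /= wi.
  by have /= -> := wgt_real Gc (n, m, s); rewrite subrK.
Qed.

Lemma ip_adj_sym (T T' : V -> V) : (forall f g, l2_ip (T f) g = l2_ip f (T' g)) ->
  forall f g, l2_ip (T' f) g = l2_ip f (T g).
Proof. by move=> h f g; rewrite l2_ipC -h -l2_ipC. Qed.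

Lemma pi0_star x f g : l2_ip (pi0 x f) g = l2_ip f (pi0 (su_star x) g).
Proof.
have [[s1 sD sM sZ] [sa sb sc sd]] := su_star_morphism q_neq0.
have [ga gb gc gd] := pi0_gen.
move: x f g; apply: su_ind.
- by move=> f g; rewrite sa ga gd gen_adjoint_ad.
- by move=> f g; rewrite sb pi0Z gb gc gen_adjoint_bc.
- have h := ip_adj_sym gen_adjoint_bc.
  have q0 : - q%:C != 0 by rewrite oppr_eq0 -[0]/(0%:C) (inj_eq (@complexI _)) q_neq0.
  move=> f g; rewrite sc pi0Z gb gc; apply: (mulfI q0).
  rewrite -ipZl h ipZr -fmorphV conjNR mulrA fmorphV.
  by rewrite mulrNN mulfV ?mul1r // -oppr_eq0.
- by move=> f g; rewrite sd ga gd; apply: ip_adj_sym; apply: gen_adjoint_ad.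
- by move=> f g; rewrite s1 !pi0_1.
- by move=> x y hx hy f g; rewrite sD !pi0D ipDl ipDr hx hy.
- by move=> x y hx hy f g; rewrite sM !pi0M hx hy.
- by move=> k x hx f g; rewrite sZ !pi0Z ipZl ipZr conjCK hx.
Qed.

Lemma pi0_bounded x : exists M : R, forall u, `|pi0 x u| <= M%:C * `|u|.
Proof. by have [M [_ h]] := pi0_bounded_ge0 x; exists M. Qed.

Definition H := l2_hilbert R I.

Definition su_rep : star_rep (SUq2_star hq) H :=
  @StarRep R (SUq2_star hq) H (fun x => pi0 x : V -> V) pi0_bilin pi0_bounded
    pi0_1 pi0M pi0_star.
End Representation.

(** * Spanning monomials and faithfulness *)

Section LinearSpan.
Variables (K : numClosedFieldType) (V : lmodType K) (S : set V).

Lemma lin_span_in u : S u -> lin_span S u.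
Proof.
move=> Su; exists [:: (1, u)]; rewrite big_seq1 scale1r; split=> // p.
by rewrite inE => /eqP ->.
Qed.

Lemma lin_span0 : lin_span S 0.
Proof. by exists [::]; rewrite big_nil. Qed.

Lemma lin_spanD u v : lin_span S u -> lin_span S v -> lin_span S (u + v).
Proof.
move=> [s [hs ->]] [t [ht ->]]; exists (s ++ t); rewrite big_cat; split=> // p.
by rewrite mem_cat => /orP[/hs|/ht].
Qed.

Lemma lin_spanZ k u : lin_span S u -> lin_span S (k *: u).
Proof.
move=> [s [hs ->]]; exists [seq (k * p.1, p.2) | p <- s]; split.
  by move=> p /mapP[p' /hs ? ->].
by rewrite big_map scaler_sumr; apply: eq_bigr => p _; rewrite scalerA.
Qed.

Lemma lin_span_ind (P : V -> Prop) :
  P 0 -> (forall u v, P u -> P v -> P (u + v)) ->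
  (forall k u, S u -> P (k *: u)) -> forall u, lin_span S u -> P u.
Proof.
move=> P0 PD PS u [s [hs ->]]; elim: s hs => [|p s IH] hs; rewrite ?big_nil //.
rewrite big_cons; apply: PD; first by apply/PS/hs; rewrite mem_head.
by apply: IH => p' p's; apply: hs; rewrite in_cons p's orbT.
Qed.
End LinearSpan.

Section Monomials.
Variables (R : realType) (q : R).
Hypothesis hq : 0 < q < 1.
Local Notation C := R[i].
Local Notation A := (SUq2 q).
Local Notation a := (su_a q).
Local Notation b := (su_b q).
Local Notation c := (su_c q).
Local Notation d := (su_d q).
Local Notation Q := (q%:C).

Lemma Q_neq0 : Q != 0 :> C.
Proof. by rewrite -[0]/(0%:C) (inj_eq (@complexI _)) (q_neq0 hq). Qed.

(** An integer exponent selects a power of a or of d, so that a single family of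
    monomials is indexed by int * nat * nat. *)
Definition mon_ad (i : int) : A :=
  match i with Posz n => a ^+ n | Negz n => d ^+ n.+1 end.
Definition mon (t : int * nat * nat) : A :=
  mon_ad t.1.1 * (b ^+ t.1.2 * c ^+ t.2).

Lemma qcomm_pow (x y : A) k : x * y = k *: (y * x) ->
  forall n, x * y ^+ n = k ^+ n *: (y ^+ n * x).
Proof.
move=> xy; elim=> [|n IH]; first by rewrite !expr0 mul1r mulr1 scale1r.
rewrite [y ^+ _]exprS (mulrA x) xy -scalerAl -(mulrA y x) IH -scalerAr scalerA.
by rewrite -exprS mulrA.
Qed.

Lemma su_ba : b * a = Q^-1 *: (a * b).
Proof. by rewrite su_ab scalerA mulVf ?Q_neq0 // scale1r. Qed.
Lemma su_ca : c * a = Q^-1 *: (a * c).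
Proof. by rewrite su_ac scalerA mulVf ?Q_neq0 // scale1r. Qed.

Lemma mon_ad_comm x : x \in [:: b; c] -> forall i,
  exists k, x * mon_ad i = k *: (mon_ad i * x).
Proof.
rewrite !inE => /orP[]/eqP -> [] n; rewrite /mon_ad; eexists; apply: qcomm_pow.
- exact: su_ba.
- exact: su_bd.
- exact: su_ca.
- exact: su_cd.
Qed.

Definition is_mon : set A := [set x | exists t, x = mon t].

Lemma b_mon t : lin_span is_mon (b * mon t).
Proof.
have [|k e] := @mon_ad_comm b _ t.1.1; first by rewrite mem_head.
rewrite /mon mulrA e -scalerAl; apply: lin_spanZ; apply: lin_span_in.
by exists (t.1.1, t.1.2.+1, t.2); rewrite /mon /= exprS !mulrA.
Qed.

Lemma c_mon t : lin_span is_mon (c * mon t).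
Proof.
have [|k e] := @mon_ad_comm c _ t.1.1; first by rewrite !inE eqxx orbT.
rewrite /mon mulrA e -scalerAl; apply: lin_spanZ; apply: lin_span_in.
exists (t.1.1, t.1.2, t.2.+1); rewrite /mon /= exprS -!mulrA; congr (_ * _).
by rewrite !mulrA; congr (_ * _); apply: commrX; exact: su_cb.
Qed.

Lemma span_closed (x : A) : (forall t, lin_span is_mon (x * mon t)) ->
  forall y, lin_span is_mon y -> lin_span is_mon (x * y).
Proof.
move=> h; apply: lin_span_ind.
- by rewrite mulr0; apply: lin_span0.
- by move=> u v hu hv; rewrite mulrDr; apply: lin_spanD.
- by move=> k u [t ->]; rewrite -scalerAr; apply: lin_spanZ.
Qed.

Lemma bc_mon t : lin_span is_mon (b * c * mon t).
Proof. by rewrite -mulrA; apply: (span_closed b_mon); apply: c_mon. Qed.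

Lemma a_mon t : lin_span is_mon (a * mon t).
Proof.
case: t => [[[n|n] j] k]; rewrite /mon mulrA /=.
  rewrite -exprS; apply: lin_span_in; by exists (Posz n.+1, j, k).
rewrite (exprS d) (mulrA a) su_ad mulrDl mul1r mulrDl -scalerAl -scalerAl.
have [t ->] : exists t, d ^+ n * (b ^+ j * c ^+ k) = mon t.
  by case: n => [|n]; [exists (Posz 0, j, k) | exists (Negz n, j, k)].
apply: lin_spanD; first by apply: lin_span_in; exists t.
apply: lin_spanZ.
have [t' e] : exists t, d ^+ n * (b ^+ j * c ^+ k) = mon t.
  by case: n => [|n]; [exists (Posz 0, j, k) | exists (Negz n, j, k)].
by rewrite -mulrA e; apply: bc_mon.
Qed.

Lemma d_mon t : lin_span is_mon (d * mon t).
Proof.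
case: t => [[[[|n]|n] j] k]; rewrite /mon mulrA /=.
- rewrite expr0 mulr1; apply: lin_span_in; exists (Negz 0, j, k).
  by rewrite /mon /= expr1.
- rewrite (exprS a) (mulrA d) su_da mulrDl mul1r mulrDl -scalerAl -scalerAl.
  apply: lin_spanD; first by apply: lin_span_in; exists (Posz n, j, k).
  by apply: lin_spanZ; rewrite -mulrA; apply: (bc_mon (Posz n, j, k)).
- by rewrite -exprS; apply: lin_span_in; exists (Negz n.+1, j, k).
Qed.

(** The span of the monomials is stable under left multiplication by the generators:
    b and c move past a and d up to scalars, while ad and da reduce to polynomials
    in bc.  Since it contains 1, it is everything. *)
Lemma mon_span x : lin_span is_mon x.
Proof.
rewrite -[x]mulr1; have : lin_span is_mon (1 : A).
  by apply: lin_span_in; exists (Posz 0, 0, 0)%N; rewrite /mon /= !expr0 !mulr1.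
move: (1 : A); move: x; apply: su_ind.
- exact: span_closed a_mon.
- exact: span_closed b_mon.
- exact: span_closed c_mon.
- exact: span_closed d_mon.
- by move=> y; rewrite mul1r.
- by move=> x y hx hy z hz; rewrite mulrDl; apply: lin_spanD; [apply: hx|apply: hy].
- by move=> x y hx hy z hz; rewrite -mulrA; apply/hx/hy.
- by move=> k x hx z hz; rewrite -scalerAl; apply/lin_spanZ/hx.
Qed.

Lemma mon_uniq_span x : exists (U : seq (int * nat * nat)) (al : _ -> C),
  uniq U /\ x = \sum_(t <- U) al t *: mon t.
Proof.
have [s [hs ->]] := mon_span x.
have [l ->] : exists l : seq (C * (int * nat * nat)),
    \sum_(p <- s) p.1 *: p.2 = \sum_(p <- l) p.1 *: mon p.2.
  elim: s hs => [|p s IH] hs; first by exists [::]; rewrite !big_nil.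
  have [|l e] := IH; first by move=> p' p's; apply: hs; rewrite in_cons p's orbT.
  have [t pt] := hs p (mem_head _ _).
  by exists ((p.1, t) :: l); rewrite !big_cons e pt.
exists (undup [seq p.2 | p <- l]), (fun t => \sum_(p <- l | p.2 == t) p.1).
split; first exact: undup_uniq.
under [RHS]eq_bigr do rewrite scaler_suml.
rewrite (exchange_big_dep predT) //= big_seq [RHS]big_seq.
apply: eq_bigr => p pl; rewrite -big_filter.
rewrite (_ : [seq _ <- _ | _] = [:: p.2]) ?big_seq1 //.
rewrite (eq_filter (a2 := pred1 p.2)); last by move=> t; apply: (eq_sym p.2 t).
by rewrite filter_pred1_uniq ?undup_uniq // mem_undup map_f.
Qed.

Section Faithful.
Local Notation V := (l2 R (nat * int * bool)%type).
Local Notation pi := (pi0 hq).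

(** In coordinates a^i shifts n by i, and d^i by - i, with a weight that vanishes
    exactly when the shift would leave the natural numbers. *)
Lemma mon_ad_coord i : exists (W : nat -> C) (tau : nat -> nat),
  [/\ forall (f : V) n m s, pi (mon_ad i) f (n, m, s) = W n * f (tau n, m, s),
      forall n, W n != 0 -> (tau n)%:Z = n%:Z + i
    & forall n, 0 <= n%:Z + i -> W n != 0].
Proof.
have sC0 n : (0 < n)%N -> (ladder q n)%:C != 0 :> C.
  by move=> n0; rewrite -[0]/(0%:C) (inj_eq (@complexI _)) gt_eqF ?(ladder_gt0 hq).
have [ga _ _ gd] := pi0_gen hq.
case: i => n0; rewrite /mon_ad.
  elim: n0 => [|i [W [tau [h1 h2 h3]]]].
    exists (fun=> 1), id; split=> [f n m s|n _|n _]; rewrite ?oner_neq0 ?addr0 //.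
    by rewrite expr0 pi0_1 mul1r.
  exists (fun n => W n * (ladder q (tau n).+1)%:C), (fun n => (tau n).+1).
  split=> [f n m s|n|n _].
  - by rewrite exprSr pi0M h1 ga gen_opE /= mulrA.
  - by rewrite mulf_eq0 negb_or => /andP[/h2 e _]; rewrite -addn1 PoszD e; lia.
  - by rewrite mulf_neq0 ?sC0 // h3.
suff [W [tau [h1 h2 h3]]] : exists (W : nat -> C) (tau : nat -> nat),
  [/\ forall (f : V) n m s, pi (d ^+ n0.+1) f (n, m, s) = W n * f (tau n, m, s),
      forall n, W n != 0 -> (n0.+1 <= n)%N /\ tau n = (n - n0.+1)%N
    & forall n, (n0.+1 <= n)%N -> W n != 0].
  exists W, tau; split=> // n; rewrite NegzE => h.
    by have [? ->] := h2 n h; lia.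
  by apply: h3; lia.
move: n0.+1 => i; elim: i => [|i [W [tau [h1 h2 h3]]]].
  exists (fun=> 1), id; split=> [f n m s|n _|n _]; rewrite ?oner_neq0 ?subn0 //.
  by rewrite expr0 pi0_1 mul1r.
exists (fun n => W n * (ladder q (tau n))%:C), (fun n => (tau n).-1).
split=> [f n m s|n|n ni].
- by rewrite exprSr pi0M h1 gd gen_opE /= mulrA.
- rewrite mulf_eq0 negb_or => /andP[/h2 [ni e]]; rewrite e => s0; split; last lia.
  rewrite ltn_neqAle ni andbT; apply: contra s0 => /eqP ->.
  by rewrite subnn (ladder0 q).
- have h : W n != 0 by apply: h3; apply: ltnW.
  by rewrite mulf_neq0 // sC0 //; have [_ ->] := h2 n h; rewrite subn_gt0.
Qed.

Lemma bc_coord j k (f : V) n m s : pi (b ^+ j * c ^+ k) f (n, m, s) =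
  (- Q) ^+ j * (Q ^+ n) ^+ (j + k) * f (n, m + j%:Z - k%:Z, s).
Proof.
have [_ gb gc _] := pi0_gen hq.
elim: j m => [|j IH] m.
  rewrite expr0 mul1r add0n addr0 mul1r; elim: k m => [|k IH] m.
    by rewrite !expr0 pi0_1 mul1r subr0.
  rewrite exprS pi0M gc gen_opE /= IH exprS mulrA; congr (_ * f (_, _, _)).
  lia.
rewrite exprS -mulrA pi0M gb gen_opE /= IH addSn !exprS.
rewrite (_ : m + 1 + j%:Z - k%:Z = m + j.+1%:Z - k%:Z); last lia.
have aux (x y z w r : C) : - (r * w) * (z * y * x) = - r * z * (w * y) * x by ring.
exact: aux.
Qed.

Lemma pi0_sum (J : Type) (r : seq J) (al : J -> C) (x : J -> A) (v : V) :
  pi (\sum_(t <- r) al t *: x t) v = \sum_(t <- r) al t *: pi (x t) v.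
Proof.
elim: r => [|t r IH]; first by rewrite !big_nil -(scale0r 1) pi0Z scale0r.
by rewrite !big_cons pi0D pi0Z IH.
Qed.

(** The powers of q are pairwise distinct, so p has too many roots. *)
Lemma poly_eq0_pow (p : {poly C}) N0 :
  (forall M, p.[Q ^+ (N0 + M)] = 0) -> p = 0.
Proof.
move=> p0; apply/eqP; apply: contraT => pn0.
have Qgt0 : 0 < Q :> C by rewrite -[0]/(0%:C) ltcR (q_gt0 hq).
have Q1 : Q != 1 :> C by rewrite -[1]/(1%:C) (inj_eq (@complexI _)) lt_eqF ?(q_lt1 hq).
pose rs := [seq Q ^+ (N0 + M) | M <- iota 0 (size p)].
have /(max_poly_roots pn0) : all (root p) rs.
  by apply/allP => z /mapP[M _ ->]; apply/rootP.
rewrite size_map size_iota ltnn => -> //.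
rewrite map_inj_uniq ?iota_uniq // => M M'.
by move/(ieexprIn Qgt0 Q1)/addnI.
Qed.

(** The weight of a monomial (i, j, k) determines how it moves the two indices:
    n changes by i and m by j - k.  So the monomials with given i0 and j0 - k0 are
    isolated by one matrix coefficient from the column of e_(N,0), in which they
    contribute multiples of (q^N)^(j+k) with a common nonzero factor.  Letting N vary
    gives a polynomial with infinitely many zeros, and within the class the exponent
    j + k determines the monomial. *)
Lemma pi0_faithful (s : bool) x :
  (forall i, pi x (ket R (i, s)) = 0) -> x = 0.
Proof.
move=> x0; have [U [al [uU xE]]] := mon_uniq_span x.
rewrite xE big_seq big1 // => t0 t0U.
suff -> : al t0 = 0 by rewrite scale0r.
case: t0 t0U => [[i0 j0] k0] t0U.
pose same (t : int * nat * nat) :=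
  (t.1.1 == i0) && (t.1.2%:Z - t.2%:Z == j0%:Z - k0%:Z).
(* The coefficient of X^e collects the monomials of the class with j + k = e. *)
pose p : {poly C} :=
  \sum_(t <- U | same t) (al t * (- Q) ^+ t.1.2) *: 'X^(t.1.2 + t.2).
have p0 : p = 0.
  apply: (@poly_eq0_pow p `|i0|%N) => M.
  (* N is large enough for the row n = N - i0 to exist. *)
  set N := (_ + M)%N; pose n := `|N%:Z - i0|%N.
  have nE : n%:Z = N%:Z - i0 by rewrite /n /N; lia.
  have [W [tau [h1 h2 h3]]] := mon_ad_coord i0.
  have Wn : W n != 0 by apply: h3; rewrite nE; lia.
  have taun : tau n = N by have := h2 n Wn; rewrite nE; lia.
  have := congr1 (fun f : V => f (n, k0%:Z - j0%:Z, s)) (x0 (N, 0)).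
  rewrite /= xE pi0_sum l2_sum_coord => e.
  apply: (mulfI Wn); rewrite mulr0 -[RHS]e /p horner_sum mulr_sumr big_mkcond /=.
  apply: eq_bigr => -[[i j] k] _ /=; rewrite [RHS]l2Z /mon pi0M.
  case: ifPn => [/andP[/= /eqP e1 /eqP jk]|nsame].
    rewrite e1 h1 bc_coord taun ketE hornerZ hornerXn.
    rewrite (_ : k0%:Z - j0%:Z + j%:Z - k%:Z = 0); last lia.
    rewrite eqxx mulr1.
    by rewrite -mulrA mulrCA.
  have [W' [tau' [h1' h2' _]]] := mon_ad_coord i.
  rewrite h1' bc_coord ketE.
  have [->|W'n] := eqVneq (W' n) 0; first by rewrite mul0r mulr0.
  case: eqVneq => [[e1 e2]|_]; last by rewrite !mulr0.
  case/negP: nsame; have := h2' n W'n; rewrite e1 nE => e3.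
  have {}e2 : k0%:Z - j0%:Z + j%:Z - k%:Z = 0 :> int := e2.
  have i00 : i = i0 :> int by clear -e3; lia.
  have jk0 : j%:Z - k%:Z = j0%:Z - k0%:Z :> int by clear -e2; lia.
  by rewrite /same /= i00 jk0 !eqxx.
have := congr1 (fun r : {poly C} => r`_(j0 + k0)) p0.
rewrite /= coef0 /p coef_sum big_mkcond (bigD1_seq (i0, j0, k0)) //=.
rewrite [same _]/same /= !eqxx /= coefZ coefXn eqxx mulr1 big1 ?addr0; last first.
  move=> [[i j] k] tt0; case: ifP => // /andP[/= /eqP e1 /eqP e2].
  rewrite coefZ coefXn; case: eqVneq => [e3|_]; last by rewrite mulr0.
  by case/eqP: tt0; rewrite e1; congr (_, _, _); move: e3 => /=; lia.
move/eqP; rewrite mulf_eq0 expf_eq0 oppr_eq0 (negPf Q_neq0) andbF orbF.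
by move/eqP.
Qed.
End Faithful.
End Monomials.

(** * Calculi with a twisted-central left basis *)

Section Calculus.
Variables (C : numClosedFieldType) (A : algType C) (G : fodc A).

Lemma lact0 (w : G) : lact 0 w = 0. Proof. exact: bilin0l (lact_bilin G) _. Qed.
Lemma lactr0 x : lact x (0 : G) = 0. Proof. exact: bilin0r (lact_bilin G) _. Qed.
Lemma lactDl x y (w : G) : lact (x + y) w = lact x w + lact y w.
Proof. exact: bilinDl (lact_bilin G) _ _ _. Qed.
Lemma lactDr x (v w : G) : lact x (v + w) = lact x v + lact x w.
Proof. exact: bilinDr (lact_bilin G) _ _ _. Qed.
Lemma lactZl k x (w : G) : lact (k *: x) w = k *: lact x w.
Proof. exact: bilinZl (lact_bilin G) _ _ _. Qed.
Lemma lactZr k x (w : G) : lact x (k *: w) = k *: lact x w.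
Proof. exact: bilinZr (lact_bilin G) _ _ _. Qed.
Lemma lactNl x (w : G) : lact (- x) w = - lact x w.
Proof. by rewrite -[- x]scaleN1r lactZl scaleN1r. Qed.
Lemma lactNr x (w : G) : lact x (- w) = - lact x w.
Proof. by rewrite -[- w]scaleN1r lactZr scaleN1r. Qed.
Lemma ractDl (v w : G) y : ract (v + w) y = ract v y + ract w y.
Proof. exact: bilinDl (ract_bilin G) _ _ _. Qed.
Lemma ractDr (w : G) x y : ract w (x + y) = ract w x + ract w y.
Proof. exact: bilinDr (ract_bilin G) _ _ _. Qed.
Lemma ractZl k (w : G) y : ract (k *: w) y = k *: ract w y.
Proof. exact: bilinZl (ract_bilin G) _ _ _. Qed.
Lemma ractZr k (w : G) y : ract w (k *: y) = k *: ract w y.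
Proof. exact: bilinZr (ract_bilin G) _ _ _. Qed.
Lemma fodc_dD x y : fodc_d G (x + y) = fodc_d G x + fodc_d G y.
Proof. by have [_ e _ _] := linear_spec (@fodc_d_linear _ _ G). Qed.
Lemma fodc_dZ k x : fodc_d G (k *: x) = k *: fodc_d G x.
Proof. by have [_ _ _ ->] := linear_spec (@fodc_d_linear _ _ G). Qed.
Lemma fodc_d1 : fodc_d G 1 = 0.
Proof.
have := @fodc_dM _ _ G 1 1; rewrite mulr1 lact1 ract1 => /eqP.
by rewrite -subr_eq0 opprD addrA subrr sub0r oppr_eq0 => /eqP.
Qed.

(** Lists of triples (x, y, z) serve as formal sums of terms x dy z, so that the same
    formal sum can be evaluated in two calculi. *)
Definition term_sum (s : seq (A * A * A)) : G :=
  \sum_(t <- s) ract (lact t.1.1 (fodc_d G t.1.2)) t.2.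

Lemma term_sum_cat s t : term_sum (s ++ t) = term_sum s + term_sum t.
Proof. exact: big_cat. Qed.

Lemma term_sum_scale k s :
  term_sum [seq (k *: t.1.1, t.1.2, t.2) | t <- s] = k *: term_sum s.
Proof.
rewrite /term_sum big_map scaler_sumr; apply: eq_bigr => t _ /=.
by rewrite lactZl ractZl.
Qed.
End Calculus.

Section Comparison.
Variables (C : numClosedFieldType).

(** Every form is the value of some formal sum, and equality of values is the vanishing
    of a formal difference; so calculi with the same vanishing formal sums have
    the same elements. *)
Lemma fodc_hom_exists (A : algType C) (G1 G2 : fodc A) :
  (forall s, term_sum G1 s = 0 <-> term_sum G2 s = 0) ->
  exists2 rho : G1 -> G2, fodc_hom rho & injective rho.
Proof.
move=> same.
have lin k s t : exists u, forall G : fodc A,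
    term_sum G u = k *: term_sum G s + term_sum G t.
  exists ([seq (k *: p.1.1, p.1.2, p.2) | p <- s] ++ t) => G.
  by rewrite term_sum_cat term_sum_scale.
have eqv s t : term_sum G1 s = term_sum G1 t -> term_sum G2 s = term_sum G2 t.
  move=> e; have [u hu] := lin (-1) t s; apply/eqP; rewrite -subr_eq0 addrC -scaleN1r.
  by apply/eqP; rewrite -hu; apply/same; rewrite hu scaleN1r e addNr.
have ex (w : G1) : exists s, w = term_sum G1 s.
  by have [s ->] := fodc_d_span w; exists s.
pose rho w := term_sum G2 (sval (cid (ex w))).
have rhoE s : rho (term_sum G1 s) = term_sum G2 s.
  by apply: eqv; rewrite -(svalP (cid (ex _))).
exists rho.
  split=> [k v w|x y z].
    have [s ->] := ex v; have [t ->] := ex w.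
    by have [u hu] := lin k s t; rewrite -hu !rhoE hu.
  by have := rhoE [:: (x, y, z)]; rewrite /term_sum !big_seq1.
move=> v w; have [s ->] := ex v; have [t ->] := ex w; rewrite !rhoE => e.
have [u hu] := lin (-1) t s; apply/eqP; rewrite -subr_eq0 addrC -scaleN1r.
by apply/eqP; rewrite -hu; apply/same; rewrite hu scaleN1r e addNr.
Qed.

(** Both involutions are determined by their effect on the terms x dy z, which span. *)
Lemma fodc_hom_star (A : star_alg C) (G1 G2 : star_fodc A) (rho : G1 -> G2) :
  fodc_hom rho -> star_fodc_hom rho.
Proof.
move=> [lr hr]; split; first by split.
have [r0 rD _ rZ] := linear_spec lr.
have sD (G : star_fodc A) (v w : G) : fstar (v + w) = fstar v + fstar w.
  by have := fstar_antilinear 1 v w; rewrite rmorph1 !scale1r.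
have s0 (G : star_fodc A) : fstar (0 : G) = 0.
  have := sD G 0 0; rewrite addr0 => /eqP.
  by rewrite -subr_eq subrr eq_sym => /eqP.
move=> w; have [s ->] := fodc_d_span w.
elim: s => [|t s IH]; first by rewrite !big_nil s0 r0 s0.
rewrite !big_cons sD !rD sD IH; congr (_ + _).
by rewrite fstarE !hr fstarE.
Qed.
End Comparison.

Section Frame.
Variables (R : realType) (q : R).
Hypothesis hq : 0 < q < 1.
Local Notation C := R[i].
Local Notation A := (SUq2 q).
Local Notation a := (su_a q).
Local Notation b := (su_b q).
Local Notation c := (su_c q).
Local Notation d := (su_d q).
Local Notation Q := (q%:C).

Section Forms.
Variable G : fodc A.
Local Notation D := (fodc_d G).

(** The left-invariant forms omega(b), omega(a) and omega(c), written out so that they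
    make sense in every calculus. *)
Definition theta0 : G := lact d (D b) - Q^-1 *: lact b (D d).
Definition theta1 : G := lact d (D a) - Q^-1 *: lact b (D c).
Definition theta2 : G := lact a (D c) - Q *: lact c (D a).

Definition comb z0 z1 z2 : G := lact z0 theta0 + lact z1 theta1 + lact z2 theta2.

(** Moving y from the right of the frame to its left turns it into y0 at theta0 and
    theta2, and into y1 at theta1. *)
Definition twist y y0 y1 := [/\ ract theta0 y = lact y0 theta0,
  ract theta1 y = lact y1 theta1 & ract theta2 y = lact y0 theta2].

Definition structure_eqs :=
  [/\ twist a (Q^-1 *: a) (Q^-2 *: a), twist b (Q *: b) (Q ^+ 2 *: b),
      twist c (Q^-1 *: c) (Q^-2 *: c) & twist d (Q *: d) (Q ^+ 2 *: d)] /\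
  [/\ D a = comb 0 a b, D b = comb a (- Q ^+ 2 *: b) 0,
      D c = comb 0 c d & D d = comb c (- Q ^+ 2 *: d) 0].

Definition frame_free := forall z0 z1 z2, comb z0 z1 z2 = 0 ->
  [/\ z0 = 0, z1 = 0 & z2 = 0].

Lemma combD z0 z1 z2 z0' z1' z2' : comb z0 z1 z2 + comb z0' z1' z2' =
  comb (z0 + z0') (z1 + z1') (z2 + z2').
Proof. by rewrite /comb !lactDl addrACA; congr (_ + _); rewrite addrACA. Qed.

Lemma combZ k z0 z1 z2 : k *: comb z0 z1 z2 = comb (k *: z0) (k *: z1) (k *: z2).
Proof. by rewrite /comb !scalerDr !lactZl. Qed.

Lemma comb0 : comb 0 0 0 = 0. Proof. by rewrite /comb !lact0 !addr0. Qed.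

Lemma comb_lact x z0 z1 z2 : lact x (comb z0 z1 z2) = comb (x * z0) (x * z1) (x * z2).
Proof. by rewrite /comb !lactDr !lactM. Qed.

Lemma comb_ract y y0 y1 z0 z1 z2 : twist y y0 y1 ->
  ract (comb z0 z1 z2) y = comb (z0 * y0) (z1 * y1) (z2 * y0).
Proof. by move=> [e0 e1 e2]; rewrite /comb !ractDl !lractA e0 e1 e2 !lactM. Qed.

Lemma twist1 : twist 1 1 1. Proof. by split; rewrite ract1 lact1. Qed.

Lemma twistD y y0 y1 z z0 z1 : twist y y0 y1 -> twist z z0 z1 ->
  twist (y + z) (y0 + z0) (y1 + z1).
Proof.
by move=> [h0 h1 h2] [k0 k1 k2]; split; rewrite ractDr lactDl ?(h0, h1, h2) ?(k0, k1, k2).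
Qed.

Lemma twistM y y0 y1 z z0 z1 : twist y y0 y1 -> twist z z0 z1 ->
  twist (y * z) (y0 * z0) (y1 * z1).
Proof.
move=> [h0 h1 h2] [k0 k1 k2]; split; rewrite ractM lactM.
- by rewrite h0 lractA k0.
- by rewrite h1 lractA k1.
- by rewrite h2 lractA k2.
Qed.

Lemma twistZ k y y0 y1 : twist y y0 y1 -> twist (k *: y) (k *: y0) (k *: y1).
Proof. by move=> [h0 h1 h2]; split; rewrite ractZr lactZl ?(h0, h1, h2). Qed.
End Forms.

Section TwoCalculi.
Variables G1 G2 : fodc A.
Hypotheses (S1 : structure_eqs G1) (S2 : structure_eqs G2).

Lemma twist_exists y : exists y0 y1, twist G1 y y0 y1 /\ twist G2 y y0 y1.
Proof.
have [[ta1 tb1 tc1 td1] _] := S1; have [[ta2 tb2 tc2 td2] _] := S2.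
move: y; apply: su_ind.
- by do 2 eexists; split; [exact: ta1|exact: ta2].
- by do 2 eexists; split; [exact: tb1|exact: tb2].
- by do 2 eexists; split; [exact: tc1|exact: tc2].
- by do 2 eexists; split; [exact: td1|exact: td2].
- by exists 1, 1; split; apply: twist1.
- move=> x y [x0 [x1 [h1 h2]]] [y0 [y1 [k1 k2]]].
  by exists (x0 + y0), (x1 + y1); split; apply: twistD.
- move=> x y [x0 [x1 [h1 h2]]] [y0 [y1 [k1 k2]]].
  by exists (x0 * y0), (x1 * y1); split; apply: twistM.
- by move=> k x [x0 [x1 [h1 h2]]]; exists (k *: x0), (k *: x1); split; apply: twistZ.
Qed.

Lemma d_coords x : exists z0 z1 z2,
  fodc_d G1 x = comb G1 z0 z1 z2 /\ fodc_d G2 x = comb G2 z0 z1 z2.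
Proof.
have [_ [da1 db1 dc1 dd1]] := S1; have [_ [da2 db2 dc2 dd2]] := S2.
move: x; apply: su_ind.
- by do 3 eexists; split; [exact: da1|exact: da2].
- by do 3 eexists; split; [exact: db1|exact: db2].
- by do 3 eexists; split; [exact: dc1|exact: dc2].
- by do 3 eexists; split; [exact: dd1|exact: dd2].
- by exists 0, 0, 0; rewrite !comb0 !fodc_d1.
- move=> x y [x0 [x1 [x2 [h1 h2]]]] [y0 [y1 [y2 [k1 k2]]]].
  exists (x0 + y0), (x1 + y1), (x2 + y2).
  by rewrite !fodc_dD h1 h2 k1 k2 !combD.
- move=> x y [x0 [x1 [x2 [h1 h2]]]] [y0 [y1 [y2 [k1 k2]]]].
  have [t0 [t1 [e1 e2]]] := twist_exists y.
  exists (x * y0 + x0 * t0), (x * y1 + x1 * t1), (x * y2 + x2 * t0).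
  by rewrite !fodc_dM h1 h2 k1 k2 !comb_lact (comb_ract _ _ _ e1) (comb_ract _ _ _ e2) !combD.
- move=> k x [x0 [x1 [x2 [h1 h2]]]]; exists (k *: x0), (k *: x1), (k *: x2).
  by rewrite !fodc_dZ h1 h2 !combZ.
Qed.

(** The structure equations express dy in the frame and move z to its left, with
    coefficients that are the same in both calculi. *)
Lemma term_sum_coords s : exists z0 z1 z2,
  term_sum G1 s = comb G1 z0 z1 z2 /\ term_sum G2 s = comb G2 z0 z1 z2.
Proof.
elim: s => [|t s [z0 [z1 [z2 [h1 h2]]]]].
  by exists 0, 0, 0; rewrite /term_sum !big_nil !comb0.
have [x0 [x1 [x2 [k1 k2]]]] := d_coords t.1.2.
have [t0 [t1 [e1 e2]]] := twist_exists t.2.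
exists (t.1.1 * x0 * t0 + z0), (t.1.1 * x1 * t1 + z1), (t.1.1 * x2 * t0 + z2).
rewrite /term_sum !big_cons -!/(term_sum _ _) h1 h2 k1 k2 !comb_lact.
by rewrite (comb_ract _ _ _ e1) (comb_ract _ _ _ e2) !combD.
Qed.

(** With free frames, a formal sum vanishes in either calculus exactly when its common
    coefficients vanish. *)
Lemma structure_hom : frame_free G1 -> frame_free G2 ->
  exists2 rho : G1 -> G2, fodc_hom rho & injective rho.
Proof.
move=> f1 f2; apply: fodc_hom_exists => s.
have [z0 [z1 [z2 [-> ->]]]] := term_sum_coords s.
by split=> [/f1|/f2] [-> -> ->]; rewrite comb0.
Qed.
End TwoCalculi.
End Frame.

(** * Triangular representations that kill the right ideal *)

Section Triangular.
Variables (R : realType) (q : R).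
Hypothesis hq : 0 < q < 1.
Local Notation C := R[i].
Local Notation A := (SUq2 q).
Local Notation a := (su_a q).
Local Notation b := (su_b q).
Local Notation c := (su_c q).
Local Notation d := (su_d q).
Local Notation Q := (q%:C).

Definition tri (e x f : C) : 'M[C]_2 :=
  \matrix_(i < 2, j < 2) if i == 0 then if j == 0 then e else x
                         else if j == 0 then 0 else f.

Lemma triD e x f e' x' f' : tri e x f + tri e' x' f' = tri (e + e') (x + x') (f + f').
Proof. by apply/matrixP => i j; rewrite !mxE; do 2 case: eqP => _ //; rewrite addr0. Qed.
Lemma triZ k e x f : k *: tri e x f = tri (k * e) (k * x) (k * f).
Proof. by apply/matrixP => i j; rewrite !mxE; do 2 case: eqP => _ //; rewrite mulr0. Qed.
Lemma triN e x f : - tri e x f = tri (- e) (- x) (- f).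
Proof. by rewrite -scaleN1r triZ !mulN1r. Qed.
Lemma triM e x f e' x' f' :
  tri e x f *m tri e' x' f' = tri (e * e') (e * x' + x * f') (f * f').
Proof.
apply/matrixP => i j; rewrite !mxE !big_ord_recl big_ord0 !mxE /= addr0.
by do 2 case: eqP => _ //; rewrite ?(mul0r, mulr0) ?(addr0, add0r).
Qed.
Lemma tri1 : 1%:M = tri 1 0 1.
Proof.
apply/matrixP => i j; rewrite !mxE; case: i => [[|[|[]]] hi] //.
  by case: j => [[|[|[]]] hj].
by case: j => [[|[|[]]] hj].
Qed.

Lemma tri_row0_inv e x f : row 0 (tri e x f) = 0 -> x = 0.
Proof. by move/matrixP => /(_ 0 1); rewrite !mxE. Qed.

Lemma mulmx_bilin n : bilin (@mulmx C n n n).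
Proof.
by split=> [w k u v|w k u v]; rewrite ?mulmxDl ?mulmxDr -?scalemxAl -?scalemxAr.
Qed.

(** For each j a representation with first row (eps, X_j), where X_0, X_1, X_2 take the
    value 1 on b, a, c respectively and span the quantum tangent space of the
    calculus; the lower right entry is the character that matches sigma_j. *)
Definition tri_gen (j : 'I_3) (g : su_gen) : 'M[C]_2 :=
  match val j, g with
  | O, Ga => tri 1 0 Q^-1 | O, Gb => tri 0 1 0
  | O, Gc => tri 0 0 0 | O, Gd => tri 1 0 Q
  | S O, Ga => tri 1 1 (Q ^- 2) | S O, Gb => tri 0 0 0
  | S O, Gc => tri 0 0 0 | S O, Gd => tri 1 (- Q ^+ 2) (Q ^+ 2)
  | _, Ga => tri 1 0 Q^-1 | _, Gb => tri 0 0 0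
  | _, Gc => tri 0 1 0 | _, Gd => tri 1 0 Q
  end.

Lemma tri_rel j s t : su_rel q s t ->
  su_eval 1%:M mulmx idfun (tri_gen j) s = su_eval 1%:M mulmx idfun (tri_gen j) t.
Proof.
have Q0 := Q_neq0 hq.
by case: j => [[|[|[|]]] hj] //; case;
  rewrite /su_eval /tri_gen /= ?tri1 ?(triM, triZ, triN, triD);
  congr tri; move: (_%:C) Q0 => x x0; field.
Qed.

Lemma tri_ex j : {X : A -> 'M[C]_2 |
  [/\ X 1 = 1%:M, {morph X : x y / x + y}, {morph X : x y / x * y >-> x *m y}
    & forall k, {morph X : x / k *: x}] /\
  [/\ X a = tri_gen j Ga, X b = tri_gen j Gb, X c = tri_gen j Gc & X d = tri_gen j Gd]}.
Proof.
exists (su_lift 1%:M mulmx idfun (tri_gen j)).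
exact: (su_lift_morphism (theta := idfun) (@mulmxA _ _ _ _ _) (@mul1mx _ _ _)
  (@mulmx1 _ _ _) (@mulmx_bilin _) (@tri_rel j)).
Qed.

(** The vanishing of the first row of X x is preserved when x is multiplied from the
    right, so it passes from the generators to the right ideal. *)
Lemma ideal_row (X : A -> 'M[C]_2) :
  {morph X : x y / x + y} -> {morph X : x y / x * y >-> x *m y} -> X 0 = 0 ->
  (forall x, @calc3D_gens R q x -> row 0 (X x) = 0) ->
  forall x, right_ideal_gen (@calc3D_gens R q) x -> row 0 (X x) = 0.
Proof.
move=> XD XM X0 Xg x [s [hs ->]]; elim: s hs => [|p s IH] hs.
  by rewrite big_nil X0 row0.
rewrite big_cons XD XM raddfD /= row_mul IH ?addr0; last first.
  by move=> p' p's; apply: hs; rewrite in_cons p's orbT.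
by rewrite Xg ?mul0mx //; apply: hs; rewrite mem_head.
Qed.

Lemma tri_row0 f : row 0 (tri 0 0 f) = 0.
Proof. by apply/matrixP => i j; rewrite !mxE /=; case: ifP. Qed.

(** Applying the functional X_j to the given combination leaves its j-th coefficient. *)
Lemma frame_indep k0 k1 k2 :
  right_ideal_gen (@calc3D_gens R q) (k0 *: b + k1 *: (a - 1) + k2 *: c) ->
  [/\ k0 = 0, k1 = 0 & k2 = 0].
Proof.
move=> hr; have Q0 := Q_neq0 hq.
have main j : row 0 (k0 *: tri_gen j Gb + k1 *: (tri_gen j Ga - 1%:M) +
     k2 *: tri_gen j Gc) = 0.
  have [X [[X1 XD XM XZ] [Xa Xb Xc Xd]]] := tri_ex j.
  have X0 : X 0 = 0 by rewrite -(scale0r 1) XZ scale0r.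
  have XN x : X (- x) = - X x by rewrite -scaleN1r XZ scaleN1r.
  have Xg x : @calc3D_gens R q x -> row 0 (X x) = 0.
    rewrite /calc3D_gens /= !inE !expr2.
    have row0E e y f : e = 0 -> y = 0 -> row 0 (tri e y f) = 0.
      by move=> -> ->; apply: tri_row0.
    move=> /orP[/eqP ->|/orP[/eqP ->|/orP[/eqP ->|/orP[/eqP ->|/orP[/eqP ->|/eqP ->]]]]];
     rewrite ?(XM, XD, XN, XZ) ?Xa ?Xb ?Xc ?Xd ?X1;
     case: (j) => [[|[|[|]]] hj] //; rewrite /tri_gen /= ?tri1 ?(triM, triZ, triN, triD);
     apply: row0E; rewrite ?rmorphD ?rmorphM ?rmorph1 /=;
     by move: (_%:C) Q0 => y y0; field.
  have := ideal_row XD XM X0 Xg hr.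
  by rewrite !XD !XZ XD XN X1 Xa Xb Xc.
have := main (Ordinal (isT : 0 < 3)%N); have := main (Ordinal (isT : 1 < 3)%N).
have := main (Ordinal (isT : 2 < 3)%N); rewrite /tri_gen /= ?tri1 ?(triM, triZ, triN, triD).
move=> /tri_row0_inv e2 /tri_row0_inv e1 /tri_row0_inv e0.
by split; [rewrite -[RHS]e0|rewrite -[RHS]e1|rewrite -[RHS]e2]; ring.
Qed.
End Triangular.

(** * The structure of the 3D-calculus *)

Section TensorLinear.
Variables (C : fieldType) (U V W : lmodType C).

Lemma tliftD (f : U -> V -> W) : bilin f ->
  forall t u, tlift f (t + u) = tlift f t + tlift f u.
Proof. by move=> bf; have [_ e _ _] := linear_spec (tlift_linear bf). Qed.
Lemma tliftZ (f : U -> V -> W) : bilin f ->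
  forall k t, tlift f (k *: t) = k *: tlift f t.
Proof. by move=> bf k t; have [_ _ _ ->] := linear_spec (tlift_linear bf). Qed.

(** All Sweedler-type identities below are proved by reduction to simple tensors. *)
Lemma tensor_lin_ext (L1 L2 : tensor U V -> W) : linear L1 -> linear L2 ->
  (forall u v, L1 (tens u v) = L2 (tens u v)) -> forall t, L1 t = L2 t.
Proof.
move=> l1 l2 e; have [z1 D1 _ _] := linear_spec l1; have [z2 D2 _ _] := linear_spec l2.
by apply: tensor_ind => [|x y hx hy|//]; [rewrite z1 z2|rewrite D1 D2 hx hy].
Qed.
End TensorLinear.

(** The two regroupings of five summands that occur when the coaction of a
    left-invariant form is expanded. *)
Section Cancellation.
Variables (V : zmodType) (A B C E X Y : V).

Let cancel W : X + W - (Y + W) = X - Y.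
Proof. by rewrite opprD addrACA subrr addr0. Qed.

Let left_out Z : A + B + (Z + C + E) = Z + (A + B + (C + E)).
Proof. by rewrite -(addrA Z C E) (addrCA (A + B) Z). Qed.
Let mid_out Z : A + (Z + B) + (C + E) = Z + (A + B + (C + E)).
Proof. by rewrite (addrCA A Z B) -(addrA Z). Qed.

Lemma cancel1 : A + B + (X + C + E) - (A + (Y + B) + (C + E)) = X - Y.
Proof. by rewrite left_out mid_out cancel. Qed.

Lemma cancel2 : A + (X + B) + (C + E) - (A + B + (Y + C + E)) = X - Y.
Proof. by rewrite left_out mid_out cancel. Qed.
End Cancellation.

Section CovariantSide.
Variables (R : realType) (q : R).
Hypothesis hq : 0 < q < 1.
Local Notation C := R[i].
Local Notation A := (SUq2 q).
Local Notation a := (su_a q).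
Local Notation b := (su_b q).
Local Notation c := (su_c q).
Local Notation d := (su_d q).
Local Notation Q := (q%:C).
Local Notation tmul := (tensor_act ( *%R : A -> A -> A) ( *%R : A -> A -> A)).
Local Notation S := (@su_antipode R q).

Let Q0 : Q != 0 := Q_neq0 hq.
Let tm := tmul_bilin A.

Let S1 : S 1 = 1. Proof. by have [[]] := su_antipode_morphism (q_neq0 hq). Qed.
Let SD x y : S (x + y) = S x + S y.
Proof. by have [[_ e _ _] _] := su_antipode_morphism (q_neq0 hq). Qed.
Let SM x y : S (x * y) = S y * S x.
Proof. by have [[_ _ e _] _] := su_antipode_morphism (q_neq0 hq). Qed.
Let SZ k x : S (k *: x) = k *: S x.
Proof. by have [[_ _ _ ->] _] := su_antipode_morphism (q_neq0 hq). Qed.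
Let Sgen : [/\ S a = d, S b = - Q^-1 *: b, S c = - Q *: c & S d = a].
Proof. by have [] := su_antipode_morphism (q_neq0 hq). Qed.

Let e1 : su_counit (1 : A) = 1.
Proof. by have [[]] := su_counit_morphism q. Qed.
Let eD (x y : A) : su_counit (x + y) = su_counit x + su_counit y.
Proof. by have [[_ e _ _] _] := su_counit_morphism q. Qed.
Let eM (x y : A) : su_counit (x * y) = su_counit x * su_counit y.
Proof. by have [[_ _ e _] _] := su_counit_morphism q. Qed.
Let eZ k (x : A) : su_counit (k *: x) = k * su_counit x.
Proof. by have [[_ _ _ ->] _] := su_counit_morphism q. Qed.
Let egen : [/\ su_counit a = 1, su_counit b = 0, su_counit c = 0 & su_counit d = 1].
Proof. by have [] := su_counit_morphism q. Qed.

Let c1 : su_comul (1 : A) = tens 1 1.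
Proof. by have [[]] := su_comul_morphism (q_neq0 hq). Qed.
Let cD (x y : A) : su_comul (x + y) = su_comul x + su_comul y.
Proof. by have [[_ e _ _] _] := su_comul_morphism (q_neq0 hq). Qed.
Let cM (x y : A) : su_comul (x * y) = tmul (su_comul x) (su_comul y).
Proof. by have [[_ _ e _] _] := su_comul_morphism (q_neq0 hq). Qed.
Let cZ k (x : A) : su_comul (k *: x) = k *: su_comul x.
Proof. by have [[_ _ _ ->] _] := su_comul_morphism (q_neq0 hq). Qed.
Let cgen : [/\ su_comul a = tens a a + tens b c,
  su_comul b = tens a b + tens b d,
  su_comul c = tens c a + tens d c & su_comul d = tens c b + tens d d].
Proof. by have [] := su_comul_morphism (q_neq0 hq). Qed.

Let anti_bilin : bilin (fun x y : A => S x * y).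
Proof.
split=> [y k x x'|x k y y']; first by rewrite SD SZ mulrDl scalerAl.
by rewrite mulrDr scalerAr.
Qed.

(** The inner factor S(x_(1)) x_(2) of S(y_(1)) S(x_(1)) x_(2) y_(2) is a scalar; this is
    the multiplicative step of the antipode identity. *)
Lemma antipode_mul x u :
  tlift (fun x y : A => S x * y) (su_comul x) = (su_counit x)%:A ->
  tlift (fun x y : A => S x * y) (tmul (su_comul x) u) =
  su_counit x *: tlift (fun x y : A => S x * y) u.
Proof.
have bf := anti_bilin; have lf := tlift_linear bf.
move=> hx; move: u; apply: tensor_lin_ext.
- by move=> k u v; rewrite tm.2 lf.
- by move=> k u v; rewrite lf scalerDr !scalerA mulrC.
move=> u1 u2; rewrite tlift_tens //.
have : forall t, tlift (fun x y : A => S x * y) (tmul t (tens u1 u2)) =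
    S u1 * (tlift (fun x y : A => S x * y) t * u2).
  apply: tensor_lin_ext.
  - by move=> k t t'; rewrite tm.1 lf.
  - by move=> k t t'; rewrite lf mulrDl mulrDr -scalerAl -scalerAr.
  by move=> x1 x2; rewrite tmulE !tlift_tens // SM !mulrA.
by move=> ->; rewrite hx mulr_algl scalerAr.
Qed.

(** The antipode axiom S(x_(1)) x_(2) = eps(x), checked on generators. *)
Lemma antipodeE x : tlift (fun x y : A => S x * y) (su_comul x) = (su_counit x)%:A.
Proof.
have [ea eb ec ed] := egen; have [ca cb cc cd] := cgen; have [Sa Sb Sc Sd] := Sgen.
have L := (tliftD anti_bilin, tlift_tens anti_bilin).
move: x; apply: su_ind.
- rewrite ca !L Sa Sb ea scale1r su_da -scalerAl scaleNr.
  by rewrite addrK.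
- rewrite cb !L Sa Sb eb scale0r -scalerAl su_bd scalerA mulNr mulVf // scaleN1r.
  by rewrite subrr.
- rewrite cc !L Sc Sd ec scale0r -scalerAl su_ac scaleNr.
  by rewrite addNr.
- rewrite cd !L Sc Sd ed scale1r -scalerAl su_cb scaleNr su_ad.
  by rewrite addrCA addNr addr0.
- by rewrite c1 tlift_tens // S1 mul1r e1 scale1r.
- by move=> x y hx hy; rewrite cD eD (tliftD anti_bilin) hx hy scalerDl.
- by move=> x y hx hy; rewrite cM eM antipode_mul // hy scalerA.
- by move=> k x hx; rewrite cZ eZ (tliftZ anti_bilin) hx scalerA.
Qed.

(** Applying eps to h(x_(1)) x_(2) gives back h(x), by the counit axiom. *)
Lemma counit_slice (h : A -> C) x : linear (h : A -> C^o) ->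
  su_counit (tlift (fun x y => h x *: y) (su_comul x)) = h x.
Proof.
move=> lh; have [h0 hD hN hZ] := linear_spec lh.
have bf : bilin (fun x y : A => h x *: y).
  split=> [y k u v|u k y y']; first by rewrite lh scalerDl scalerA.
  by rewrite scalerDr !scalerA mulrC.
have lf := tlift_linear bf.
(* the counit axiom x_(1) eps(x_(2)) = x *)
have be : bilin (fun x y : A => su_counit y *: x).
  split=> [y k u v|u k y y']; first by rewrite scalerDr !scalerA mulrC.
  by rewrite eD eZ scalerDl scalerA.
have le := tlift_linear be.
have eps_id y : tlift (fun x y : A => su_counit y *: x) (su_comul y) = y.
  have [ea eb ec ed] := egen; have [ca cb cc cd] := cgen.
  have L := (tliftD be, tlift_tens be).
  move: y; apply: su_ind.
  - by rewrite ca !L ea ec scale1r scale0r addr0.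
  - by rewrite cb !L eb ed scale1r scale0r add0r.
  - by rewrite cc !L ea ec scale1r scale0r addr0.
  - by rewrite cd !L eb ed scale1r scale0r add0r.
  - by rewrite c1 tlift_tens // e1 scale1r.
  - by move=> u v hu hv; rewrite cD (tliftD be) hu hv.
  - move=> u v hu hv; rewrite cM -[in RHS]hu -[in RHS]hv.
    move: (su_comul u) (su_comul v) => t t'; move: t.
    apply: tensor_lin_ext => [k t1 t2|k t1 t2|x1 x2].
    + by rewrite tm.1 le.
    + by rewrite le mulrDl scalerAl.
    move: t'; apply: tensor_lin_ext => [k t1 t2|k t1 t2|y1 y2].
    + by rewrite tm.2 le.
    + by rewrite le mulrDr scalerAr.
    by rewrite tmulE !tlift_tens // eM -scalerAl -scalerAr scalerA.
  - by move=> k u hu; rewrite cZ (tliftZ be) hu.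
rewrite -[in RHS](eps_id x); move: (su_comul x); apply: (tensor_lin_ext (W := C^o)).
- by move=> k t t'; rewrite lf eD eZ.
- by move=> k t t'; rewrite le lh.
by move=> x1 x2; rewrite !tlift_tens // eZ hZ /= mulrC.
Qed.

(** The matrix of the antipodes S(a), S(b), S(c), S(d) is inverse to the matrix with rows
    (a, b) and (c, d), so a pair of vectors and its two images determine each other in
    any left module.  This converts dx into left-invariant forms and back. *)
Section MatrixInverse.
Variables (M : lmodType C) (act : A -> M -> M).
Hypotheses (ab : bilin act) (actM : forall x y w, act (x * y) w = act x (act y w)).
Hypothesis act1 : forall w, act 1 w = w.

Let actDl := bilinDl ab.
Let actDr := bilinDr ab.
Let actZl := bilinZl ab.
Let actZr := bilinZr ab.
Let actBr x v w : act x (v - w) = act x v - act x w.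
Proof. by rewrite -scaleN1r actDr actZr scaleN1r. Qed.

Lemma matrix_solve U1 U2 :
  act a (act d U1 - Q^-1 *: act b U2) + act b (act a U2 - Q *: act c U1) = U1 /\
  act c (act d U1 - Q^-1 *: act b U2) + act d (act a U2 - Q *: act c U1) = U2.
Proof.
rewrite !actBr !actZr -!actM su_ad su_da su_ab su_cd su_cb.
rewrite !actDl !actZl !act1 !scalerA mulVf // !scale1r; split.
  by rewrite addrA subrK addrK.
by rewrite addrC addrA subrK addrK.
Qed.

Lemma matrix_unsolve V1 V2 :
  act d (act a V1 + act b V2) - Q^-1 *: act b (act c V1 + act d V2) = V1 /\
  act a (act c V1 + act d V2) - Q *: act c (act a V1 + act b V2) = V2.
Proof.
rewrite !actDr -!actM su_ad su_da su_ac su_bd su_cb.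
rewrite !actDl !actZl !act1 !scalerDr !scalerA mulVf // !scale1r; split.
  by rewrite opprD addrACA subrr addr0 addrK.
by rewrite opprD addrACA subrr add0r addrK.
Qed.
End MatrixInverse.

Section Form.
Variable G : fodc A.
Local Notation D := (fodc_d G).
Local Notation om := (omega G).

Lemma omega_bilin : bilin (fun x1 x2 : A => lact (S x1) (D x2)).
Proof.
split=> [y k u v|u k y y']; first by rewrite SD SZ lactDl lactZl.
by rewrite fodc_dD fodc_dZ lactDr lactZr.
Qed.

Let ob := omega_bilin.
Let ol := tlift_linear ob.

Lemma omegaD x y : om (x + y) = om x + om y.
Proof. by rewrite /omega cD (tliftD ob). Qed.
Lemma omegaZ k x : om (k *: x) = k *: om x.
Proof. by rewrite /omega cZ (tliftZ ob). Qed.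
Lemma omegaN x : om (- x) = - om x.
Proof. by rewrite -[- x]scaleN1r omegaZ scaleN1r. Qed.
Lemma omega1 : om 1 = 0.
Proof. by rewrite /omega c1 tlift_tens // fodc_d1 lactr0. Qed.

Lemma omega_gen : [/\ om b = theta0 G, om a = theta1 G, om c = theta2 G
  & om d = lact a (D d) - Q *: lact c (D b)].
Proof.
have [ca cb cc cd] := cgen; have [Sa Sb Sc Sd] := Sgen.
have L := (tliftD ob, tlift_tens ob).
split; rewrite /omega ?ca ?cb ?cc ?cd !L ?Sa ?Sb ?Sc ?Sd lactZl scaleNr //.
- by rewrite addrC.
- by rewrite addrC.
Qed.

(** The identity omega(xy) = eps(x) omega(y) + S(y_(1)) omega(x) y_(2), with the coproduct
    of y replaced by a simple tensor: expand d(x_(2) y_(2)) and use the antipode axiom. *)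
Lemma omega_mul_tens x y1 y2 : tlift (fun x1 x2 : A => lact (S x1) (D x2))
    (tmul (su_comul x) (tens y1 y2)) =
  su_counit x *: lact (S y1) (D y2) + lact (S y1) (ract (om x) y2).
Proof.
have -> : su_counit x *: lact (S y1) (D y2) =
    lact (S y1) (lact (tlift (fun x y : A => S x * y) (su_comul x)) (D y2)).
  by rewrite antipodeE lactZl lact1 lactZr.
rewrite /omega; move: (su_comul x); have la := tlift_linear anti_bilin.
apply: tensor_lin_ext => [k t t'|k t t'|x1 x2].
- by rewrite tm.1 ol.
- rewrite la ol lactDl lactZl lactDr lactZr ractDl ractZl lactDr lactZr.
  by rewrite addrACA scalerDr.
rewrite tmulE !tlift_tens // SM fodc_dM lactDr; congr (_ + _).
  by rewrite -!lactM mulrA.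
by rewrite lractA !lactM.
Qed.

Lemma omega_mul x : su_counit x = 0 ->
  [/\ om (x * a) = lact d (ract (om x) a) - Q^-1 *: lact b (ract (om x) c),
      om (x * b) = lact d (ract (om x) b) - Q^-1 *: lact b (ract (om x) d),
      om (x * c) = lact a (ract (om x) c) - Q *: lact c (ract (om x) a)
    & om (x * d) = lact a (ract (om x) d) - Q *: lact c (ract (om x) b)].
Proof.
move=> ex; have [ca cb cc cd] := cgen; have [Sa Sb Sc Sd] := Sgen.
have om2 y1 y2 z1 z2 : tlift (fun x1 x2 : A => lact (S x1) (D x2))
    (tmul (su_comul x) (tens y1 y2 + tens z1 z2)) =
    lact (S y1) (ract (om x) y2) + lact (S z1) (ract (om x) z2).
  by rewrite (bilinDr tm) (tliftD ob) !omega_mul_tens ex !scale0r !add0r.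
split; rewrite /om cM ?ca ?cb ?cc ?cd om2 ?Sa ?Sb ?Sc ?Sd lactZl scaleNr //.
- by rewrite addrC.
- by rewrite addrC.
Qed.

Lemma antipode_solve (U1 U2 : G) :
  lact a (lact d U1 - Q^-1 *: lact b U2) + lact b (lact a U2 - Q *: lact c U1) = U1 /\
  lact c (lact d U1 - Q^-1 *: lact b U2) + lact d (lact a U2 - Q *: lact c U1) = U2.
Proof. exact: (matrix_solve (lact_bilin G) (@lactM _ _ G) (@lact1 _ _ G)). Qed.

Section Relations3D.
Hypothesis hid : calc_ideal G = right_ideal_gen (@calc3D_gens R q).

Lemma ideal_omega x y : calc3D_gens x -> om (x * y) = 0.
Proof.
move=> gx; suff [] : calc_ideal G (x * y) by [].
rewrite hid; exists [:: (x, y)]; rewrite big_seq1; split=> // p.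
by rewrite inE => /eqP ->.
Qed.

Let gen_in i : (i < 6)%N -> calc3D_gens (nth 0 [:: b ^+ 2; c ^+ 2; b * c;
  (a - 1) * b; (a - 1) * c; (q ^+ 2)%:C *: a + d - (q ^+ 2 + 1)%:C *: 1] i).
Proof. by move=> hi; apply: mem_nth. Qed.

Lemma omega_bb y : om (b * b * y) = 0.
Proof. by rewrite -expr2 ideal_omega //; apply: (@gen_in 0). Qed.
Lemma omega_cc y : om (c * c * y) = 0.
Proof. by rewrite -expr2 ideal_omega //; apply: (@gen_in 1). Qed.
Lemma omega_bc y : om (b * c * y) = 0.
Proof. by rewrite ideal_omega //; apply: (@gen_in 2). Qed.
Lemma omega_ab y : om (a * b * y) = om (b * y).
Proof.
apply/eqP; rewrite -subr_eq0 -omegaN -omegaD -mulrBl -[X in _ - X]mul1r -mulrBl.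
by apply/eqP/ideal_omega/(@gen_in 3).
Qed.
Lemma omega_ac y : om (a * c * y) = om (c * y).
Proof.
apply/eqP; rewrite -subr_eq0 -omegaN -omegaD -mulrBl -[X in _ - X]mul1r -mulrBl.
by apply/eqP/ideal_omega/(@gen_in 4).
Qed.
Lemma omega_ad y : Q ^+ 2 *: om (a * y) + om (d * y) = (Q ^+ 2 + 1) *: om y.
Proof.
apply/eqP; rewrite -subr_eq0 -!omegaZ -omegaN -!omegaD scalerAl -mulrDl.
rewrite -[X in _ - _ *: X]mul1r scalerAl -mulrBl.
have q2 : (q ^+ 2)%:C = Q ^+ 2 :> C by rewrite rmorphXn.
have q21 : (q ^+ 2 + 1)%:C = Q ^+ 2 + 1 :> C by rewrite rmorphD rmorph1 /= q2.
by apply/eqP; have := @ideal_omega _ y (@gen_in 5 isT); rewrite /= q21 q2.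
Qed.

Lemma omega_d : om d = - Q ^+ 2 *: om a.
Proof.
have := omega_ad 1; rewrite !mulr1 omega1 scaler0 => /eqP.
by rewrite addrC addr_eq0 scaleNr => /eqP.
Qed.

(** For x in the kernel of eps, omega_mul can be inverted to express omega(x) y through
    the forms omega(x y') with y' a generator.  For x = b, c, a - 1 the relations of the
    right ideal reduce each of these to a multiple of omega(x). *)
Lemma frame_twist : [/\ twist G a (Q^-1 *: a) (Q^-2 *: a),
  twist G b (Q *: b) (Q ^+ 2 *: b), twist G c (Q^-1 *: c) (Q^-2 *: c)
  & twist G d (Q *: d) (Q ^+ 2 *: d)].
Proof.
have [ob' oa oc od] := omega_gen; have [ea eb ec ed] := egen.
have Q20 : Q ^+ 2 != 0 by rewrite expf_neq0.
have solve x : su_counit x = 0 ->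
    [/\ ract (om x) a = lact a (om (x * a)) + lact b (om (x * c)),
        ract (om x) b = lact a (om (x * b)) + lact b (om (x * d)),
        ract (om x) c = lact c (om (x * a)) + lact d (om (x * c))
      & ract (om x) d = lact c (om (x * b)) + lact d (om (x * d))].
  move=> ex; have [-> -> -> ->] := omega_mul ex.
  by split; rewrite ?(antipode_solve _ _).1 ?(antipode_solve _ _).2.
have one x : om x = om (x * 1) by rewrite mulr1.
(* theta0 = omega(b), and b is killed by the counit *)
have h1 : om (b * a) = Q^-1 *: om b.
  by rewrite (su_ba hq) omegaZ [om (a * b)]one omega_ab mulr1.
have h2 : om (b * b) = 0 by rewrite [om _]one omega_bb.
have h3 : om (b * c) = 0 by rewrite [om _]one omega_bc.
have h4 : om (b * d) = Q *: om b.
  rewrite -omega_ab -mulrA su_bd -scalerAr mulrA su_ad mulrDl mul1r omegaZ omegaD.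
  by rewrite -scalerAl omegaZ omega_bc scaler0 addr0.
have [b1 b2 b3 b4] := solve b eb; rewrite h1 h2 h3 h4 in b1 b2 b3 b4.
(* theta2 = omega(c) *)
have k1 : om (c * a) = Q^-1 *: om c.
  by rewrite (su_ca hq) omegaZ [om (a * c)]one omega_ac mulr1.
have k2 : om (c * b) = 0 by rewrite su_cb h3.
have k3 : om (c * c) = 0 by rewrite [om _]one omega_cc.
have k4 : om (c * d) = Q *: om c.
  rewrite -omega_ac -mulrA su_cd -scalerAr mulrA su_ad mulrDl mul1r omegaZ omegaD.
  by rewrite -scalerAl omegaZ omega_bc scaler0 addr0.
have [c1' c2 c3 c4] := solve c ec; rewrite k1 k2 k3 k4 in c1' c2 c3 c4.
(* theta1 = omega(a) = omega(a - 1); only a - 1 is killed by the counit *)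
have oa1 : om (a - 1) = om a by rewrite omegaD omegaN omega1 subr0.
have ea1 : su_counit (a - 1) = 0.
  by rewrite -scaleN1r eD eZ ea e1 mulr1 subrr.
have m1 : om ((a - 1) * a) = Q^-2 *: om a.
  apply: (scalerI Q20); rewrite scalerA mulfV // scale1r.
  rewrite mulrBl mul1r omegaD omegaN scalerBr.
  have := omega_ad a; rewrite su_da omegaD omega1 omegaZ h3 scaler0 !addr0.
  by rewrite scalerDl scale1r => ->; rewrite addrC addKr.
have m2 : om ((a - 1) * b) = 0.
  by rewrite mulrBl mul1r omegaD omegaN [om (a * b)]one omega_ab mulr1 subrr.
have m3 : om ((a - 1) * c) = 0.
  by rewrite mulrBl mul1r omegaD omegaN [om (a * c)]one omega_ac mulr1 subrr.
have m4 : om ((a - 1) * d) = Q ^+ 2 *: om a.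
  rewrite mulrBl mul1r su_ad omegaD omegaN omegaD omega1 omegaZ h3 scaler0 addr0.
  by rewrite add0r omega_d scaleNr opprK.
have [a1 a2 a3 a4] := solve (a - 1) ea1; rewrite oa1 m1 m2 m3 m4 in a1 a2 a3 a4.
have z := (lactr0, addr0, add0r, lactZr, lactZl).
rewrite -?ob' -?oa -?oc; split; split; rewrite -?ob' -?oa -?oc ?lactZl;
 rewrite ?(b1, b2, b3, b4, c1', c2, c3, c4, a1, a2, a3, a4) !z //.
Qed.

(** Inverting the antipode matrix gives da = a omega(a) + b omega(c) and its
    analogues, and omega(d) = - q^2 omega(a) by the last generator of the ideal. *)
Lemma frame_d : [/\ D a = comb G 0 a b, D b = comb G a (- Q ^+ 2 *: b) 0,
      D c = comb G 0 c d & D d = comb G c (- Q ^+ 2 *: d) 0].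
Proof.
have [ob' oa oc od] := omega_gen.
have [s1 s2] := antipode_solve (D a) (D c).
have [s3 s4] := antipode_solve (D b) (D d).
rewrite -/(theta1 G) -/(theta2 G) in s1 s2; rewrite -/(theta0 G) -od omega_d in s3 s4.
rewrite /comb !lact0 !add0r !addr0 !lactZl s1 s2 -!lactZr -[theta1 G]oa.
by split.
Qed.

Lemma calc3D_structure : structure_eqs G.
Proof. by split; [exact: frame_twist|exact: frame_d]. Qed.
End Relations3D.

Section Freeness.
Hypothesis hid : calc_ideal G = right_ideal_gen (@calc3D_gens R q).
Hypothesis hcov : left_covariant G.
Local Notation act := (tensor_act ( *%R : A -> A -> A) (@lact _ _ G)).

Let ab := tensor_act_bilin (mulr_bilin A) (lact_bilin G).
Let actE x y z w : act (tens x y) (tens z w) = tens (x * z) (lact y w).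
Proof. exact: tensor_actE (mulr_bilin A) (lact_bilin G) _ _ _ _. Qed.

Lemma act_mul t t' u : act (tmul t t') u = act t (act t' u).
Proof.
have al w := ab.1 w; have ar w := ab.2 w.
move: u; apply: tensor_lin_ext => [k u v|k u v|z w].
- by rewrite ar.
- by rewrite !ar.
move: t'; apply: tensor_lin_ext => [k u v|k u v|y1 y2].
- by rewrite tm.2 al.
- by rewrite al ar.
move: t; apply: tensor_lin_ext => [k u v|k u v|x1 x2].
- by rewrite tm.1 al.
- by rewrite al.
by rewrite tmulE !actE mulrA lactM.
Qed.

(** By the Leibniz rule, x dy z = x d(yz) - xy dz. *)
Lemma left_span w : exists s : seq (A * A), w = \sum_(p <- s) lact p.1 (D p.2).
Proof.
have [s ->] := fodc_d_span w; elim: s => [|t s [r e]].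
  by exists [::]; rewrite !big_nil.
exists [:: (t.1.1, t.1.2 * t.2), (- t.1.1 * t.1.2, t.2) & r].
rewrite !big_cons e addrA; congr (_ + _) => /=.
by rewrite lractA fodc_dM lactDr mulNr lactNl lactM addrC addKr.
Qed.

(** The coaction is a module map over the coproduct, so on S(x_(1)) d x_(2) the first
    legs multiply to S(x_(2)) x_(3) = eps; explicitly, the relations of the algebra make
    the first legs collapse. *)
Lemma coinvariance : exists phi : G -> tensor A G,
  [/\ linear phi, forall x w, phi (lact x w) = act (su_comul x) (phi w),
      phi (theta0 G) = tens 1 (theta0 G), phi (theta1 G) = tens 1 (theta1 G)
    & phi (theta2 G) = tens 1 (theta2 G)].
Proof.
have [phi lphi phiE] := hcov; exists phi.
have [p0 pD pN pZ] := linear_spec lphi.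
have pact x w : phi (lact x w) = act (su_comul x) (phi w).
  have [s ->] := left_span w; elim: s => [|p s IH].
    by rewrite big_nil lactr0 p0 (bilin0r ab).
  rewrite big_cons lactDr !pD IH (bilinDr ab); congr (_ + _).
  by rewrite -lactM !phiE cM act_mul.
have [ca cb cc cd] := cgen.
have tb := tens_bilin A G.
have bd' : bilin (fun y1 y2 => tens y1 (D y2) : tensor A G).
  by split=> [y k u v|u k y y']; rewrite ?tb.1 // fodc_dD fodc_dZ tb.2.
have pd y : phi (D y) = tlift (fun y1 y2 => tens y1 (D y2)) (su_comul y).
  rewrite -[D y]lact1 phiE c1; move: (su_comul y) => t.
  have : forall u, act (tens 1 1) u = u.
    apply: tensor_lin_ext => [|//|y1 w]; first exact: ab.2.
    by rewrite actE mul1r lact1.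
  exact.
have L := (tliftD bd', tlift_tens bd').
have coinv p r : su_comul p = tens a p + tens b r -> su_comul r = tens c p + tens d r ->
    phi (lact d (D p) - Q^-1 *: lact b (D r)) = tens 1 (lact d (D p) - Q^-1 *: lact b (D r)) /\
    phi (lact a (D r) - Q *: lact c (D p)) = tens 1 (lact a (D r) - Q *: lact c (D p)).
  move=> hp hr.
  have T := (bilinDl ab, bilinDr ab, actE).
  have tZl k x w : tens (k *: x) w = k *: tens x w :> tensor A G by exact: (bilinZl tb).
  have tDl x y w : tens (x + y) w = tens x w + tens y w :> tensor A G.
    exact: (bilinDl tb).
  have tDr x v w : tens x (v + w) = tens x v + tens x w :> tensor A G.
    exact: (bilinDr tb).
  have tZr k x w : tens x (k *: w) = k *: tens x w :> tensor A G by exact: (bilinZr tb).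
  have tNr x w : tens x (- w) = - tens x w :> tensor A G.
    by rewrite -scaleN1r tZr scaleN1r.
  rewrite !pD !pN !pZ !pact !pd hp hr !L ca cb cc cd !T.
  rewrite su_ac su_bd su_cb su_ad su_da.
  rewrite !(tZl, tDl, tDr, tNr, tZr) !scalerDr !scalerA mulVf // mulfV // !scale1r.
  split; first exact: cancel1.
  exact: cancel2.
have [h0 _] := coinv b d cb cd; have [h1 h2] := coinv a c ca cc.
by split.
Qed.

(** A vanishing combination is omega of a combination of b, a - 1, c, which then lies in
    the right ideal. *)
Lemma theta_indep k0 k1 k2 :
  k0 *: theta0 G + k1 *: theta1 G + k2 *: theta2 G = 0 -> [/\ k0 = 0, k1 = 0 & k2 = 0].
Proof.
have [o0 o1 o2 _] := omega_gen; have [ea eb ec ed] := egen.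
rewrite -o0 -o1 -o2 => h; apply: (frame_indep hq); rewrite -hid; split.
  by rewrite !eD !eZ eb ec -scaleN1r eD eZ ea e1 mulr1 subrr !mulr0 !addr0.
by rewrite !omegaD !omegaZ omegaD omegaN omega1 subr0.
Qed.

(** Apply the coaction to a vanishing combination and a functional h to the first leg:
    the coefficients z become h(z_(1)) z_(2).  Applying the coaction again, and the
    antipode to its first leg followed by left multiplication, turns these into their
    counits, h(z).  So h(z_j) = 0 for all h, by the independence of the frame. *)
Lemma calc3D_free : frame_free G.
Proof.
move=> z0 z1 z2 hz; have [phi [lphi pact p0 p1 p2]] := coinvariance.
have [phi0 phiD _ _] := linear_spec lphi.
have tb := tens_bilin A G.
(* sl x is h(x_(1)) x_(2). *)
have slice (h : A -> C) : linear (h : A -> C^o) ->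
    [/\ h z0 = 0, h z1 = 0 & h z2 = 0].
  move=> lh; pose sl x := tlift (fun x y => h x *: y) (su_comul x) : A.
  have bh : bilin (fun x y : A => h x *: y).
    split=> [y k u v|u k y y']; first by rewrite lh scalerDl scalerA.
    by rewrite scalerDr !scalerA mulrC.
  have bhG : bilin (fun x (w : G) => h x *: w).
    split=> [y k u v|u k y y']; first by rewrite lh scalerDl scalerA.
    by rewrite scalerDr !scalerA mulrC.
  have bSG : bilin (fun x (w : G) => lact (S x) w).
    split=> [y k u v|u k y y']; first by rewrite SD SZ lactDl lactZl.
    by rewrite lactDr lactZr.
  have phic y0 y1 y2 : phi (comb G y0 y1 y2) =
     act (su_comul y0) (tens 1 (theta0 G)) + act (su_comul y1) (tens 1 (theta1 G)) +
     act (su_comul y2) (tens 1 (theta2 G)).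
    by rewrite /comb !phiD !pact p0 p1 p2.
  have hl x w : tlift (fun x (w : G) => h x *: w) (act (su_comul x) (tens 1 w)) =
      lact (sl x) w.
    rewrite /sl; move: (su_comul x); apply: tensor_lin_ext.
    - by move=> k t t'; rewrite ab.1 (tlift_linear bhG).
    - by move=> k t t'; rewrite (tlift_linear bh) lactDl lactZl.
    by move=> x1 x2; rewrite actE !tlift_tens // mulr1 lactZl.
  have Sl x w : tlift (fun x (w : G) => lact (S x) w) (act (su_comul x) (tens 1 w)) =
      su_counit x *: w.
    have -> : su_counit x *: w = lact (tlift (fun x y : A => S x * y) (su_comul x)) w.
      by rewrite antipodeE lactZl lact1.
    move: (su_comul x); apply: tensor_lin_ext.
    - by move=> k t t'; rewrite ab.1 (tlift_linear bSG).
    - by move=> k t t'; rewrite (tlift_linear anti_bilin) lactDl lactZl.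
    by move=> x1 x2; rewrite actE !tlift_tens // mulr1 lactM.
  have hs : comb G (sl z0) (sl z1) (sl z2) = 0.
    have := congr1 (tlift (fun x (w : G) => h x *: w)) (congr1 phi hz).
    rewrite phic phi0 !(tliftD bhG) !hl => e; rewrite /comb e.
    by have [-> _ _ _] := linear_spec (tlift_linear bhG).
  have := congr1 (tlift (fun x (w : G) => lact (S x) w)) (congr1 phi hs).
  rewrite phic phi0 !(tliftD bSG) !Sl !counit_slice //.
  have [-> _ _ _] := linear_spec (tlift_linear bSG).
  exact: theta_indep.
have sep z : (forall h : A -> C, linear (h : A -> C^o) -> h z = 0) -> z = 0.
  move=> hz'; apply: (pi0_faithful (hq := hq) (s := false)) => i; apply: l2P => j.
  rewrite l2_0; apply: (hz' (fun x => pi0 hq x (ket R (i, false)) j)).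
  by move=> k x y; rewrite (pi0_bilin hq).1 l2E.
by split; apply: sep => h /slice[].
Qed.
End Freeness.
End Form.
End CovariantSide.

(** * The operator F *)

Section DiracOperator.
Variables (R : realType) (q : R).
Hypothesis hq : 0 < q < 1.
Local Notation C := R[i].
Local Notation I := (nat * int * bool)%type.
Local Notation V := (l2 R I).
Local Notation A := (SUq2 q).
Local Notation a := (su_a q).
Local Notation b := (su_b q).
Local Notation c := (su_c q).
Local Notation d := (su_d q).
Local Notation Q := (q%:C).
Local Notation pi := (pi0 hq).
Local Notation sC n := ((ladder q n)%:C).
Local Notation D := (fun u : V => fin_supp u).

Let Q0 : Q != 0 := Q_neq0 hq.

(** The generator whose shift undoes the shift of g. *)
Definition dual (g : su_gen) : su_gen :=
  match g with Ga => Gd | Gb => Gc | Gc => Gb | Gd => Ga end.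

Lemma dual_shift g i : gen_wgt q g i != 0 -> gen_shift (dual g) (gen_shift g i) = i.
Proof.
case: i => [[n m] s]; case: g => //= w0; rewrite ?addrK ?subrK //.
by case: n w0 => // /eqP; rewrite ladder0.
Qed.

Lemma gen_fin_supp g (u : V) : fin_supp u -> fin_supp (gen_op hq g u).
Proof.
move=> [r hr]; exists [seq gen_shift (dual g) i | i <- r] => i ir.
rewrite gen_opE; have [->|w0] := eqVneq (gen_wgt q g i) 0; first by rewrite mul0r.
rewrite hr ?mulr0 //; apply: contra ir => ir.
by rewrite -(dual_shift w0); apply: map_f.
Qed.

Lemma fin_suppD (u v : V) : fin_supp u -> fin_supp v -> fin_supp (u + v).
Proof. by move=> hu hv; have := (fin_supp_subspace R I).2 1 u v hu hv; rewrite scale1r. Qed.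
Lemma fin_suppZ k (u : V) : fin_supp u -> fin_supp (k *: u).
Proof.
move=> hu; have := (fin_supp_subspace R I).2 k u 0 hu (fin_supp_subspace R I).1.
by rewrite addr0.
Qed.

Lemma pi0_fin_supp x (u : V) : fin_supp u -> fin_supp (pi x u).
Proof.
have [ga gb gc gd] := pi0_gen hq.
move: x u; apply: su_ind.
- by move=> u; rewrite ga; apply: gen_fin_supp.
- by move=> u; rewrite gb; apply: gen_fin_supp.
- by move=> u; rewrite gc; apply: gen_fin_supp.
- by move=> u; rewrite gd; apply: gen_fin_supp.
- by move=> u; rewrite pi0_1.
- by move=> x y hx hy u hu; rewrite pi0D; apply: fin_suppD; [apply: hx|apply: hy].
- by move=> x y hx hy u hu; rewrite pi0M; apply/hx/hy.
- by move=> k x hx u hu; rewrite pi0Z; apply/fin_suppZ/hx.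
Qed.

(** The function q^-m of the second index; kap and lam are the scalars 1/(1 - q^2) and
    q^2/(1 - q^2), and Omega is the diagonal operator with eigenvalues q^(n-m). *)
Definition qpowN (m : int) : C := Q ^ (- m).

Lemma qpowND1 m : qpowN (m + 1) = Q^-1 * qpowN m.
Proof. by rewrite /qpowN opprD expfzDr // mulrC. Qed.
Lemma qpowNB1 m : qpowN (m - 1) = Q * qpowN m.
Proof. by rewrite /qpowN opprB addrC expfzDr // expr1z mulrC. Qed.
Lemma qpowN_neq0 m : qpowN m != 0. Proof. exact: expfz_neq0. Qed.
Lemma qpowN_conj m : Num.conj (qpowN m) = qpowN m.
Proof.
have cQ : Num.conj Q = Q by exact: conjc_real.
by rewrite /qpowN; case: (- m) => n; rewrite /exprz ?fmorphV rmorphXn /= cQ.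
Qed.

Definition kap : C := (1 - Q ^+ 2)^-1.
Definition lam : C := Q ^+ 2 * kap.
Definition Omega (n : nat) (m : int) : C := Q ^+ n * qpowN m.

(** The action of F on coordinates.  The first summand is the diagonal part, and the
    second one exchanges the sheets, raising n when it leads from the sheet false to
    the sheet true.  Again the predecessor of 0 is multiplied by s_0 = 0. *)
Definition dirac_raw (f : I -> C) (i : I) : C :=
  lam * Omega i.1.1 i.1.2 ^+ 2 * f i +
  if i.2 then kap * qpowN i.1.2 * sC i.1.1 * f (i.1.1.-1, i.1.2 + 1, false)
  else kap * qpowN (i.1.2 - 1) * sC i.1.1.+1 * f (i.1.1.+1, i.1.2 - 1, true).

Lemma dirac_raw_fin_supp f : fin_supp f -> fin_supp (dirac_raw f).
Proof.
move=> [r hr]; exists (r ++ [seq (i.1.1.+1, i.1.2 - 1, true) | i <- r] ++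
   [seq (i.1.1.-1, i.1.2 + 1, false) | i <- r]) => -[[n m] s].
rewrite !mem_cat !negb_or => /andP[ir /andP[i1 i2]].
rewrite /dirac_raw (hr _ ir) mulr0 add0r /=; case: s ir i1 i2 => ir i1 i2.
  case: n ir i1 i2 => [|n] ir i1 i2; first by rewrite ladder0 mulr0 mul0r.
  rewrite hr ?mulr0 //; apply: contra i1 => h.
  by apply/mapP; exists (n, m + 1, false) => //=; rewrite addrK.
rewrite hr ?mulr0 //; apply: contra i2 => h.
by apply/mapP; exists (n.+1, m - 1, true) => //=; rewrite subrK.
Qed.

Lemma dirac_ex : {T : V -> V | forall u, T u = mkl2 (dirac_raw u)}.
Proof. by exists (fun u => mkl2 (dirac_raw u)). Qed.

Definition dirac : V -> V := sval dirac_ex.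

Lemma diracE (u : V) i : D u -> dirac u i = dirac_raw u i.
Proof.
by move=> Du; rewrite /dirac (svalP dirac_ex); apply/mkl2E/fin_supp_l2/dirac_raw_fin_supp.
Qed.

Lemma dirac_linear k (u v : V) : D u -> D v -> dirac (k *: u + v) = k *: dirac u + dirac v.
Proof.
move=> Du Dv; have Dw : D (k *: u + v) by apply: (fin_supp_subspace R I).2.
apply: l2P => i; rewrite l2E !diracE // /dirac_raw !l2E.
by case: i.2; ring.
Qed.

Lemma kap_conj : Num.conj kap = kap.
Proof.
have cQ : Num.conj Q = Q by exact: conjc_real.
by rewrite /kap fmorphV rmorphB rmorph1 rmorphXn /= cQ.
Qed.

Lemma dirac_ket n m s : dirac (ket R (n, m, s)) = lam * Omega n m ^+ 2 *: ket R (n, m, s) +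
  if s then kap * qpowN m * sC n *: ket R (n.-1, m + 1, false)
  else kap * qpowN (m - 1) * sC n.+1 *: ket R (n.+1, m - 1, true).
Proof.
apply: l2P => -[[n' m'] s']; rewrite diracE; last exact: ket_fin_supp.
rewrite l2D l2Z /dirac_raw !ketE /=; congr (_ + _).
  by case: eqVneq => [[-> -> _]|_] //; rewrite !mulr0.
case: s s' => -[]; rewrite l2Z ketE !xpair_eqE /= ?andbT ?andbF ?mulr0 //.
  case: n => [|n]; first by rewrite ladder0 /= !(mulr0, mul0r).
  rewrite eqSS subr_eq; case: eqVneq => [->|_]; last by rewrite !mulr0.
  by case: eqVneq => [->|_]; rewrite ?mulr0 // addrK.
case: n' => [|n']; first by rewrite ladder0 /= !(mulr0, mul0r).
have -> : (m' == m - 1) = (m' + 1 == m) by rewrite [LHS]eq_sym subr_eq eq_sym.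
rewrite /= eqSS; case: (n' =P n) => [->|_]; last by rewrite !mulr0.
by case: (m' + 1 =P m) => [<-|_]; rewrite ?mulr0 // addrK.
Qed.

Lemma dirac_adj_ket (u : V) i : D u -> l2_ip (dirac u) (ket R i) = l2_ip u (dirac (ket R i)).
Proof.
case: i => [[n m] s] Du; rewrite l2_ip_ket diracE // dirac_ket.
have cQ : Num.conj Q = Q by exact: conjc_real.
have omJ : Num.conj (Omega n m) = Omega n m.
  by rewrite rmorphM rmorphXn /= cQ qpowN_conj.
have lamJ : Num.conj lam = lam by rewrite rmorphM rmorphXn /= cQ kap_conj.
rewrite ipDr ipZr rmorphM rmorphXn /= lamJ omJ l2_ip_ket /dirac_raw /=; congr (_ + _).
by case: s; rewrite ipZr !rmorphM /= kap_conj qpowN_conj conjR l2_ip_ket.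
Qed.

Lemma dirac0 : dirac 0 = 0.
Proof.
have D0 : D 0 by exact: (fin_supp_subspace R I).1.
have := dirac_linear 1 D0 D0; rewrite !scale1r addr0 => /eqP.
by rewrite -subr_eq subrr eq_sym => /eqP.
Qed.

(** The second argument is a finite combination of basis vectors, for which the claim
    is an identity between real matrix entries. *)
Lemma dirac_symmetric (u v : V) : D u -> D v -> l2_ip (dirac u) v = l2_ip u (dirac v).
Proof.
move=> Du /fin_supp_ket[r ur ->]; rewrite /trunc.
elim: r {ur} => [|i r IH].
  by rewrite big_nil dirac0 !(linear0r (l2_dot R I)).
have Dr : D (\sum_(j <- r) v j *: ket R j).
  elim: r {IH} => [|j r IH]; first by rewrite big_nil; exact: (fin_supp_subspace R I).1.
  by rewrite big_cons; apply: (fin_supp_subspace R I).2 => //; apply: ket_fin_supp.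
rewrite big_cons dirac_linear //; last exact: ket_fin_supp.
by rewrite !ipDr !ipZr IH dirac_adj_ket.
Qed.

Definition dirac_symop : symop (H R) := @Symop R (H R) (fun u : V => fin_supp u) dirac
  (fin_supp_subspace R I) (@fin_supp_dense R I) dirac_linear dirac_symmetric.

Definition dirac_pair : comm_pair (SUq2_star hq) :=
  @CommPair R (SUq2_star hq) (H R) (su_rep hq) dirac_symop (fun u : V => fin_supp u)
    (fin_supp_subspace R I) (@fin_supp_dense R I) (fun u Du => Du) pi0_fin_supp.

End DiracOperator.

(** * Commutators with F *)

(** One identity per generator and sheet, for the coordinate (n, m) of a commutator.  The
    scalars stand for k = i, y = q^-m, w = q^n, with w0, w1, w2 the neighbouring powers of
    q, for the coefficients s_n of the neighbouring indices, and for the coordinates U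
    and W of the vector that occur.  The variants with suffix 0 are the boundary n = 0. *)
Section FieldIdentities.
Variables (K : fieldType) (Q k y : K).
Hypotheses (Q0 : Q != 0) (Q1 : 1 - Q ^+ 2 != 0).
Local Notation lam := (Q ^+ 2 * (1 - Q ^+ 2)^-1).
Local Notation kap := ((1 - Q ^+ 2)^-1).

Lemma id_a_true w w1 s1 s2 U W : w1 = Q * w ->
  s1 * s1 = 1 - w * w -> s2 * s2 = 1 - w1 * w1 ->
  k * (lam * (w * y) ^+ 2 * (s2 * U) + kap * y * s1 * (s1 * W)) -
  s2 * (k * (lam * (w1 * y) ^+ 2 * U + kap * y * s2 * W)) =
  s2 * (k * (w1 * y) ^+ 2 * U) + - w1 * (k * (w * (Q^-1 * y)) * W).
Proof.
move=> -> e1 e2; set L := LHS.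
have -> : L = s2 * (k * (Q * w * y) ^+ 2 * U) + k * kap * y * W * (s1 * s1 - s2 * s2).
  by rewrite /L; field; rewrite Q1.
by rewrite e1 e2; field; rewrite Q0 Q1.
Qed.

Lemma id_a_false w w1 s2 s3 U W : w1 = Q * w ->
  k * (lam * (w * y) ^+ 2 * (s2 * U) + kap * (Q * y) * s2 * (s3 * W)) -
  s2 * (k * (lam * (w1 * y) ^+ 2 * U + kap * (Q * y) * s3 * W)) =
  s2 * (k * (w1 * y) ^+ 2 * U) + - w1 * 0.
Proof. by move=> ->; field; rewrite Q1. Qed.

Lemma id_b_true w w1 s1 s2 U W : w1 = Q * w ->
  k * (lam * (w * y) ^+ 2 * (- w1 * U) + kap * y * s1 * (- w * W)) -
  - w1 * (k * (lam * (w * (Q^-1 * y)) ^+ 2 * U + kap * (Q^-1 * y) * s1 * W)) =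
  s2 * 0 + - w1 * (- Q ^+ 2 * (k * (w * (Q^-1 * y)) ^+ 2 * U)).
Proof. by move=> ->; field; rewrite Q0 Q1. Qed.

Lemma id_b_false w w1 w2 s2 U W : w1 = Q * w -> w2 = Q * w1 ->
  k * (lam * (w * y) ^+ 2 * (- w1 * U) + kap * (Q * y) * s2 * (- w2 * W)) -
  - w1 * (k * (lam * (w * (Q^-1 * y)) ^+ 2 * U + kap * (Q * (Q^-1 * y)) * s2 * W)) =
  s2 * (k * (w1 * y) * W) + - w1 * (- Q ^+ 2 * (k * (w * (Q^-1 * y)) ^+ 2 * U)).
Proof. by move=> -> ->; field; rewrite Q0 Q1. Qed.

Lemma id_c_true w w0 s1 U W : w = Q * w0 ->
  k * (lam * (w * y) ^+ 2 * (w * U) + kap * y * s1 * (w0 * W)) -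
  w * (k * (lam * (w * (Q * y)) ^+ 2 * U + kap * (Q * y) * s1 * W)) =
  w * (k * (w * (Q * y)) ^+ 2 * U) + s1 * (k * (w0 * y) * W).
Proof. by move=> ->; field; rewrite Q1. Qed.

Lemma id_c_true0 w U :
  k * (lam * (w * y) ^+ 2 * (w * U) + 0) - w * (k * (lam * (w * (Q * y)) ^+ 2 * U + 0)) =
  w * (k * (w * (Q * y)) ^+ 2 * U) + 0.
Proof. by field; rewrite Q1. Qed.

Lemma id_c_false w w1 s1 s2 U W : w1 = Q * w ->
  k * (lam * (w * y) ^+ 2 * (w * U) + kap * (Q * y) * s2 * (w1 * W)) -
  w * (k * (lam * (w * (Q * y)) ^+ 2 * U + kap * (Q * (Q * y)) * s2 * W)) =
  w * (k * (w * (Q * y)) ^+ 2 * U) + s1 * 0.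
Proof. by move=> ->; field; rewrite Q1. Qed.

Lemma id_d_true w0 w1 s0 s1 U W : w1 = Q * w0 ->
  k * (lam * (w1 * y) ^+ 2 * (s1 * U) + kap * y * s1 * (s0 * W)) -
  s1 * (k * (lam * (w0 * y) ^+ 2 * U + kap * y * s0 * W)) =
  w1 * 0 + s1 * (- Q ^+ 2 * (k * (w0 * y) ^+ 2 * U)).
Proof. by move=> ->; field; rewrite Q1. Qed.

Lemma id_d_false w0 w1 w2 s1 s2 U W : w1 = Q * w0 -> w2 = Q * w1 ->
  s1 * s1 = 1 - w1 * w1 -> s2 * s2 = 1 - w2 * w2 ->
  k * (lam * (w1 * y) ^+ 2 * (s1 * U) + kap * (Q * y) * s2 * (s2 * W)) -
  s1 * (k * (lam * (w0 * y) ^+ 2 * U + kap * (Q * y) * s1 * W)) =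
  w1 * (k * (w1 * (Q * y)) * W) + s1 * (- Q ^+ 2 * (k * (w0 * y) ^+ 2 * U)).
Proof.
move=> -> -> e1 e2; set L := LHS.
have -> : L = s1 * (- Q ^+ 2 * (k * (w0 * y) ^+ 2 * U)) +
    k * kap * (Q * y) * W * (s2 * s2 - s1 * s1).
  by rewrite /L; field; rewrite Q1.
by rewrite e1 e2; field; rewrite Q1.
Qed.

Lemma id_d_false0 s2 W X : s2 * s2 = 1 - Q * Q ->
  k * (X * 0 + kap * (Q * y) * s2 * (s2 * W)) - 0 = 1 * (k * (1 * (Q * y)) * W) + 0.
Proof.
move=> e; set L := LHS.
have -> : L = k * kap * (Q * y) * W * (s2 * s2) by rewrite /L; field; rewrite Q1.
by rewrite e; field; rewrite Q1.
Qed.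
End FieldIdentities.

Section DiracCalculus.
Variables (R : realType) (q : R).
Hypothesis hq : 0 < q < 1.
Local Notation C := R[i].
Local Notation I := (nat * int * bool)%type.
Local Notation V := (l2 R I).
Local Notation A := (SUq2 q).
Local Notation a := (su_a q).
Local Notation b := (su_b q).
Local Notation c := (su_c q).
Local Notation d := (su_d q).
Local Notation Q := (q%:C).
Local Notation pi := (pi0 hq).
Local Notation sC n := ((ladder q n)%:C).
Local Notation D := (fun u : V => fin_supp u).
Local Notation P := (dirac_pair hq).
Local Notation iC := ('i%R : C).
Local Notation Omega := (Omega q).
Local Notation qpowN := (qpowN q).
Local Notation kap := (kap q).
Local Notation lam := (lam q).
Local Notation dirac := (@dirac R q).

Let Q0 : Q != 0 := Q_neq0 hq.
Definition dirac_fodc : fodc A := comm_fodc P.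
Local Notation G := dirac_fodc.

(** The operators by which theta0, theta1, theta2 turn out to act, again as weighted
    compositions: i Omega from the sheet true to the sheet false, i Omega^2 on both
    sheets, and i Omega from false to true. *)
Definition frame_wgt (j : 'I_3) (i : I) : C :=
  match val j with
  | O => if i.2 then 0 else iC * Omega i.1.1 i.1.2
  | S O => iC * Omega i.1.1 i.1.2 ^+ 2
  | _ => if i.2 then iC * Omega i.1.1 i.1.2 else 0
  end.
Definition frame_swap (j : 'I_3) (i : I) : I :=
  if val j is S O then i else (i.1, ~~ i.2).
Definition frame_raw j (f : I -> C) (i : I) : C := frame_wgt j i * f (frame_swap j i).

Lemma frame_swapK j : involutive (frame_swap j).
Proof. by move=> [i s]; rewrite /frame_swap; case: (val j) => [|[|k]] //=; rewrite negbK. Qed.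

Lemma frame_raw_fin_supp j f : fin_supp f -> fin_supp (frame_raw j f).
Proof.
move=> [r hr]; exists [seq frame_swap j i | i <- r] => i ir.
rewrite /frame_raw hr ?mulr0 //; apply: contra ir => h.
by apply/mapP; exists (frame_swap j i); rewrite // frame_swapK.
Qed.

Lemma frame_op_ex : {X : 'I_3 -> V -> V | forall j u, X j u = mkl2 (frame_raw j u)}.
Proof. by exists (fun j u => mkl2 (frame_raw j u)). Qed.

Definition frame_op : 'I_3 -> V -> V := sval frame_op_ex.

Lemma frame_opE j (u : V) i : D u -> frame_op j u i = frame_raw j u i.
Proof.
by move=> Du; rewrite /frame_op (svalP frame_op_ex); apply/mkl2E/fin_supp_l2/frame_raw_fin_supp.
Qed.

Local Notation j0 := (Ordinal (isT : 0 < 3)%N).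
Local Notation j1 := (Ordinal (isT : 1 < 3)%N).
Local Notation j2 := (Ordinal (isT : 2 < 3)%N).

Lemma d_val x (u : V) : D u ->
  comm_val (comm_d P x) u = iC *: dirac (pi x u) - pi x (iC *: dirac u) :> V.
Proof. by move=> Du; rewrite /= /comm_diff restrE. Qed.

(** The structure equations for the commutators, verified coordinate by coordinate. *)
Lemma d_gens (u : V) : D u ->
  [/\ comm_val (comm_d P a) u = pi a (frame_op j1 u) + pi b (frame_op j2 u),
      comm_val (comm_d P b) u = pi a (frame_op j0 u) + pi b (- Q ^+ 2 *: frame_op j1 u),
      comm_val (comm_d P c) u = pi c (frame_op j1 u) + pi d (frame_op j2 u)
    & comm_val (comm_d P d) u = pi c (frame_op j0 u) + pi d (- Q ^+ 2 *: frame_op j1 u)].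
Proof.
move=> Du; have [ga gb gc gd] := pi0_gen hq.
have kap0 : 1 - Q ^+ 2 != 0.
  have := q_lt1 hq; have := q_gt0 hq => q0 q1.
  rewrite -rmorphXn -(rmorph1 (@real_complex R)) -rmorphB /=.
  rewrite -[0]/(0%:C) (inj_eq (@complexI _)) subr_eq0 eq_sym lt_eqF //.
  by rewrite exprn_ilt1 // ltW.
have sqq n : sC n * sC n = 1 - (q%:C) ^+ n * q%:C ^+ n :> C.
  by rewrite -rmorphM -expr2 (ladder_sqr hq) rmorphB rmorph1 -exprD addnn -mul2n rmorphXn.
have Dg g : D (gen_op hq g u) by apply: gen_fin_supp.
have cf (f g : V) : (forall n m s, f (n, m, s) = g (n, m, s)) -> f = g.
  by move=> e; apply: l2P => -[[n m] s]; exact: e.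
have FE (v : V) (n : nat) (m : int) (s : bool) : D v ->
  dirac v (n, m, s) = dirac_raw q v (n, m, s) by move=> Dv; exact: diracE.
have frame_opE' j (n : nat) (m : int) (s : bool) :
  frame_op j u (n, m, s) = frame_raw j u (n, m, s) by exact: frame_opE.
have sC0 : sC 0 = 0 by rewrite ladder0.
split; rewrite (d_val _ Du) ?ga ?gb ?gc ?gd; apply: cf => n m s.
- rewrite l2D l2N l2Z gen_opE l2Z (FE _ _ _ _ (Dg Ga)) (FE _ _ _ _ Du) l2D !gen_opE !frame_opE'.
  rewrite /dirac_raw /frame_raw /frame_wgt /frame_swap /gen_wgt /gen_shift !gen_opE /=.
  rewrite /gen_wgt /gen_shift /Omega /=.
  case: s; rewrite /= ?mul0r ?(qpowNB1 hq) ?(qpowND1 hq) ?addrK ?subrK /lam /kap.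
    have -> : kap * qpowN m * sC n * (sC n.-1.+1 * u (n.-1.+1, m + 1, false)) =
        kap * qpowN m * sC n * (sC n * u (n, m + 1, false)).
      by case: (n) => [|n'] //; rewrite sC0 !(mulr0, mul0r).
    by apply: id_a_true; rewrite ?sqq // exprS.
  by apply: id_a_false; rewrite // exprS.
- rewrite l2D l2N l2Z gen_opE l2Z (FE _ _ _ _ (Dg Gb)) (FE _ _ _ _ Du) l2D.
  rewrite !gen_opE l2Z !frame_opE'.
  rewrite /dirac_raw /frame_raw /frame_wgt /frame_swap /gen_wgt /gen_shift !gen_opE /=.
  rewrite /gen_wgt /gen_shift /Omega /=.
  case: s; rewrite /= ?mul0r ?(qpowNB1 hq) ?(qpowND1 hq) ?addrK ?subrK /lam /kap.
    have -> : kap * qpowN m * sC n * (- Q ^+ n.-1.+1 * u (n.-1, m + 1 + 1, false)) =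
        kap * qpowN m * sC n * (- Q ^+ n * u (n.-1, m + 1 + 1, false)).
      by case: (n) => [|n'] //; rewrite sC0 !(mulr0, mul0r).
    by apply: id_b_true; rewrite // exprS.
  by apply: id_b_false; rewrite // exprS.
- rewrite l2D l2N l2Z gen_opE l2Z (FE _ _ _ _ (Dg Gc)) (FE _ _ _ _ Du) l2D !gen_opE !frame_opE'.
  rewrite /dirac_raw /frame_raw /frame_wgt /frame_swap /gen_wgt /gen_shift !gen_opE /=.
  rewrite /gen_wgt /gen_shift /Omega /=.
  case: s; rewrite /= ?mul0r ?(qpowNB1 hq) ?(qpowND1 hq) ?addrK ?subrK /lam /kap.
    case: n => [|n]; first by rewrite sC0 !(mulr0, mul0r); apply: id_c_true0.
    by apply: id_c_true; rewrite // exprS.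
  by apply: id_c_false; rewrite // exprS.
- rewrite l2D l2N l2Z gen_opE l2Z (FE _ _ _ _ (Dg Gd)) (FE _ _ _ _ Du) l2D.
  rewrite !gen_opE l2Z !frame_opE'.
  rewrite /dirac_raw /frame_raw /frame_wgt /frame_swap /gen_wgt /gen_shift !gen_opE /=.
  rewrite /gen_wgt /gen_shift /Omega /=.
  case: s; rewrite /= ?mul0r ?(qpowNB1 hq) ?(qpowND1 hq) ?addrK ?subrK /lam /kap.
    case: n => [|n]; first by rewrite sC0 !(mulr0, mul0r) addr0 mulr0 subr0.
    by apply: id_d_true; rewrite // exprS.
  case: n => [|n].
    by rewrite sC0 !mul0r; apply: id_d_false0; rewrite // sqq expr1.
  by apply: id_d_false; rewrite ?sqq // exprS.
Qed.

Let pb := pi0_bilin hq.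
Let pM := @pi0M R q hq.

(** The frame is defined from the differentials by the inverse matrix, which d_gens
    allows to cancel. *)
Lemma theta_val (u : V) : D u ->
  [/\ comm_val (theta0 G) u = frame_op j0 u, comm_val (theta1 G) u = frame_op j1 u
    & comm_val (theta2 G) u = frame_op j2 u].
Proof.
move=> Du; have [ha hb hc hd] := d_gens Du.
have vD (w w' : comm_space P) : comm_val (w - w') u = comm_val w u - comm_val w' u :> V.
  by [].
have vZ k (w : comm_space P) : comm_val (k *: w) u = k *: comm_val w u :> V by [].
have vL x (w : comm_space P) : comm_val (comm_lact x w) u = pi x (comm_val w u) :> V.
  by [].
have pi1 := @pi0_1 R q hq.
have [s1 _] := matrix_unsolve hq pb pM pi1 (frame_op j0 u) (- Q ^+ 2 *: frame_op j1 u).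
have [s3 s4] := matrix_unsolve hq pb pM pi1 (frame_op j1 u) (frame_op j2 u).
split.
- by rewrite -[RHS]s1 -hb -hd.
- by rewrite -[RHS]s3 -ha -hc.
- by rewrite -[RHS]s4 -ha -hc.
Qed.

Lemma comm_val_ract (w : comm_space P) y (u : V) : D u ->
  comm_val (comm_ract w y) u = comm_val w (pi y u) :> V.
Proof.
move=> Du; have Dyu : cp_dom P (pi y u) := pi0_fin_supp hq y Du.
have [s ws] : exists s, comm_val w = comm_sum s by exists (comm_seq w); apply: comm_seqE.
rewrite (comm_ractE y ws) ws (comm_sum_in _ Dyu).
rewrite (comm_sum_in (P := P) _ (Du : cp_dom P u)).
rewrite /rscale big_map; apply: eq_bigr => t _.
by rewrite /= pM.
Qed.

(** Elements of the space of commutators vanish outside the domain by construction. *)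
Lemma comm_space_eq (w w' : comm_space P) :
  (forall u, D u -> comm_val w u = comm_val w' u) -> w = w'.
Proof.
move=> e; apply: comm_val_inj; apply/funext => u.
have [Du|Du] := pselect (D u); first exact: e.
by rewrite !comm_seqE !comm_sum_out.
Qed.

(** Omega changes by q or q^-1 along the shift of each generator, and the generators act
    in the same way on both sheets. *)
Lemma frame_op_gen g (u : V) : D u ->
  [/\ frame_op j0 (gen_op hq g u) =
        (if g is (Ga | Gc) then Q^-1 else Q) *: gen_op hq g (frame_op j0 u),
      frame_op j1 (gen_op hq g u) =
        (if g is (Ga | Gc) then Q ^- 2 else Q ^+ 2) *: gen_op hq g (frame_op j1 u)
    & frame_op j2 (gen_op hq g u) =
        (if g is (Ga | Gc) then Q^-1 else Q) *: gen_op hq g (frame_op j2 u)].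
Proof.
move=> Du; have Dg : D (gen_op hq g u) by apply: gen_fin_supp.
have key (j : 'I_3) k : (forall i, gen_wgt q g i != 0 ->
      frame_wgt j i = k * frame_wgt j (gen_shift g i)) ->
    frame_op j (gen_op hq g u) = k *: gen_op hq g (frame_op j u).
  move=> hk; apply: l2P => i; rewrite (frame_opE _ _ Dg) l2Z gen_opE (frame_opE _ _ Du).
  rewrite /frame_raw gen_opE.
  have -> : gen_wgt q g (frame_swap j i) = gen_wgt q g i.
    by rewrite /frame_swap; case: (val j) => [|[|j']] //; case: g {Dg hk}.
  have -> : gen_shift g (frame_swap j i) = frame_swap j (gen_shift g i).
    by rewrite /frame_swap; case: (val j) => [|[|j']] //; case: g {Dg hk}.
  have [->|w0] := eqVneq (gen_wgt q g i) 0; first by rewrite !(mul0r, mulr0).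
  by rewrite (hk _ w0); move: (u _) => x; ring.
have omk i : gen_wgt q g i != 0 -> Omega i.1.1 i.1.2 =
    (if g is (Ga | Gc) then Q^-1 else Q) *
      Omega (gen_shift g i).1.1 (gen_shift g i).1.2.
  case: i => [[n m] s]; case: g {Dg key} => /= w0; rewrite /Omega ?(qpowNB1 hq) ?(qpowND1 hq).
  - by rewrite exprS; field.
  - by field.
  - by field.
  - by case: n w0 => [|n] w0; [rewrite ladder0 eqxx in w0|rewrite exprS; ring].
have i2 i : (gen_shift g i).2 = i.2 by case: g {Dg key omk}.
split; apply: key => i w0; rewrite /frame_wgt /= ?i2 (omk _ w0).
- by case: i.2; rewrite ?mulr0 // mulrCA.
- by case: g {Dg omk i2 w0} => /=; rewrite exprMn ?exprVn mulrCA.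
- by case: i.2; rewrite ?mulr0 // mulrCA.
Qed.

End DiracCalculus.

(** * Freeness and admissibility *)

Section DiracStructure.
Variables (R : realType) (q : R).
Hypothesis hq : 0 < q < 1.
Local Notation C := R[i].
Local Notation I := (nat * int * bool)%type.
Local Notation V := (l2 R I).
Local Notation A := (SUq2 q).
Local Notation a := (su_a q).
Local Notation b := (su_b q).
Local Notation c := (su_c q).
Local Notation d := (su_d q).
Local Notation Q := (q%:C).
Local Notation pi := (pi0 hq).
Local Notation D := (fun u : V => fin_supp u).
Local Notation P := (dirac_pair hq).
Local Notation iC := ('i%R : C).
Local Notation G := (dirac_fodc hq).
Local Notation j0 := (Ordinal (isT : 0 < 3)%N).
Local Notation j1 := (Ordinal (isT : 1 < 3)%N).
Local Notation j2 := (Ordinal (isT : 2 < 3)%N).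
Local Notation frame_op := (@frame_op R q).

Lemma comb_val z0 z1 z2 (u : V) : D u -> comm_val (comb G z0 z1 z2) u =
  pi z0 (frame_op j0 u) + pi z1 (frame_op j1 u) + pi z2 (frame_op j2 u) :> V.
Proof. by move=> Du; have [<- <- <-] := theta_val hq Du. Qed.

Lemma pi0_0 v : pi 0 v = 0.
Proof. by rewrite -(scale0r 1) pi0Z scale0r. Qed.

Lemma pi0Zr k x v : pi x (k *: v) = k *: pi x v.
Proof. exact: (bilinZr (pi0_bilin hq)). Qed.

(** The twisting rules are frame_op_gen and the differentials are d_gens, both
    transported from vectors in the domain to commutators. *)
Lemma dirac_structure : structure_eqs G.
Proof.
have [ga gb gc gd] := pi0_gen hq.
have tw x g k0 k1 : pi x = gen_op hq g ->
    (forall u, D u -> [/\ frame_op j0 (gen_op hq g u) = k0 *: gen_op hq g (frame_op j0 u),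
      frame_op j1 (gen_op hq g u) = k1 *: gen_op hq g (frame_op j1 u)
      & frame_op j2 (gen_op hq g u) = k0 *: gen_op hq g (frame_op j2 u)]) ->
    twist G x (k0 *: x) (k1 *: x).
  move=> gx h; split; apply: comm_space_eq => u Du; have [h0 h1 h2] := h u Du;
    have Dg : D (pi x u) by apply: pi0_fin_supp.
  - have [e _ _] := theta_val hq Du; have [e' _ _] := theta_val hq Dg.
    by rewrite (comm_val_ract _ _ Du) e' gx h0 -gx -pi0Z -e.
  - have [_ e _] := theta_val hq Du; have [_ e' _] := theta_val hq Dg.
    by rewrite (comm_val_ract _ _ Du) e' gx h1 -gx -pi0Z -e.
  - have [_ _ e] := theta_val hq Du; have [_ _ e'] := theta_val hq Dg.
    by rewrite (comm_val_ract _ _ Du) e' gx h2 -gx -pi0Z -e.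
have tg g := @frame_op_gen R q hq g.
split.
  split.
  - exact: (tw _ _ _ _ ga (tg Ga)).
  - exact: (tw _ _ _ _ gb (tg Gb)).
  - exact: (tw _ _ _ _ gc (tg Gc)).
  - exact: (tw _ _ _ _ gd (tg Gd)).
split; apply: comm_space_eq => u Du; have [ha hb hc hd] := d_gens hq Du;
  rewrite (comb_val _ _ _ Du) ?pi0_0 ?add0r ?addr0 ?pi0Z -?pi0Zr.
- exact: ha.
- exact: hb.
- exact: hc.
- exact: hd.
Qed.

Lemma pi0_sheet x (f : V) s : (forall i, f (i, s) = 0) -> forall i, pi x f (i, s) = 0.
Proof.
have [ga gb gc gd] := pi0_gen hq.
have gen g (f' : V) : (forall i, f' (i, s) = 0) -> forall i, gen_op hq g f' (i, s) = 0.
  by move=> h i; rewrite gen_opE; case: g => /=; rewrite h mulr0.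
move: x f; apply: su_ind.
- by rewrite ga; apply: gen.
- by rewrite gb; apply: gen.
- by rewrite gc; apply: gen.
- by rewrite gd; apply: gen.
- by move=> f h i; rewrite pi0_1.
- by move=> x y hx hy f h i; rewrite pi0D l2D hx // hy // addr0.
- by move=> x y hx hy f h i; rewrite pi0M; apply: hx; apply: hy.
- by move=> k x hx f h i; rewrite pi0Z l2Z hx // mulr0.
Qed.

Lemma frame_op_ket j i s : frame_op j (ket R (i, s)) =
  frame_wgt q j (frame_swap j (i, s)) *: ket R (frame_swap j (i, s)).
Proof.
apply: l2P => k; rewrite frame_opE; last exact: ket_fin_supp.
rewrite /frame_raw l2Z !ketE.
have -> : (frame_swap j k == (i, s)) = (k == frame_swap j (i, s)).
  by apply/eqP/eqP => [<-|->]; rewrite frame_swapK.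
by case: eqVneq => [->|_]; rewrite ?mulr0.
Qed.

(** On a vector of one sheet, theta1 stays in the sheet, one of theta0 and theta2 leaves
    it, and the other vanishes.  As the representation preserves sheets, both remaining
    terms of a vanishing combination vanish separately.  The weights are nonzero, so
    faithfulness on a single sheet gives z_j = 0. *)
Lemma dirac_free : frame_free G.
Proof.
move=> z0 z1 z2 z.
have Q0 : Q != 0 := Q_neq0 hq.
have om0 n m : Omega q n m != 0 by rewrite mulf_neq0 ?expf_neq0 // (qpowN_neq0 hq).
have i0 : iC != 0 by exact: neq0Ci.
have e i s : pi z0 (frame_op j0 (ket R (i, s))) + pi z1 (frame_op j1 (ket R (i, s))) +
     pi z2 (frame_op j2 (ket R (i, s))) = 0.
  rewrite -comb_val; last exact: ket_fin_supp.
  by rewrite z.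
have split2 (f g : V) s : f + g = 0 -> (forall i, f (i, s) = 0) ->
    (forall i, g (i, ~~ s) = 0) -> f = 0 /\ g = 0.
  move=> fg hf hg; have fg' k : f k + g k = 0 by rewrite -l2D fg.
  split; apply: l2P => -[k s']; rewrite l2_0; case: (eqVneq s' s) => [->|ss'] //.
  - have := fg' (k, s'); suff -> : s' = ~~ s by rewrite hg addr0.
    by case: s s' ss' {hf hg} => -[].
  - by have := fg' (k, s); rewrite hf add0r.
  - by suff -> : s' = ~~ s by []; case: s s' ss' {hf hg} => -[].
have ksh x k (i : nat * int) s j : pi x (k *: ket R (i, s)) (j, ~~ s) = 0.
  apply: pi0_sheet => j'; rewrite l2Z ketE xpair_eqE /=.
  by case: s; rewrite andbF mulr0.
have fin x (k : nat * int -> C) s : (forall i, pi x (k i *: ket R (i, s)) = 0) ->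
    (forall i, k i != 0) -> x = 0.
  move=> h k0; apply: (pi0_faithful (hq := hq) (s := s)) => i.
  by apply: (scalerI (k0 i)); rewrite -pi0Zr h scaler0.
have w1 (i : nat * int) s : frame_wgt q j1 (i, s) != 0.
  by rewrite /frame_wgt /= mulf_neq0 ?expf_neq0.
have w0 (i : nat * int) : frame_wgt q j0 (i, false) != 0.
  by rewrite /frame_wgt /= mulf_neq0.
have w2 (i : nat * int) : frame_wgt q j2 (i, true) != 0.
  by rewrite /frame_wgt /= mulf_neq0.
have T1 i s : frame_op j1 (ket R (i, s)) = frame_wgt q j1 (i, s) *: ket R (i, s).
  exact: frame_op_ket.
have T0 i s : frame_op j0 (ket R (i, s)) = frame_wgt q j0 (i, ~~ s) *: ket R (i, ~~ s).
  exact: frame_op_ket.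
have T2 i s : frame_op j2 (ket R (i, s)) = frame_wgt q j2 (i, ~~ s) *: ket R (i, ~~ s).
  exact: frame_op_ket.
have z1z2 i : pi z1 (frame_op j1 (ket R (i, false))) = 0 /\
    pi z2 (frame_op j2 (ket R (i, false))) = 0.
  have := e i false.
  rewrite T0 T1 T2 /= [frame_wgt q j0 (i, true)]/frame_wgt /= scale0r.
  have -> : pi z0 0 = 0 by rewrite -[X in pi z0 X](scale0r (0 : V)) pi0Zr scale0r.
  rewrite add0r => h; apply: (split2 _ _ true h) => k; exact: ksh.
split.
- apply: (fin _ (fun i => frame_wgt q j0 (i, false)) false) => // i.
  have := e i true; rewrite T0 T1 T2 /= [frame_wgt q j2 (i, false)]/frame_wgt /= scale0r.
  have -> : pi z2 0 = 0 by rewrite -[X in pi z2 X](scale0r (0 : V)) pi0Zr scale0r.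
  by rewrite addr0 => h; have [] := split2 _ _ true h (fun k => ksh _ _ _ _ _)
    (fun k => ksh _ _ _ _ _).
- apply: (fin _ (fun i => frame_wgt q j1 (i, false)) false) => // i.
  by have [h _] := z1z2 i; rewrite -T1.
- apply: (fin _ (fun i => frame_wgt q j2 (i, true)) true) => // i.
  by have [_ h] := z1z2 i; rewrite -(T2 i false).
Qed.

Lemma d_ket n m s : gen_op hq Gd (ket R (n, m, s)) = (ladder q n.+1)%:C *: ket R (n.+1, m, s).
Proof.
apply: l2P => -[[n' m'] s']; rewrite gen_opE l2Z !ketE /gen_wgt /gen_shift /=.
rewrite !xpair_eqE; case: n' => [|n']; first by rewrite ladder0 mulr0 mul0r.
by rewrite /= eqSS; case: (n' =P n) => [->|_]; rewrite ?mulr0.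
Qed.

(** The scalar is the product of s_1, ..., s_n. *)
Lemma d_pow_ket n m s :
  exists2 k : C, k != 0 & pi (d ^+ n) (ket R (0%N, m, s)) = k *: ket R (n, m, s).
Proof.
have [_ _ _ gd] := pi0_gen hq; elim: n => [|n [k k0 IH]].
  by exists 1; rewrite ?oner_neq0 // expr0 pi0_1 scale1r.
exists (k * (ladder q n.+1)%:C); last by rewrite exprS pi0M IH pi0Zr gd d_ket scalerA.
by rewrite mulf_neq0 // -[0]/(0%:C) (inj_eq (@complexI _)) gt_eqF // (ladder_gt0 hq).
Qed.

Lemma dirac_admissible : admissible P.
Proof.
have [ga gb gc gd] := pi0_gen hq.
pose D0 : set V := [set u | fin_supp u /\ forall n m s, u (n.+1, m, s) = 0].
exists [set 0], D0; split.
- by split=> // k u v -> ->; rewrite scaler0 addr0.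
- split; first by split; [exact: (fin_supp_subspace R I).1|].
  move=> k u v [fu u0] [fv v0]; split; first exact: (fin_supp_subspace R I).2.
  by move=> n m s; rewrite l2E u0 v0 mulr0 addr0.
- move=> u ->; split; first exact: (bilin0r (pi0_bilin hq)).
  + exact: (bilin0r (pi0_bilin hq)).
  + exact: (bilin0r (pi0_bilin hq)).
- move=> u [fu u0]; split.
  + rewrite /= ga; apply: l2P => -[[n m] s]; rewrite gen_opE l2_0 /gen_shift /=.
    by rewrite u0 mulr0.
  + split; first exact: pi0_fin_supp.
    by move=> n m s; rewrite /= gb gen_opE /gen_shift /= u0 mulr0.
  + split; first exact: pi0_fin_supp.
    by move=> n m s; rewrite /= gc gen_opE /gen_shift /= u0 mulr0.
split=> //; apply/seteqP; split=> u /=.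
  move=> /fin_supp_ket[r _ ->]; exists 0 => //; exists (trunc u r); last by rewrite add0r.
  exists [seq (u i, ket R i) | i <- r]; split; last by rewrite big_map.
  move=> p /mapP[[[n m] s] _ ->] /=; have [k k0 e] := d_pow_ket n m s.
  exists n, (k^-1 *: ket R (0%N, m, s)); last first.
    by rewrite pi0Zr e scalerA mulVf // scale1r.
  split; first exact/fin_suppZ/ket_fin_supp.
  by move=> n' m' s'; rewrite l2Z ketE !xpair_eqE /= mulr0.
move=> [e ->] [v [r [hr ->]] <-]; rewrite add0r.
elim: r hr => [|p r IH] hr; first by rewrite big_nil; exact: (fin_supp_subspace R I).1.
rewrite big_cons; apply: (fin_supp_subspace R I).2.
  have [n [w [fw _] ->]] := hr p (mem_head _ _).
  exact: pi0_fin_supp.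
by apply: IH => p' p'r; apply: hr; rewrite in_cons p'r orbT.
Qed.
End DiracStructure.

Theorem mainTheorem4 (R : realType) (q : R) (hq : 0 < q < 1)
    (Gamma : star_fodc (SUq2_star hq)) (h3D : is_calc3D Gamma) :
  exists P : comm_pair (SUq2_star hq),
    admissible P /\ faithful_commutator_rep Gamma P.
Proof.
exists (dirac_pair hq); split; first exact: dirac_admissible.
have [hcov hid] := h3D.
have [rho rhoh rhoi] := structure_hom (@calc3D_structure R q hq _ hid) (@dirac_structure R q hq)
  (@calc3D_free R q hq _ hid hcov) (@dirac_free R q hq).
by exists rho => //; apply: fodc_hom_star.
Qed.
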